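(* For any fixed $0<\delta\le2\pi$, $$\Gamma(z,z)\sim\sqrt{\frac\pi2}\,z^{z-\frac12}e^{-z}\sum_{n=0}^\infty\frac{a_n}{z^{\frac n2}}$$ as $z\to\infty$ in the sector $|\arg z|\le2\pi-\delta<2\pi$, in the sense of Poincar\'e asymptotic expansions.
   Context: $\Gamma(a,z)=\int_z^{+\infty}t^{a-1}e^{-t}\,dt$ ($|\arg z|<\pi$) is the upper incomplete gamma function, continued analytically in $z$ to the Riemann surface of the logarithm (so $\Gamma(a,ze^{2\pi im})=e^{2\pi ima}\Gamma(a,z)+(1-e^{2\pi ima})\Gamma(a)$, $m\in\mathbb Z$); $\Gamma(z,z)$ and powers of $z$ are continued analytically from the positive real axis. The coefficients are $$a_n=\frac{1}{2^{n/2}\Gamma(\frac n2+1)}\left[\frac{d^n}{dt^n}\left(\frac12\frac{t^2}{e^t-t-1}\right)^{\frac{n+1}2}\right]_{t=0},$$ with the branch of the power equal to $1$ at $t=0$. *)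

(* Defs.v *)
From Stdlib Require Import Reals.
From Coquelicot Require Import Coquelicot.
Open Scope R_scope.

Definition Cexp (z : C) : C := (exp (Re z) * cos (Im z), exp (Re z) * sin (Im z)).

(** Points of the Riemann surface of the logarithm.  The argument is an
    arbitrary real number: arguments differing by [2 * PI] give different
    points above the same complex number. *)
Record logsurf : Type := LogPoint {
  modulus : R;
  argument : R;
  modulus_gt0 : 0 < modulus }.

Definition surf_log (z : logsurf) : C := (ln (modulus z), argument z).

Definition proj (z : logsurf) : C :=
  (modulus z * cos (argument z), modulus z * sin (argument z)).

Definition surf_pow (z : logsurf) (a : C) : C := Cexp (a * surf_log z)%C.

(** The same circle [|t| = |z|], at argument [phi]. *)
Definition with_argument (z : logsurf) (phi : R) : logsurf :=
  LogPoint (modulus z) phi (modulus_gt0 z).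

(** [t ^ (a-1) * exp (-t)], as a function on the surface. *)
Definition gamma_integrand (a : C) (t : logsurf) : C :=
  (surf_pow t (a - 1) * Cexp (- proj t))%C.

(** [Gamma (a, z)], the integral of [t ^ (a-1) * exp (-t)] from [z] to
    [+oo] taken on the Riemann surface of the logarithm.  The integrand is
    holomorphic there and the surface is simply connected, so the path is
    immaterial; we follow the arc [t = |z| e^(i phi)] from [z] to [|z|] (where
    [dt = i t dphi]) and then the positive real axis.  For [|arg z| < PI] this
    path avoids the cut, so the value is the principal one; for other arguments
    it is the analytic continuation of the principal value along the arc.  On
    the positive axis, [t ^ (a-1) = exp ((a-1) ln t)]. *)
Definition upper_gamma (a : C) (z : logsurf) : C :=
  (RInt (V := C_R_CompleteNormedModule)
     (fun phi : R => let t := with_argument z phi in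
                     gamma_integrand a t * (Ci * proj t))
     (argument z) 0
   + RInt_gen (V := C_R_CompleteNormedModule)
       (fun t : R => Cexp ((a - 1) * RtoC (ln t)) * Cexp (- RtoC t))
       (at_point (modulus z)) (Rbar_locally p_infty))%C.

(** Euler's Gamma function, for [0 < x]. *)
Definition Gamma (x : R) : R :=
  RInt_gen (V := R_CompleteNormedModule)
    (fun t => Rpower t (x - 1) * exp (- t)) (at_right 0) (Rbar_locally p_infty).

(** [t^2 / (2 (e^t - t - 1))] with its removable singularity at [0] filled in.
    It is positive on the real line, so the branch of its powers equal to [1]
    at [0] is the real power [Rpower]. *)
Definition phi_base (t : R) : R :=
  if Req_EM_T t 0 then 1 else 1 / 2 * (t ^ 2 / (exp t - t - 1)).

Definition coef (n : nat) : R :=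
  1 / (Rpower 2 (INR n / 2) * Gamma (INR n / 2 + 1))
  * Derive_n (fun t => Rpower (phi_base t) ((INR n + 1) / 2)) n 0.

(** [F z ~ sum_n c_n / z^(n/2)] in the sense of Poincare, as [z -> oo] in the
    subset [S] of the surface: each truncation error is of the order of the
    first omitted power, uniformly in [S]. *)
Definition poincare_expansion (S : logsurf -> Prop) (F : logsurf -> C)
    (c : nat -> C) : Prop :=
  forall N : nat, exists K r0 : R, 0 < r0 /\
    forall z : logsurf, S z -> r0 <= modulus z ->
      Cmod (F z - sum_n (fun n => c n / surf_pow z (RtoC (INR n / 2))) N)%C
      <= K * Rpower (modulus z) (- (INR (N + 1) / 2)).

(* Main.v *)
Require Import Defs.
From Stdlib Require Import Reals.
From Coquelicot Require Import Coquelicot.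
From Stdlib Require Import Lra Lia List Factorial.
Open Scope R_scope.

(** Put [z = r e^(i th)], [s = log z] on the surface, and [g w = e^w - w - 1].  In the
    logarithmic variable [t = e^(s + w)] the integrand of [Gamma (z, z)] becomes the
    entire function [z^z e^(-z) e^(-z g w)], and the path of integration becomes the
    vertical segment from [0] to [- i th] followed by the horizontal half-line to
    [+oo - i th].  Hence [Gamma (z, z) = z^z e^(-z) G], where [G] is the limit at
    [+oo - i th] of the primitive of [e^(-z g)] vanishing at [0]
    ([upper_gamma_limit], on top of the path independence [Cderiv_radial_primitive]).

    Path independence allows another path.  Leave the saddle point [0] along its direction
    of steepest descent, the ray [w = e^(-i th / 2) u] with [u >= 0], until it meets
    the line [Im w = - th], and follow that line to infinity.  For [|th| < 2 PI] the
    real part of [z g] increases along this part of the ray, because its derivative is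
    [r (e^(u cos b) cos (b - u sin b) - cos b)] with [b = th / 2]
    ([ray_height_increasing]), and on the line it stays above a positive
    multiple of [r], uniformly for [|th| <= 2 PI - delta] ([line_height_lower_bound]).  So
    only a fixed neighbourhood of [0] on the ray matters, up to an exponentially
    small error ([tail_bound]).

    Near [0] write [g = W^2 / 2] with [W w = w + ...].  If [1 = W' * sum_n b_n W^n], then
    the integral is, up to small errors, [sum_n b_n] times the integrals of
    [W^n e^(-z W^2 / 2) dW], which are Gaussian moments times [z^(-(n+1)/2)]
    ([gauss_primitive_moment]).  Analytic inverse functions are avoided by taking for
    [W] a Taylor polynomial with real coefficients.  The two estimates needed are
    [g - W^2 / 2 = O(w^(N+3))] and [1 - W' * sum_n b_n W^n = O(w^(N+1))]; they are
    proved on the positive real axis by real Taylor expansions and transferred to complex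
    [w], since a polynomial that is [O(t^k)] on the positive axis is divisible by
    the [k]-th power of its variable ([evalC_bigO], [polynomial_uniformizer]).  Comparing
    derivatives of the two sides along the ray gives [local_expansion].

    Lagrange inversion identifies [b_n] with the coefficient of [t^n] in
    [(t^2 / (2 (e^t - t - 1)))^((n+1)/2)] ([lagrange_remainder_bigO]), and the duplication
    formula in the form [moment_prod], together with the values [Gamma_half], turns
    [b_n] times the [n]-th moment into [coef n * sqrt (PI / 2)] ([coef_moment]). *)

(** * Calculus of complex-valued functions of a real variable *)

Lemma C_eq (x y : C) : Re x = Re y -> Im x = Im y -> x = y.
Proof. destruct x, y; simpl; intros -> ->; reflexivity. Qed.

(** Differentiation and continuity of complex curves are taken coordinate by coordinate, so that
    the calculus of real-valued functions applies directly. *)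
Definition Cderiv (g : R -> C) (t : R) (d : C) : Prop :=
  is_derive (fun s => Re (g s)) t (Re d) /\ is_derive (fun s => Im (g s)) t (Im d).

Definition Ccont {U : UniformSpace} (u : U -> C) (x : U) : Prop :=
  continuous (fun y => Re (u y)) x /\ continuous (fun y => Im (u y)) x.

Lemma Cderiv_eq g t d d' : Cderiv g t d -> d = d' -> Cderiv g t d'.
Proof. intros H <-; exact H. Qed.

Lemma Cderiv_ext f g t d : (forall s, f s = g s) -> Cderiv f t d -> Cderiv g t d.
Proof.
  intros E [H1 H2]; split; (eapply is_derive_ext; [intros s; rewrite <- E; reflexivity | assumption]).
Qed.

Lemma Cderiv_const c t : Cderiv (fun _ => c) t 0%C.
Proof. split; apply @is_derive_const. Qed.

Lemma Cderiv_RtoC f t d : is_derive f t d -> Cderiv (fun s => RtoC (f s)) t (RtoC d).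
Proof. intros H; split; simpl; [exact H | apply @is_derive_const]. Qed.

Lemma Cderiv_id t : Cderiv (fun s => RtoC s) t 1%C.
Proof. apply Cderiv_RtoC, @is_derive_id. Qed.

Lemma Cderiv_plus f g t a b :
  Cderiv f t a -> Cderiv g t b -> Cderiv (fun s => (f s + g s)%C) t (a + b)%C.
Proof.
  intros [f1 f2] [g1 g2]; split; simpl; now apply @is_derive_plus.
Qed.

Lemma Cderiv_opp f t a : Cderiv f t a -> Cderiv (fun s => (- f s)%C) t (- a)%C.
Proof. intros [f1 f2]; split; simpl; now apply @is_derive_opp. Qed.

Lemma Cderiv_minus f g t a b :
  Cderiv f t a -> Cderiv g t b -> Cderiv (fun s => (f s - g s)%C) t (a - b)%C.
Proof. intros; apply Cderiv_plus; [assumption | now apply Cderiv_opp]. Qed.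

Lemma is_derive_Rmult (f g : R -> R) t a b :
  is_derive f t a -> is_derive g t b -> is_derive (fun s => f s * g s) t (a * g t + f t * b).
Proof. intros H1 H2. apply (is_derive_mult f g t a b H1 H2). intros; apply Rmult_comm. Qed.

Lemma is_derive_eq (f : R -> R) t a b : is_derive f t a -> a = b -> is_derive f t b.
Proof. intros H <-; exact H. Qed.

Lemma Cderiv_mult f g t a b :
  Cderiv f t a -> Cderiv g t b ->
  Cderiv (fun s => (f s * g s)%C) t (a * g t + f t * b)%C.
Proof.
  intros [f1 f2] [g1 g2]; split; simpl.
  - eapply is_derive_eq.
    + apply @is_derive_minus; apply is_derive_Rmult; eassumption.
    + unfold minus, plus, opp; simpl; unfold Re, Im; ring.
  - eapply is_derive_eq.
    + apply @is_derive_plus; apply is_derive_Rmult; eassumption.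
    + unfold minus, plus, opp; simpl; unfold Re, Im; ring.
Qed.

Lemma Cderiv_scal c g t b : Cderiv g t b -> Cderiv (fun s => (c * g s)%C) t (c * b)%C.
Proof.
  intros H. eapply Cderiv_eq.
  - apply Cderiv_mult; [apply Cderiv_const | exact H].
  - rewrite Cmult_0_l, Cplus_0_l. reflexivity.
Qed.

Lemma Cderiv_Cexp f t a :
  Cderiv f t a -> Cderiv (fun s => Cexp (f s)) t (a * Cexp (f t))%C.
Proof.
  intros [f1 f2]; split; simpl.
  - eapply is_derive_eq.
    + apply is_derive_Rmult.
      * apply (is_derive_comp exp); [apply is_derive_exp | exact f1].
      * apply (is_derive_comp cos); [apply is_derive_cos | exact f2].
    + unfold scal, mult; simpl; unfold mult; simpl. unfold Re, Im; ring.
  - eapply is_derive_eq.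
    + apply is_derive_Rmult.
      * apply (is_derive_comp exp); [apply is_derive_exp | exact f1].
      * apply (is_derive_comp sin); [apply is_derive_sin | exact f2].
    + unfold scal, mult; simpl; unfold mult; simpl. unfold Re, Im; ring.
Qed.

Lemma Cderiv_comp (f : R -> C) (h : R -> R) t a b :
  Cderiv f (h t) a -> is_derive h t b -> Cderiv (fun s => f (h s)) t (RtoC b * a)%C.
Proof.
  intros [f1 f2] H; split; simpl.
  - eapply is_derive_eq; [apply (is_derive_comp (fun s => Re (f s))); eassumption|].
    unfold scal; simpl; unfold mult; simpl; unfold Re, Im; ring.
  - eapply is_derive_eq; [apply (is_derive_comp (fun s => Im (f s))); eassumption|].
    unfold scal; simpl; unfold mult; simpl; unfold Re, Im; ring.
Qed.

Lemma Cderiv_cont g t d : Cderiv g t d -> Ccont g t.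
Proof. intros [H1 H2]; split; apply @ex_derive_continuous; eexists; eassumption. Qed.

Section Continuity.
Context {U : UniformSpace}.
Implicit Types (u v : U -> C) (x : U).

Lemma Ccont_const c x : Ccont (fun _ : U => c) x.
Proof. split; apply continuous_const. Qed.

Lemma Ccont_RtoC (h : U -> R) x : continuous h x -> Ccont (fun y => RtoC (h y)) x.
Proof. intros H; split; [exact H | apply continuous_const]. Qed.

Lemma Ccont_plus u v x : Ccont u x -> Ccont v x -> Ccont (fun y => (u y + v y)%C) x.
Proof. intros [a b] [c d]; split; simpl; now apply @continuous_plus. Qed.

Lemma Ccont_opp u x : Ccont u x -> Ccont (fun y => (- u y)%C) x.
Proof. intros [a b]; split; simpl; now apply @continuous_opp. Qed.

Lemma Ccont_minus u v x : Ccont u x -> Ccont v x -> Ccont (fun y => (u y - v y)%C) x.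
Proof. intros; apply Ccont_plus; [|apply Ccont_opp]; assumption. Qed.

Lemma Ccont_mult u v x : Ccont u x -> Ccont v x -> Ccont (fun y => (u y * v y)%C) x.
Proof.
  intros [a b] [c d]; split; simpl.
  - apply @continuous_minus; apply @continuous_mult; assumption.
  - apply @continuous_plus; apply @continuous_mult; assumption.
Qed.

Lemma Ccont_Cexp u x : Ccont u x -> Ccont (fun y => Cexp (u y)) x.
Proof.
  intros [a b]; split; simpl; apply @continuous_mult.
  - apply (continuous_comp _ exp); [exact a | apply continuous_exp].
  - apply (continuous_comp _ cos); [exact b | apply continuous_cos].
  - apply (continuous_comp _ exp); [exact a | apply continuous_exp].
  - apply (continuous_comp _ sin); [exact b | apply continuous_sin].
Qed.
End Continuity.

Lemma Ccont_comp {U V : UniformSpace} (u : V -> C) (h : U -> V) x :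
  continuous h x -> Ccont u (h x) -> Ccont (fun y => u (h y)) x.
Proof. intros H [a b]; split; [apply (continuous_comp h (fun y => Re (u y))) | apply (continuous_comp h (fun y => Im (u y)))]; assumption. Qed.

Lemma is_derive_pair (g : R -> C) t d :
  Cderiv g t d -> is_derive (V := C_R_NormedModule) g t d.
Proof.
  intros [H1 H2].
  apply is_derive_ext with (fun s => plus (scal (Re (g s)) ((1,0) : C_R_NormedModule)) (scal (Im (g s)) ((0,1) : C_R_NormedModule))).
  { intros s. apply C_eq; simpl; unfold scal; simpl; unfold mult; simpl; unfold plus; simpl; unfold Re, Im; ring. }
  replace d with (plus (scal (Re d) ((1,0) : C_R_NormedModule)) (scal (Im d) ((0,1) : C_R_NormedModule))).
  2:{ apply C_eq; simpl; unfold scal; simpl; unfold mult; simpl; unfold plus; simpl; unfold Re, Im; ring. }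
  apply @is_derive_plus; apply @is_derive_scal_l; assumption.
Qed.

Lemma continuous_pair (g : R -> C) t :
  Ccont g t -> continuous (U := C_R_NormedModule) g t.
Proof.
  intros [H1 H2]. apply filterlim_locally. intros eps.
  generalize (proj1 (filterlim_locally _ _) H1 eps); intros K1.
  generalize (proj1 (filterlim_locally _ _) H2 eps); intros K2.
  generalize (filter_and _ _ K1 K2). apply filter_imp. intros s [a b]; split; assumption.
Qed.

(** The fundamental theorem of calculus in the module structure in which the contour integrals
    are stated. *)
Lemma is_RInt_Cderiv (g d : R -> C) a b :
  (forall t, Rmin a b <= t <= Rmax a b -> Cderiv g t (d t)) ->
  (forall t, Rmin a b <= t <= Rmax a b -> Ccont d t) ->
  is_RInt (V := C_R_NormedModule) d a b (g b - g a)%C.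
Proof.
  intros H1 H2. apply (is_RInt_derive (V := C_R_CompleteNormedModule) g d).
  - intros; now apply is_derive_pair, H1.
  - intros; now apply continuous_pair, H2.
Qed.

Lemma Re_le_Cmod (c : C) : Re c <= Cmod c.
Proof. eapply Rle_trans; [apply Rle_abs | apply re_le_Cmod]. Qed.

(** Let [u] be the increment of [g].  The real mean value theorem applies to
    [|u| m - Re (conj u * g)], whose derivative is nonnegative.  The majorant [m] of the
    arc length takes the place of an integral of [Cmod (d t)]. *)
Lemma Cmean_value (g d : R -> C) (m m' : R -> R) a b :
  a <= b ->
  (forall t, a <= t <= b -> Cderiv g t (d t)) ->
  (forall t, a <= t <= b -> is_derive m t (m' t)) ->
  (forall t, a <= t <= b -> Cmod (d t) <= m' t) ->
  Cmod (g b - g a)%C <= m b - m a.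
Proof.
  intros Hab Hg Hm Hd.
  set (u := (g b - g a)%C).
  destruct (Rle_lt_dec (Cmod u) 0) as [Hu|Hu].
  { apply Rle_trans with 0; [exact Hu|].
    destruct (MVT_gen m a b m') as [c [Hc E]].
    - intros x Hx; apply Hm; rewrite Rmin_left, Rmax_right in Hx by lra; lra.
    - intros x Hx. rewrite Rmin_left, Rmax_right in Hx by lra.
      apply derivable_continuous_pt. eexists. apply is_derive_Reals, Hm; lra.
    - rewrite E. rewrite Rmin_left, Rmax_right in Hc by lra.
      generalize (Hd c Hc) (Cmod_ge_0 (d c)); nra. }
  set (k := fun t => Cmod u * m t - Re (Cconj u * g t)%C).
  set (k' := fun t => Cmod u * m' t - Re (Cconj u * d t)%C).
  assert (Hk : forall t, a <= t <= b -> is_derive k t (k' t)).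
  { intros t Ht. unfold k, k'. apply @is_derive_minus.
    - apply @is_derive_scal, Hm; exact Ht.
    - apply (proj1 (Cderiv_scal (Cconj u) g t (d t) (Hg t Ht))). }
  destruct (MVT_gen k a b k') as [c [Hc E]].
  - intros x Hx; apply Hk; rewrite Rmin_left, Rmax_right in Hx by lra; lra.
  - intros x Hx. rewrite Rmin_left, Rmax_right in Hx by lra.
    apply derivable_continuous_pt. eexists. apply is_derive_Reals, Hk; lra.
  - rewrite Rmin_left, Rmax_right in Hc by lra.
    assert (0 <= k' c).
    { unfold k'. apply Rle_trans with (Cmod u * m' c - Cmod (Cconj u * d c)%C).
      - rewrite Cmod_mult, Cmod_conj. generalize (Hd c Hc); nra.
      - generalize (Re_le_Cmod (Cconj u * d c)%C); lra. }
    assert (Hk2 : 0 <= k b - k a) by (rewrite E; nra).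
    unfold k in Hk2.
    assert (Re (Cconj u * g b)%C - Re (Cconj u * g a)%C = Cmod u ^ 2).
    { rewrite Cmod2_alt. unfold u. simpl; unfold Re, Im; ring. }
    nra.
Qed.

Lemma Cmean_value_const (g d : R -> C) M a b :
  a <= b ->
  (forall t, a <= t <= b -> Cderiv g t (d t)) ->
  (forall t, a <= t <= b -> Cmod (d t) <= M) ->
  Cmod (g b - g a)%C <= M * (b - a).
Proof.
  intros Hab Hg Hd.
  replace (M * (b - a)) with (M * b - M * a) by ring.
  apply (Cmean_value g d (fun t => M * t) (fun _ => M)); try assumption.
  intros t _. auto_derive; [exact I | ring].
Qed.

Lemma Cexp_plus (a b : C) : Cexp (a + b)%C = (Cexp a * Cexp b)%C.
Proof.
  apply C_eq; simpl; unfold Re, Im; simpl; rewrite exp_plus, ?cos_plus, ?sin_plus; ring.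
Qed.

Lemma Cexp_0 : Cexp 0%C = 1%C.
Proof. apply C_eq; simpl; rewrite exp_0, ?cos_0, ?sin_0; ring. Qed.

Lemma Cmod_Cexp a : Cmod (Cexp a) = exp (Re a).
Proof.
  unfold Cmod, Cexp; simpl fst; simpl snd.
  replace (_ ^ 2 + _ ^ 2) with (exp (Re a) ^ 2).
  - apply sqrt_pow2, Rlt_le, exp_pos.
  - generalize (sin2_cos2 (Im a)); unfold Rsqr; nra.
Qed.

Lemma Cexp_neq_0 a : Cexp a <> 0%C.
Proof.
  intros H. apply (f_equal Cmod) in H. rewrite Cmod_Cexp, Cmod_0 in H.
  generalize (exp_pos (Re a)); lra.
Qed.

Lemma Cexp_opp a : Cexp (- a)%C = (/ Cexp a)%C.
Proof.
  assert (H : (Cexp (- a) * Cexp a)%C = 1%C).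
  { rewrite <- Cexp_plus, <- Cexp_0. f_equal; ring. }
  rewrite <- (Cmult_1_l (/ Cexp a)%C), <- H. field. apply Cexp_neq_0.
Qed.

Lemma Cexp_RtoC x : Cexp (RtoC x) = RtoC (exp x).
Proof. apply C_eq; simpl; rewrite ?cos_0, ?sin_0; ring. Qed.

(** Mean value inequality on the segment from [b] to [a], where the real part is at most [m]. *)
Lemma Cexp_diff_le (a b : C) m :
  Re a <= m -> Re b <= m -> Cmod (Cexp a - Cexp b)%C <= Cmod (a - b)%C * exp m.
Proof.
  intros Ha Hb.
  set (g := fun t : R => (b + RtoC t * (a - b))%C).
  replace (Cexp a) with (Cexp (g 1)) by (f_equal; unfold g; ring).
  replace (Cexp b) with (Cexp (g 0)) by (f_equal; unfold g; ring).
  replace (Cmod (a - b) * exp m) with (Cmod (a - b) * exp m * (1 - 0)) by ring.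
  apply (Cmean_value_const (fun t => Cexp (g t)) (fun t => (a - b) * Cexp (g t))%C).
  - lra.
  - intros t _. apply Cderiv_Cexp. unfold g. eapply Cderiv_eq.
    + apply Cderiv_plus; [apply Cderiv_const | apply Cderiv_mult; [apply Cderiv_id | apply Cderiv_const]].
    + cbv beta; ring.
  - intros t Ht. rewrite Cmod_mult, Cmod_Cexp.
    apply Rmult_le_compat_l; [apply Cmod_ge_0|].
    assert (Re (g t) <= m).
    { unfold g; simpl; unfold Re, Im in *; simpl; nra. }
    destruct (Rle_lt_or_eq_dec _ _ H) as [H'| ->]; [|lra].
    apply Rlt_le, exp_increasing, H'.
Qed.

(** * Primitives of entire functions *)

Lemma is_derive_RInt_param_global (F dF : R -> R -> R) a b u :
  (forall u v, is_derive (fun s => F s v) u (dF u v)) ->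
  (forall u v, continuous (fun p : R * R => dF (fst p) (snd p)) (u, v)) ->
  (forall u v, continuous (F u) v) ->
  is_derive (fun s => RInt (F s) a b) u (RInt (dF u) a b).
Proof.
  intros HF HdF Hc.
  replace (RInt (dF u) a b) with (RInt (fun v => Derive (fun s => F s v) u) a b).
  2:{ apply RInt_ext; intros v _. apply is_derive_unique, HF. }
  apply is_derive_RInt_param.
  - apply filter_forall. intros s v _. eexists; apply HF.
  - intros v _. apply continuity_2d_pt_ext with dF.
    + intros s w. symmetry; apply is_derive_unique, HF.
    + apply continuity_2d_pt_filterlim, HdF.
  - apply filter_forall. intros s. apply (ex_RInt_continuous (V := R_CompleteNormedModule)).
    intros v _; apply Hc.
Qed.

Definition Cint (f : R -> C) (a b : R) : C :=
  (RInt (fun t => Re (f t)) a b, RInt (fun t => Im (f t)) a b).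

Definition is_Cint (f : R -> C) (a b : R) (l : C) : Prop :=
  is_RInt (fun t => Re (f t)) a b (Re l) /\ is_RInt (fun t => Im (f t)) a b (Im l).

Lemma Cint_unique f a b l : is_Cint f a b l -> Cint f a b = l.
Proof. intros [H1 H2]; apply C_eq; simpl; now apply is_RInt_unique. Qed.

Lemma is_Cint_continuous f a b : (forall t, Ccont f t) -> is_Cint f a b (Cint f a b).
Proof.
  intros H; split; simpl; apply (RInt_correct (V := R_CompleteNormedModule));
  apply (ex_RInt_continuous (V := R_CompleteNormedModule)); intros t _; apply H.
Qed.

Lemma is_Cint_plus f g a b lf lg :
  is_Cint f a b lf -> is_Cint g a b lg ->
  is_Cint (fun t => (f t + g t)%C) a b (lf + lg)%C.
Proof. intros [f1 f2] [g1 g2]; split; simpl; now apply (is_RInt_plus (V := R_NormedModule)). Qed.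

Lemma is_Cint_scal c f a b l :
  is_Cint f a b l -> is_Cint (fun t => (c * f t)%C) a b (c * l)%C.
Proof.
  intros [f1 f2]; split; simpl.
  - apply (is_RInt_minus (V := R_NormedModule)); now apply (is_RInt_scal (V := R_NormedModule)).
  - apply (is_RInt_plus (V := R_NormedModule)); now apply (is_RInt_scal (V := R_NormedModule)).
Qed.

Lemma is_Cint_ext f g a b l : (forall t, f t = g t) -> is_Cint f a b l -> is_Cint g a b l.
Proof.
  intros E [H1 H2]; split; (eapply is_RInt_ext; [intros t _; rewrite <- E; reflexivity | assumption]).
Qed.

Lemma is_Cint_Cderiv (g d : R -> C) a b :
  (forall t, Cderiv g t (d t)) -> (forall t, Ccont d t) -> is_Cint d a b (g b - g a)%C.
Proof.
  intros H1 H2; split; simpl.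
  - apply (is_RInt_derive (fun t => Re (g t))); intros; [apply H1 | apply H2].
  - apply (is_RInt_derive (fun t => Im (g t))); intros; [apply H1 | apply H2].
Qed.

Lemma Cderiv_Cint_param (F dF : R -> R -> C) a b u :
  (forall u v, Cderiv (fun s => F s v) u (dF u v)) ->
  (forall u v, Ccont (fun p : R * R => dF (fst p) (snd p)) (u, v)) ->
  (forall u v, Ccont (F u) v) ->
  Cderiv (fun s => Cint (F s) a b) u (Cint (dF u) a b).
Proof.
  intros HF HdF Hc; split; simpl.
  - apply (is_derive_RInt_param_global (fun s v => Re (F s v)) (fun s v => Re (dF s v)));
    intros; [apply HF | apply HdF | apply Hc].
  - apply (is_derive_RInt_param_global (fun s v => Im (F s v)) (fun s v => Im (dF s v)));
    intros; [apply HF | apply HdF | apply Hc].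
Qed.

(** Complex differentiability expressed through substitution: [f'] gives the chain rule along
    every curve, and both functions preserve continuity of maps into the plane. *)
Record entire (f f' : C -> C) : Prop := Entire {
  entire_deriv : forall g t d, Cderiv g t d -> Cderiv (fun s => f (g s)) t (d * f' (g t))%C;
  entire_cont : forall (U : UniformSpace) (u : U -> C) x, Ccont u x -> Ccont (fun y => f (u y)) x;
  entire_cont' : forall (U : UniformSpace) (u : U -> C) x, Ccont u x -> Ccont (fun y => f' (u y)) x }.

(** The integral of [f] along the segment from [0] to [w]. *)
Definition radial_primitive (f : C -> C) (w : C) : C :=
  (w * Cint (fun s => f (RtoC s * w)) 0 1)%C.

Lemma radial_primitive_0 f : radial_primitive f 0%C = 0%C.
Proof. apply Cmult_0_l. Qed.

(** Cauchy's theorem in the form that is needed: the radial integral is a primitive of [f] along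
    every continuously differentiable curve.  Differentiation under the integral sign produces
    the integrand [f (s w) + w s f' (s w)], which is the derivative of [s f (s w)]. *)
Lemma Cderiv_radial_primitive f f' (g g' : R -> C) :
  entire f f' -> (forall t, Cderiv g t (g' t)) -> (forall t, Ccont g' t) ->
  forall t, Cderiv (fun s => radial_primitive f (g s)) t (g' t * f (g t))%C.
Proof.
  intros Hf Hg Hg' t.
  assert (Hgc : forall t, Ccont g t) by (intros; eapply Cderiv_cont, Hg).
  assert (Hray : forall w v, Ccont (fun s : R => (RtoC s * w)%C) v).
  { intros w v. apply Ccont_mult; [apply Ccont_RtoC, continuous_id | apply Ccont_const]. }
  assert (Hint : is_Cint (fun s => f (RtoC s * g t) + g t * (RtoC s * f' (RtoC s * g t)))%C 0 1 (f (g t))).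
  { replace (f (g t)) with (RtoC 1 * f (RtoC 1 * g t) - RtoC 0 * f (RtoC 0 * g t))%C
      by (rewrite !Cmult_1_l; ring).
    apply (is_Cint_Cderiv (fun s => RtoC s * f (RtoC s * g t))%C).
    - intros s. eapply Cderiv_eq.
      + apply Cderiv_mult; [apply Cderiv_id|].
        apply (entire_deriv _ _ Hf). apply Cderiv_mult; [apply Cderiv_id | apply Cderiv_const].
      + cbv beta; ring.
    - intros s. apply Ccont_plus.
      + apply (entire_cont _ _ Hf), Hray.
      + apply Ccont_mult; [apply Ccont_const|].
        apply Ccont_mult; [apply Ccont_RtoC, continuous_id|].
        apply (entire_cont' _ _ Hf), Hray. }
  unfold radial_primitive. eapply Cderiv_eq.
  - apply Cderiv_mult; [apply Hg|].
    apply (Cderiv_Cint_param (fun u v => f (RtoC v * g u)%C)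
             (fun u v => RtoC v * g' u * f' (RtoC v * g u))%C).
    + intros u v. eapply Cderiv_eq.
      * apply (entire_deriv _ _ Hf). apply Cderiv_scal, Hg.
      * reflexivity.
    + intros u v.
      assert (H1 : Ccont (fun p : R * R => RtoC (snd p)) (u, v))
        by (apply Ccont_RtoC; apply continuous_snd).
      assert (H2 : forall k, (forall t, Ccont k t) -> Ccont (fun p : R * R => k (fst p)) (u, v))
        by (intros k Hk; apply (Ccont_comp k (fun p : R * R => fst p)); [apply continuous_fst | apply Hk]).
      apply Ccont_mult; [apply Ccont_mult; [exact H1 | apply H2, Hg'] |].
      apply (entire_cont' _ _ Hf). apply Ccont_mult; [exact H1 | apply H2, Hgc].
    + intros u v. apply (entire_cont _ _ Hf), Hray.
  - cbv beta. rewrite <- (Cint_unique _ _ _ _ Hint).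
    set (A := fun s => f (RtoC s * g t)%C).
    set (B := fun s => (RtoC s * f' (RtoC s * g t))%C).
    assert (HA : is_Cint A 0 1 (Cint A 0 1)).
    { apply is_Cint_continuous. intros s; apply (entire_cont _ _ Hf), Hray. }
    assert (HB : is_Cint B 0 1 (Cint B 0 1)).
    { apply is_Cint_continuous. intros s.
      apply Ccont_mult; [apply Ccont_RtoC, continuous_id | apply (entire_cont' _ _ Hf), Hray]. }
    replace (Cint (fun s => f (RtoC s * g t) + g t * (RtoC s * f' (RtoC s * g t)))%C 0 1)
      with (Cint A 0 1 + g t * Cint B 0 1)%C
      by (symmetry; apply Cint_unique, (is_Cint_plus A (fun s => (g t * B s)%C));
          [exact HA | apply is_Cint_scal, HB]).
    fold A.
    replace (Cint (fun v => (RtoC v * g' t * f' (RtoC v * g t))%C) 0 1) with (g' t * Cint B 0 1)%C.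
    + ring.
    + symmetry. apply Cint_unique. eapply is_Cint_ext; [|apply (is_Cint_scal (g' t)), HB].
      intros s. unfold B. ring.
Qed.

(** * Taylor remainders of the exponential *)

Definition exp_rem (n : nat) (w : C) : C :=
  (Cexp w - sum_n (fun k => RtoC (/ INR (fact k)) * w ^ k)%C n)%C.

Lemma Cpow_S (w : C) n : (w ^ (S n))%C = (w * w ^ n)%C.
Proof. reflexivity. Qed.

Lemma Cderiv_pow g t d n :
  Cderiv g t d -> Cderiv (fun s => (g s ^ S n)%C) t (RtoC (INR (S n)) * g t ^ n * d)%C.
Proof.
  intros H. induction n as [|n IH].
  - apply (Cderiv_ext g); [intros s; simpl; ring|].
    eapply Cderiv_eq; [exact H | simpl; ring].
  - apply (Cderiv_ext (fun s => g s * g s ^ S n)%C); [intros s; reflexivity|].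
    eapply Cderiv_eq; [apply Cderiv_mult; [exact H | exact IH]|].
    cbv beta. rewrite (S_INR (S n)), RtoC_plus, !Cpow_S. ring.
Qed.

Lemma exp_rem_S n w : exp_rem (S n) w = (exp_rem n w - RtoC (/ INR (fact (S n))) * w ^ S n)%C.
Proof.
  unfold exp_rem. rewrite sum_Sn. unfold plus; simpl. unfold Cminus. ring.
Qed.

Lemma Cderiv_exp_rem n w t :
  Cderiv (fun s : R => exp_rem (S n) (RtoC s * w)%C) t (w * exp_rem n (RtoC t * w))%C.
Proof.
  assert (Hw : forall t, Cderiv (fun s : R => (RtoC s * w)%C) t w).
  { intros s; eapply Cderiv_eq; [apply Cderiv_mult; [apply Cderiv_id | apply Cderiv_const]|].
    cbv beta; ring. }
  induction n as [|n IH].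
  - apply (Cderiv_ext (fun s : R => Cexp (RtoC s * w) - (1 + RtoC s * w))%C).
    { intros s. unfold exp_rem. rewrite sum_Sn, sum_O. unfold plus; simpl.
      rewrite Rinv_1. unfold Cminus. f_equal. f_equal. rewrite !Cmult_1_r, !Cmult_1_l. reflexivity. }
    eapply Cderiv_eq.
    + apply Cderiv_minus; [apply Cderiv_Cexp, Hw | apply Cderiv_plus; [apply Cderiv_const | apply Hw]].
    + unfold exp_rem. rewrite sum_O. cbv beta. simpl. rewrite Rinv_1. ring.
  - apply (Cderiv_ext (fun s : R => exp_rem (S n) (RtoC s * w) - RtoC (/ INR (fact (S (S n)))) * (RtoC s * w) ^ (S (S n)))%C).
    { intros s. rewrite (exp_rem_S (S n)). reflexivity. }
    eapply Cderiv_eq.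
    + apply Cderiv_minus; [apply IH|]. apply Cderiv_scal, Cderiv_pow, Hw.
    + rewrite exp_rem_S.
      assert (E : (RtoC (/ INR (fact (S (S n)))) * RtoC (INR (S (S n))))%C = RtoC (/ INR (fact (S n)))).
      { rewrite <- RtoC_mult. f_equal.
        change (fact (S (S n))) with (S (S n) * fact (S n))%nat. rewrite mult_INR.
        field. split; [apply INR_fact_neq_0 | apply not_0_INR; discriminate]. }
      rewrite <- E. ring.
Qed.

(** Along the segment from [0] to [w] the remainder of order [n + 1] has derivative [w] times the
    remainder of order [n], which gives an induction on [n]. *)
Lemma exp_rem_bound n w : Cmod w <= 1 -> Cmod (exp_rem n w) <= 3 * Cmod w ^ S n.
Proof.
  assert (E1 : exp 1 <= 3) by apply exp_le_3.
  assert (base : forall w, Cmod w <= 1 -> Cmod (Cexp w) <= 3).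
  { intros v Hv. rewrite Cmod_Cexp. eapply Rle_trans; [|exact E1].
    assert (Re v <= 1) by (generalize (Re_le_Cmod v); lra).
    destruct (Rle_lt_or_eq_dec _ _ H) as [K| ->]; [apply Rlt_le, exp_increasing, K | lra]. }
  revert w; induction n as [|n IH]; intros w Hw.
  - replace (exp_rem 0 w) with (Cexp (RtoC 1 * w) - Cexp (RtoC 0 * w))%C.
    2:{ unfold exp_rem. rewrite sum_O, Cmult_0_l, Cexp_0, Cmult_1_l. simpl. rewrite Rinv_1; ring. }
    replace (3 * Cmod w ^ 1) with (3 * Cmod w * (1 - 0)) by ring.
    apply (Cmean_value_const (fun s : R => Cexp (RtoC s * w)) (fun s => w * Cexp (RtoC s * w))%C); [lra| |].
    + intros t _. apply Cderiv_Cexp. eapply Cderiv_eq; [apply Cderiv_mult; [apply Cderiv_id | apply Cderiv_const]|]. cbv beta; ring.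
    + intros t Ht. rewrite Cmod_mult, (Rmult_comm 3). apply Rmult_le_compat_l; [apply Cmod_ge_0|].
      apply base. rewrite Cmod_mult, Cmod_R, Rabs_pos_eq by lra. generalize (Cmod_ge_0 w); nra.
  - replace (exp_rem (S n) w) with (exp_rem (S n) (RtoC 1 * w) - exp_rem (S n) (RtoC 0 * w))%C.
    2:{ rewrite Cmult_1_l, Cmult_0_l.
        replace (exp_rem (S n) 0%C) with (RtoC 0); [ring|].
        clear. induction n as [|n IH]; symmetry.
        - unfold exp_rem. rewrite sum_Sn, sum_O, Cexp_0. unfold plus; simpl. rewrite Rinv_1. ring.
        - rewrite exp_rem_S, <- IH, Cpow_S; ring. }
    replace (3 * Cmod w ^ S (S n)) with (Cmod w * (3 * Cmod w ^ S n) * (1 - 0)) by (simpl; ring).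
    apply (Cmean_value_const (fun s : R => exp_rem (S n) (RtoC s * w)%C) (fun s => w * exp_rem n (RtoC s * w))%C); [lra| |].
    + intros t _; apply Cderiv_exp_rem.
    + intros t Ht. rewrite Cmod_mult. apply Rmult_le_compat_l; [apply Cmod_ge_0|].
      assert (Hm : Cmod (RtoC t * w) <= Cmod w).
      { rewrite Cmod_mult, Cmod_R, Rabs_pos_eq by lra. generalize (Cmod_ge_0 w); nra. }
      eapply Rle_trans; [apply IH; lra|].
      apply Rmult_le_compat_l; [lra|]. apply pow_incr. split; [apply Cmod_ge_0 | exact Hm].
Qed.

(** * Smooth real functions and their Taylor coefficients *)

(** Being [n] times differentiable on the whole line, by recursion on the derivative: closure under
    products and real powers is then an induction on [n]. *)
Fixpoint Ck (n : nat) (f : R -> R) : Prop :=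
  match n with
  | O => True
  | S m => exists f', (forall x, is_derive f x (f' x)) /\ Ck m f'
  end.

Definition smooth (f : R -> R) : Prop := forall n, Ck n f.

Lemma Ck_ext n f g : (forall x, f x = g x) -> Ck n f -> Ck n g.
Proof.
  intros E. destruct n as [|n]; simpl; [auto|].
  intros [f' [H1 H2]]. exists f'. split; [|exact H2].
  intros x. eapply is_derive_ext; [exact E | apply H1].
Qed.

Lemma Ck_S n f : Ck (S n) f -> Ck n f.
Proof.
  revert f; induction n as [|n IH]; intros f [f' [H1 H2]]; simpl; [exact I|].
  exists f'; split; [exact H1 | apply IH; exact H2].
Qed.

Lemma Ck_const n c : Ck n (fun _ => c).
Proof.
  revert c; induction n as [|n IH]; intros c; simpl; [exact I|].
  exists (fun _ => 0). split; [intros; apply @is_derive_const | apply IH].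
Qed.

Lemma Ck_id n : Ck n (fun x => x).
Proof.
  destruct n as [|n]; simpl; [exact I|].
  exists (fun _ => 1). split; [intros; apply @is_derive_id | apply Ck_const].
Qed.

Lemma Ck_plus n : forall f g, Ck n f -> Ck n g -> Ck n (fun x => f x + g x).
Proof.
  induction n as [|n IH]; intros f g; simpl; [auto|].
  intros [f' [H1 H2]] [g' [H3 H4]].
  exists (fun x => f' x + g' x). split; [intros; now apply @is_derive_plus | auto].
Qed.

Lemma Ck_mult n : forall f g, Ck n f -> Ck n g -> Ck n (fun x => f x * g x).
Proof.
  induction n as [|n IH]; intros f g Hf Hg; [exact I|].
  assert (Hf0 := Ck_S _ _ Hf). assert (Hg0 := Ck_S _ _ Hg).
  destruct Hf as [f' [H1 H2]], Hg as [g' [H3 H4]].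
  exists (fun x => f' x * g x + f x * g' x).
  split; [intros; now apply is_derive_Rmult | apply Ck_plus; auto].
Qed.

Lemma is_derive_Rpower h p x h' :
  0 < h x -> is_derive h x h' ->
  is_derive (fun y => Rpower (h y) p) x (p * (h' * Rpower (h x) (p - 1))).
Proof.
  intros Hp H. eapply is_derive_eq.
  - apply (is_derive_comp (fun y => Rpower y p)); [|exact H].
    apply is_derive_Reals, derivable_pt_lim_power, Hp.
  - unfold scal; simpl; unfold mult; simpl; ring.
Qed.

(** All exponents have to be treated together, because differentiation lowers the exponent by one. *)
Lemma Ck_Rpower n : forall h p, (forall x, 0 < h x) -> Ck n h -> Ck n (fun x => Rpower (h x) p).
Proof.
  induction n as [|n IH]; intros h p Hp Hh; [exact I|].
  assert (Hh0 := Ck_S _ _ Hh). destruct Hh as [h' [H1 H2]].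
  exists (fun x => p * (h' x * Rpower (h x) (p - 1))). split.
  - intros x; apply is_derive_Rpower; auto.
  - apply Ck_mult; [apply Ck_const | apply Ck_mult; auto].
Qed.

Lemma smooth_plus f g : smooth f -> smooth g -> smooth (fun x => f x + g x).
Proof. intros a b n; now apply Ck_plus. Qed.

Lemma smooth_mult f g : smooth f -> smooth g -> smooth (fun x => f x * g x).
Proof. intros a b n; now apply Ck_mult. Qed.

Lemma smooth_scal c f : smooth f -> smooth (fun x => c * f x).
Proof. intros a; apply (smooth_mult (fun _ => c)); [intros n; apply Ck_const | exact a]. Qed.

Lemma smooth_pow f n : smooth f -> smooth (fun x => f x ^ n).
Proof.
  intros H; induction n as [|n IH]; [intros m; apply (Ck_const m 1) | now apply (smooth_mult f)].
Qed.

Lemma smooth_id : smooth (fun x => x).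
Proof. intros n; apply Ck_id. Qed.

Lemma smooth_const c : smooth (fun _ => c).
Proof. intros n; apply Ck_const. Qed.

Lemma smooth_Rpower h p : (forall x, 0 < h x) -> smooth h -> smooth (fun x => Rpower (h x) p).
Proof. intros Hp H n; now apply Ck_Rpower. Qed.

Lemma smooth_ext f g : (forall x, f x = g x) -> smooth f -> smooth g.
Proof. intros E H n; now apply (Ck_ext n f). Qed.

Lemma smooth_sum (f : nat -> R -> R) n :
  (forall k, smooth (f k)) -> smooth (fun x => sum_n (fun k => f k x) n).
Proof.
  intros H; induction n as [|n IH].
  - apply (smooth_ext (f O)); [intros; now rewrite sum_O | apply H].
  - apply (smooth_ext (fun x => sum_n (fun k => f k x) n + f (S n) x)).
    + intros; now rewrite sum_Sn.
    + now apply smooth_plus.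
Qed.

Lemma smooth_is_derive f x : smooth f -> is_derive f x (Derive f x).
Proof. intros H. apply Derive_correct. destruct (H 1%nat) as [f' [H1 _]]. eexists; apply H1. Qed.

Lemma smooth_Derive f : smooth f -> smooth (Derive f).
Proof.
  intros H n. destruct (H (S n)) as [f' [H1 H2]].
  apply (Ck_ext n f'); [|exact H2]. intros x; symmetry; apply is_derive_unique, H1.
Qed.

Lemma Derive_n_S f n x : Derive_n f (S n) x = Derive_n (Derive f) n x.
Proof.
  change (Derive f) with (Derive_n f 1). rewrite Derive_n_comp, Nat.add_1_r. reflexivity.
Qed.

Lemma smooth_Derive_n f n : smooth f -> smooth (Derive_n f n).
Proof. intros H; induction n as [|n IH]; [exact H | exact (smooth_Derive _ IH)]. Qed.

Lemma smooth_ex_derive_n f n x : smooth f -> ex_derive_n f n x.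
Proof.
  intros H. destruct n as [|n]; simpl; [exact I|].
  eexists. apply smooth_is_derive, smooth_Derive_n, H.
Qed.

Lemma smooth_continuous f x : smooth f -> continuous f x.
Proof. intros H. apply @ex_derive_continuous. eexists; now apply smooth_is_derive. Qed.

Lemma smooth_bounded f : smooth f -> exists K, 0 <= K /\ forall t, 0 <= t <= 1 -> Rabs (f t) <= K.
Proof.
  intros H. destruct (continuity_ab_maj (fun t => Rabs (f t)) 0 1) as [M [HM _]]; [lra| |].
  - intros c _. apply continuity_pt_filterlim.
    apply (continuous_comp f Rabs); [now apply smooth_continuous | apply continuous_Rabs].
  - exists (Rabs (f M)). split; [apply Rabs_pos | exact HM].
Qed.

Definition taylor (f : R -> R) (k : nat) : R := Derive_n f k 0 / INR (fact k).

Lemma taylor_Derive f k : taylor (Derive f) k = INR (S k) * taylor f (S k).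
Proof.
  unfold taylor. rewrite <- Derive_n_S.
  change (fact (S k)) with (S k * fact k)%nat. rewrite mult_INR.
  field. split; [apply INR_fact_neq_0 | apply not_0_INR; discriminate].
Qed.

Lemma taylor_plus f g k : smooth f -> smooth g ->
  taylor (fun x => f x + g x) k = taylor f k + taylor g k.
Proof.
  intros Hf Hg. unfold taylor. rewrite Derive_n_plus.
  - field. apply INR_fact_neq_0.
  - apply filter_forall; intros; now apply smooth_ex_derive_n.
  - apply filter_forall; intros; now apply smooth_ex_derive_n.
Qed.

Lemma taylor_scal c f k : taylor (fun x => c * f x) k = c * taylor f k.
Proof. unfold taylor. rewrite Derive_n_scal_l. field. apply INR_fact_neq_0. Qed.

Lemma taylor_ext f g k : (forall x, f x = g x) -> taylor f k = taylor g k.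
Proof. intros E. unfold taylor. now rewrite (Derive_n_ext f g). Qed.

Lemma Derive_n_mult_id f n x : smooth f ->
  Derive_n (fun y => y * f y) (S n) x = x * Derive_n f (S n) x + INR (S n) * Derive_n f n x.
Proof.
  intros H. revert x; induction n as [|n IH]; intros x.
  - simpl. apply is_derive_unique. eapply is_derive_eq.
    + apply is_derive_Rmult; [apply @is_derive_id | apply smooth_is_derive, H].
    + unfold one; simpl. change (1 * f x + x * Derive f x = x * Derive f x + 1 * f x). ring.
  - change (Derive (Derive_n (fun y => y * f y) (S n)) x = x * Derive_n f (S (S n)) x + INR (S (S n)) * Derive_n f (S n) x).
    rewrite (Derive_ext _ _ x IH). apply is_derive_unique. eapply is_derive_eq.
    + apply @is_derive_plus.
      * apply is_derive_Rmult; [apply @is_derive_id | apply smooth_is_derive, smooth_Derive_n, H].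
      * apply @is_derive_scal. apply smooth_is_derive, smooth_Derive_n, H.
    + rewrite (S_INR (S n)). unfold plus, one; simpl. ring.
Qed.

Lemma taylor_mult_id f k : smooth f -> taylor (fun x => x * f x) (S k) = taylor f k.
Proof.
  intros H. unfold taylor. rewrite Derive_n_mult_id by exact H.
  change (fact (S k)) with (S k * fact k)%nat. rewrite mult_INR.
  field. split; [apply INR_fact_neq_0 | apply not_0_INR; discriminate].
Qed.

Lemma taylor_mult_pow f n k : smooth f -> taylor (fun x => x ^ n * f x) (n + k) = taylor f k.
Proof.
  intros H; induction n as [|n IH]; simpl plus.
  - apply taylor_ext; intros; simpl; ring.
  - rewrite <- IH, <- (taylor_mult_id (fun x => x ^ n * f x)).
    + apply taylor_ext; intros; simpl; ring.
    + apply smooth_mult; [apply smooth_pow, smooth_id | exact H].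
Qed.

Lemma taylor_expansion f n : smooth f ->
  exists K, 0 <= K /\ forall t, 0 < t <= 1 ->
    Rabs (f t - sum_n (fun k => taylor f k * t ^ k) n) <= K * t ^ S n.
Proof.
  intros H. destruct (smooth_bounded _ (smooth_Derive_n f (S n) H)) as [K [HK HB]].
  assert (Hf : 0 < INR (fact (S n))) by apply INR_fact_lt_0.
  exists (K / INR (fact (S n))). split; [apply Rdiv_le_0_compat; lra|].
  intros t Ht.
  destruct (Taylor_Lagrange f n 0 t ltac:(lra)) as [z [Hz E]].
  { intros; now apply smooth_ex_derive_n. }
  rewrite sum_n_Reals, E.
  rewrite (sum_eq _ (fun k => taylor f k * t ^ k)).
  2:{ intros i _. unfold taylor. rewrite Rminus_0_r. field. apply INR_fact_neq_0. }
  rewrite Rminus_0_r.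
  match goal with |- Rabs (?a + ?b - ?a) <= _ => replace (a + b - a) with b by ring end.
  rewrite Rabs_mult. unfold Rdiv at 1. rewrite Rabs_mult, Rabs_inv, (Rabs_pos_eq (INR _)) by lra.
  rewrite (Rabs_pos_eq (t ^ S n)) by (apply pow_le; lra).
  replace (K / INR (fact (S n)) * t ^ S n) with (t ^ S n * / INR (fact (S n)) * K) by (field; lra).
  apply Rmult_le_compat_l; [|apply HB; lra].
  apply Rmult_le_pos; [apply pow_le; lra | apply Rlt_le, Rinv_0_lt_compat, Hf].
Qed.

Lemma zero_of_linear_bound a K : (forall t, 0 < t <= 1 -> Rabs a <= K * t) -> a = 0.
Proof.
  intros H. destruct (Req_dec a 0) as [E|E]; [exact E|exfalso].
  assert (Hpos : 0 < Rabs a) by now apply Rabs_pos_lt.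
  assert (HK : 0 < K) by (specialize (H 1 ltac:(lra)); lra).
  destruct (Rle_lt_dec (Rabs a / (2 * K)) 1) as [L|L].
  - specialize (H (Rabs a / (2 * K))).
    assert (0 < Rabs a / (2 * K)) by (apply Rdiv_lt_0_compat; lra).
    specialize (H ltac:(lra)). replace (K * (Rabs a / (2 * K))) with (Rabs a / 2) in H by (field; lra). lra.
  - specialize (H (1/2) ltac:(lra)).
    assert (2 * K < Rabs a) by (apply (Rmult_lt_reg_r (/ (2 * K))); [apply Rinv_0_lt_compat; lra|]; rewrite Rinv_r by lra; exact L). lra.
Qed.

Lemma sum_n_shift (a : nat -> R) t n :
  sum_n (fun k => a k * t ^ k) (S n) = a O + t * sum_n (fun k => a (S k) * t ^ k) n.
Proof.
  induction n as [|n IH].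
  - rewrite sum_Sn, !sum_O. unfold plus; simpl; ring.
  - rewrite sum_Sn, IH, sum_Sn. unfold plus; simpl; ring.
Qed.

(** The constant coefficient is at most a multiple of [t] for all small [t], hence zero; dividing
    by [t] gives the induction. *)
Lemma coefs_vanish n : forall (a : nat -> R) K,
  (forall t, 0 < t <= 1 -> Rabs (sum_n (fun k => a k * t ^ k) n) <= K * t ^ S n) ->
  forall k, (k <= n)%nat -> a k = 0.
Proof.
  induction n as [|n IH]; intros a K H.
  - intros k Hk. replace k with O by lia. apply (zero_of_linear_bound _ K).
    intros t Ht. specialize (H t Ht). rewrite sum_O in H. simpl in H. rewrite !Rmult_1_r in H. exact H.
  - assert (HK : 0 <= K).
    { specialize (H 1 ltac:(lra)). rewrite pow1, Rmult_1_r in H.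
      eapply Rle_trans; [apply Rabs_pos | exact H]. }
    set (s := fun t => sum_n (fun k => a (S k) * t ^ k) n).
    assert (Hs : exists B, 0 <= B /\ forall t, 0 <= t <= 1 -> Rabs (s t) <= B).
    { apply smooth_bounded, smooth_sum. intros k. apply smooth_scal, smooth_pow, smooth_id. }
    destruct Hs as [B [HB0 HB]].
    assert (Ha : a O = 0).
    { apply (zero_of_linear_bound _ (K + B)). intros t Ht.
      specialize (H t Ht). rewrite sum_n_shift in H. fold (s t) in H.
      specialize (HB t ltac:(lra)).
      assert (t ^ S (S n) <= t).
      { simpl. assert (t ^ n <= 1) by (rewrite <- (pow1 n); apply pow_incr; lra).
        assert (0 <= t ^ n) by (apply pow_le; lra). nra. }
      replace (a O) with ((a O + t * s t) + - (t * s t)) by ring.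
      eapply Rle_trans; [apply Rabs_triang|]. rewrite Rabs_Ropp, Rabs_mult, (Rabs_pos_eq t) by lra. nra. }
    intros [|k] Hk; [exact Ha|].
    apply (IH (fun k => a (S k)) K); [|lia].
    intros t Ht. specialize (H t Ht). rewrite sum_n_shift, Ha, Rplus_0_l, Rabs_mult, (Rabs_pos_eq t) in H by lra.
    apply (Rmult_le_reg_l t); [lra|]. simpl in *. lra.
Qed.

(** Order of vanishing at [0], measured on the positive side only.  One side is enough to determine
    Taylor coefficients. *)
Definition bigO (k : nat) (f : R -> R) : Prop :=
  exists K, 0 <= K /\ forall t, 0 < t <= 1 -> Rabs (f t) <= K * t ^ k.

Lemma bigO_ext k f g : (forall t, 0 < t <= 1 -> f t = g t) -> bigO k f -> bigO k g.
Proof. intros E [K [HK H]]. exists K; split; [exact HK|]. intros t Ht; rewrite <- E; auto. Qed.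

Lemma bigO_plus k f g : bigO k f -> bigO k g -> bigO k (fun t => f t + g t).
Proof.
  intros [K [HK H]] [L [HL H']]. exists (K + L). split; [lra|]. intros t Ht.
  eapply Rle_trans; [apply Rabs_triang|]. generalize (H t Ht) (H' t Ht); nra.
Qed.

Lemma bigO_mult k l f g : bigO k f -> bigO l g -> bigO (k + l) (fun t => f t * g t).
Proof.
  intros [K [HK H]] [L [HL H']]. exists (K * L). split; [nra|]. intros t Ht.
  rewrite Rabs_mult, pow_add. replace (K * L * (t ^ k * t ^ l)) with ((K * t ^ k) * (L * t ^ l)) by ring.
  apply Rmult_le_compat; auto using Rabs_pos.
Qed.

Lemma bigO_weaken k l f : (l <= k)%nat -> bigO k f -> bigO l f.
Proof.
  intros Hl [K [HK H]]. exists K. split; [exact HK|]. intros t Ht.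
  eapply Rle_trans; [apply H, Ht|]. apply Rmult_le_compat_l; [exact HK|].
  replace k with (l + (k - l))%nat by lia. rewrite pow_add.
  assert (t ^ (k - l) <= 1) by (rewrite <- (pow1 (k - l)); apply pow_incr; lra).
  assert (0 <= t ^ l) by (apply pow_le; lra). nra.
Qed.

Lemma bigO_scal c k f : bigO k f -> bigO k (fun t => c * f t).
Proof.
  intros H. apply (bigO_mult 0 k (fun _ => c)); [|exact H].
  exists (Rabs c). split; [apply Rabs_pos|]. intros; simpl; lra.
Qed.

Lemma bigO_minus k f g : bigO k f -> bigO k g -> bigO k (fun t => f t - g t).
Proof.
  intros H1 H2. apply (bigO_ext k (fun t => f t + (-1) * g t)); [intros; ring|].
  apply bigO_plus; [exact H1 | now apply bigO_scal].
Qed.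

Lemma smooth_bigO f : smooth f -> bigO 0 f.
Proof.
  intros H. destruct (smooth_bounded f H) as [K [HK HB]]. exists K; split; [exact HK|].
  intros t Ht. simpl. rewrite Rmult_1_r. apply HB; lra.
Qed.

Lemma bigO_pow_id k : bigO k (fun t => t ^ k).
Proof. exists 1. split; [lra|]. intros t Ht. rewrite Rabs_pos_eq by (apply pow_le; lra). lra. Qed.

Lemma bigO_sum k (f : nat -> R -> R) n :
  (forall j, (j <= n)%nat -> bigO k (f j)) -> bigO k (fun t => sum_n (fun j => f j t) n).
Proof.
  intros H; induction n as [|n IH].
  - apply (bigO_ext k (f O)); [intros; now rewrite sum_O | apply H; lia].
  - apply (bigO_ext k (fun t => sum_n (fun j => f j t) n + f (S n) t)).
    + intros; now rewrite sum_Sn.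
    + apply bigO_plus; [apply IH; intros; apply H; lia | apply H; lia].
Qed.

Lemma taylor_bigO f n : smooth f -> bigO (S n) (fun t => f t - sum_n (fun k => taylor f k * t ^ k) n).
Proof. apply taylor_expansion. Qed.

Lemma taylor_unique f n (a : nat -> R) : smooth f ->
  bigO (S n) (fun t => f t - sum_n (fun k => a k * t ^ k) n) ->
  forall k, (k <= n)%nat -> taylor f k = a k.
Proof.
  intros Hf Ha k Hk.
  destruct (bigO_minus _ _ _ (taylor_bigO f n Hf) Ha) as [K [HK H]].
  assert (E : a k - taylor f k = 0); [|lra].
  revert k Hk. apply (coefs_vanish n (fun k => a k - taylor f k) K).
  intros t Ht. specialize (H t Ht).
  replace (sum_n (fun k => (a k - taylor f k) * t ^ k) n : R) with
   (f t - sum_n (fun k => taylor f k * t ^ k) n - (f t - sum_n (fun k => a k * t ^ k) n)); [exact H|].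
  clear. symmetry. induction n as [|n IH]; [rewrite !sum_O; simpl; ring|].
  rewrite !sum_Sn, IH. unfold plus; simpl; ring.
Qed.

Lemma sum_n_monomial c n t : sum_n (fun k => (if Nat.eqb k n then c else 0) * t ^ k) n = c * t ^ n.
Proof.
  destruct n as [|n]; [rewrite sum_O; reflexivity|].
  rewrite sum_Sn, Nat.eqb_refl.
  rewrite (sum_n_ext_loc _ (fun _ => 0)).
  - rewrite sum_n_const. unfold plus; simpl; ring.
  - intros k Hk. replace (Nat.eqb k (S n)) with false; [apply Rmult_0_l|].
    symmetry; apply Nat.eqb_neq; lia.
Qed.

Lemma taylor_leading f n c : smooth f ->
  bigO (S n) (fun t => f t - c * t ^ n) -> taylor f n = c.
Proof.
  intros Hf H.
  rewrite (taylor_unique f n (fun k => if Nat.eqb k n then c else 0) Hf) with (k := n); [now rewrite Nat.eqb_refl| |lia].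
  eapply bigO_ext; [|exact H]. intros t _. now rewrite sum_n_monomial.
Qed.

(** All Taylor coefficients below the order [n] of vanishing are zero. *)
Lemma bigO_leading f n : smooth f -> bigO n f ->
  bigO (S n) (fun t => f t - taylor f n * t ^ n).
Proof.
  intros Hf H. eapply bigO_ext; [|apply (taylor_bigO f n Hf)].
  intros t _. rewrite <- sum_n_monomial. apply (f_equal (Rminus (f t))), sum_n_ext_loc.
  intros k Hk. apply (f_equal (fun c => c * t ^ k)). destruct (Nat.eqb k n) eqn:E.
  - apply Nat.eqb_eq in E; now subst.
  - apply Nat.eqb_neq in E. destruct n as [|n]; [lia|].
    apply (taylor_unique f n (fun _ => 0) Hf); [|lia].
    eapply bigO_ext; [|exact H]. intros s _. rewrite (sum_n_ext _ (fun _ => 0)) by (intros; apply Rmult_0_l).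
    rewrite sum_n_const. ring.
Qed.

(** * Polynomials with real coefficients, on the real line and in the plane *)

Fixpoint evalR (l : list R) (t : R) : R :=
  match l with nil => 0 | cons a l => a + t * evalR l t end.

Fixpoint evalC (l : list R) (w : C) : C :=
  match l with nil => 0%C | cons a l => (RtoC a + w * evalC l w)%C end.

Fixpoint padd (l m : list R) : list R :=
  match l, m with
  | nil, _ => m
  | _, nil => l
  | cons a l, cons b m => cons (a + b) (padd l m)
  end.

Definition pscal (c : R) (l : list R) : list R := map (Rmult c) l.

Fixpoint pmul (l m : list R) : list R :=
  match l with nil => nil | cons a l => padd (pscal a m) (cons 0 (pmul l m)) end.

(** Horner form of the derivative: [(a + X l)' = l + X l']. *)
Fixpoint pderiv (l : list R) : list R :=
  match l with nil => nil | cons _ l => padd l (cons 0 (pderiv l)) end.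

Lemma evalC_padd l m w : evalC (padd l m) w = (evalC l w + evalC m w)%C.
Proof.
  revert m; induction l as [|a l IH]; intros [|b m]; simpl; try ring.
  rewrite IH, RtoC_plus; ring.
Qed.

Lemma evalC_pscal c l w : evalC (pscal c l) w = (RtoC c * evalC l w)%C.
Proof. induction l as [|a l IH]; simpl; [ring | rewrite IH, RtoC_mult; ring]. Qed.

Lemma evalC_pmul l m w : evalC (pmul l m) w = (evalC l w * evalC m w)%C.
Proof.
  induction l as [|a l IH]; simpl; [ring|].
  rewrite evalC_padd, evalC_pscal. simpl. rewrite IH. ring.
Qed.

Lemma evalC_RtoC l t : evalC l (RtoC t) = RtoC (evalR l t).
Proof. induction l as [|a l IH]; simpl; [reflexivity | rewrite IH, RtoC_plus, RtoC_mult; reflexivity]. Qed.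

Lemma Cderiv_evalC l g t d :
  Cderiv g t d -> Cderiv (fun s => evalC l (g s)) t (d * evalC (pderiv l) (g t))%C.
Proof.
  intros H; induction l as [|a l IH]; simpl.
  - eapply Cderiv_eq; [apply Cderiv_const | ring].
  - eapply Cderiv_eq.
    + apply Cderiv_plus; [apply Cderiv_const | apply Cderiv_mult; [exact H | exact IH]].
    + cbv beta. rewrite evalC_padd. simpl. ring.
Qed.

Lemma Ccont_evalC {U : UniformSpace} l (u : U -> C) x :
  Ccont u x -> Ccont (fun y => evalC l (u y)) x.
Proof.
  intros H; induction l as [|a l IH]; simpl; [apply Ccont_const|].
  apply Ccont_plus; [apply Ccont_const | apply Ccont_mult; assumption].
Qed.

Lemma smooth_evalR l : smooth (evalR l).
Proof.
  induction l as [|a l IH]; simpl; [apply smooth_const|].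
  apply smooth_plus; [apply smooth_const | apply smooth_mult; [apply smooth_id | exact IH]].
Qed.

Lemma evalC_bounded l : exists K, 0 <= K /\ forall w, Cmod w <= 1 -> Cmod (evalC l w) <= K.
Proof.
  induction l as [|a l [K [HK IH]]]; simpl.
  - exists 0. split; [lra|]. intros. rewrite Cmod_0; lra.
  - exists (Rabs a + K). split; [generalize (Rabs_pos a); lra|].
    intros t Ht. eapply Rle_trans; [apply Cmod_triangle|].
    rewrite Cmod_mult, Cmod_R. generalize (IH t Ht) (Cmod_ge_0 t) (Cmod_ge_0 (evalC l t)). nra.
Qed.

(** The passage from the real axis to the disc.  The estimate on the positive axis forces the
    first [k] coefficients of [l] to vanish, and these are the same in the complex
    polynomial. *)
Lemma evalC_bigO l : forall k, bigO k (evalR l) ->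
  exists K, 0 <= K /\ forall w, Cmod w <= 1 -> Cmod (evalC l w) <= K * Cmod w ^ k.
Proof.
  induction l as [|a l IH]; intros k [K [HK H]].
  - exists 0. split; [lra|]. intros w _. simpl. rewrite Cmod_0. lra.
  - destruct k as [|k].
    { destruct (evalC_bounded (a :: l)) as [K' [HK' HB]].
      exists K'. split; [exact HK'|]. intros w Hw. simpl pow. rewrite Rmult_1_r. apply HB, Hw. }
    destruct (smooth_bounded _ (smooth_evalR l)) as [B [HB0 HB]].
    assert (Ha : a = 0).
    { apply (zero_of_linear_bound _ (K + B)). intros t Ht.
      specialize (H t Ht). simpl in H. specialize (HB t ltac:(lra)).
      assert (t ^ k <= 1) by (rewrite <- (pow1 k); apply pow_incr; lra).
      assert (0 <= t ^ k) by (apply pow_le; lra).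
      assert (K * (t * t ^ k) <= K * t) by (apply Rmult_le_compat_l; nra).
      replace a with ((a + t * evalR l t) + - (t * evalR l t)) at 1 by ring.
      eapply Rle_trans; [apply Rabs_triang|].
      rewrite Rabs_Ropp, Rabs_mult, (Rabs_pos_eq t) by lra. nra. }
    subst a. destruct (IH k) as [K' [HK' HC]].
    { exists K. split; [exact HK|]. intros t Ht. specialize (H t Ht). simpl in H.
      rewrite Rplus_0_l, Rabs_mult, (Rabs_pos_eq t) in H by lra.
      apply (Rmult_le_reg_l t); [lra|]. lra. }
    exists K'. split; [exact HK'|]. intros w Hw. simpl. rewrite Cplus_0_l, Cmod_mult.
    generalize (HC w Hw) (Cmod_ge_0 w). nra.
Qed.

(** [p] and [q] are the real and the complex polynomial function with the same real coefficients. *)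
Definition real_poly (p : R -> R) (q : C -> C) : Prop :=
  exists l, (forall t, p t = evalR l t) /\ (forall w, q w = evalC l w).

Lemma real_poly_intro q l p :
  (forall w, q w = evalC l w) -> (forall t, q (RtoC t) = RtoC (p t)) -> real_poly p q.
Proof.
  intros H1 H2. exists l; split; [|exact H1].
  intros t. apply RtoC_inj. rewrite <- H2, H1, evalC_RtoC. reflexivity.
Qed.

Lemma real_poly_RtoC p q t : real_poly p q -> q (RtoC t) = RtoC (p t).
Proof. intros [l [H1 H2]]. rewrite H1, H2, evalC_RtoC; reflexivity. Qed.

Lemma real_poly_eval l : real_poly (evalR l) (evalC l).
Proof. exists l; split; reflexivity. Qed.

Lemma real_poly_const c : real_poly (fun _ => c) (fun _ => RtoC c).
Proof. apply real_poly_intro with (c :: nil); intros; simpl; [ring | reflexivity]. Qed.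

Lemma real_poly_id : real_poly (fun t => t) (fun w => w).
Proof. apply real_poly_intro with (0 :: 1 :: nil); intros; simpl; [ring | reflexivity]. Qed.

Lemma real_poly_plus p q p' q' :
  real_poly p q -> real_poly p' q' -> real_poly (fun t => p t + p' t) (fun w => q w + q' w)%C.
Proof.
  intros H1 H2. destruct H1 as [l [a b]] eqn:E1. destruct H2 as [m [c d]] eqn:E2.
  apply real_poly_intro with (padd l m).
  - intros w. rewrite evalC_padd, b, d; reflexivity.
  - intros t. rewrite (real_poly_RtoC p q), (real_poly_RtoC p' q'), RtoC_plus by eauto. reflexivity.
Qed.

Lemma real_poly_mult p q p' q' :
  real_poly p q -> real_poly p' q' -> real_poly (fun t => p t * p' t) (fun w => q w * q' w)%C.
Proof.
  intros H1 H2. destruct H1 as [l [a b]] eqn:E1. destruct H2 as [m [c d]] eqn:E2.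
  apply real_poly_intro with (pmul l m).
  - intros w. rewrite evalC_pmul, b, d; reflexivity.
  - intros t. rewrite (real_poly_RtoC p q), (real_poly_RtoC p' q'), RtoC_mult by eauto. reflexivity.
Qed.

Lemma real_poly_minus p q p' q' :
  real_poly p q -> real_poly p' q' -> real_poly (fun t => p t - p' t) (fun w => q w - q' w)%C.
Proof.
  intros H1 H2.
  destruct (real_poly_plus _ _ _ _ H1 (real_poly_mult _ _ _ _ (real_poly_const (-1)) H2)) as [l [a b]].
  exists l. split.
  - intros t. rewrite <- a. ring.
  - intros w. rewrite <- b. apply C_eq; simpl; unfold Re, Im; ring.
Qed.

Lemma real_poly_pow p q n :
  real_poly p q -> real_poly (fun t => p t ^ n) (fun w => q w ^ n)%C.
Proof.
  intros H; induction n as [|n IH]; [apply (real_poly_const 1) | apply (real_poly_mult p q); assumption].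
Qed.

Lemma real_poly_ext p q p' q' :
  (forall t, p t = p' t) -> (forall w, q w = q' w) -> real_poly p q -> real_poly p' q'.
Proof. intros E1 E2 [l [a b]]; exists l; split; intros; [rewrite <- E1 | rewrite <- E2]; auto. Qed.

Lemma real_poly_sum (p : nat -> R -> R) (q : nat -> C -> C) n :
  (forall k, real_poly (p k) (q k)) ->
  real_poly (fun t => sum_n (fun k => p k t) n) (fun w => sum_n (fun k => q k w) n).
Proof.
  intros H; induction n as [|n IH].
  - eapply real_poly_ext; [| |apply (H 0%nat)]; intros; rewrite sum_O; reflexivity.
  - eapply real_poly_ext; [| |apply (real_poly_plus _ _ _ _ IH (H (S n)))]; intros; rewrite sum_Sn; reflexivity.
Qed.

Lemma real_poly_bigO p q k : real_poly p q -> bigO k p ->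
  exists K, 0 <= K /\ forall w, Cmod w <= 1 -> Cmod (q w) <= K * Cmod w ^ k.
Proof.
  intros [l [H1 H2]] H.
  destruct (evalC_bigO l k) as [K [HK H']].
  - eapply bigO_ext; [|exact H]. intros; apply H1.
  - exists K. split; [exact HK|]. intros; rewrite H2; auto.
Qed.

(** * Lagrange inversion for the local uniformizer *)

(** The entire function [2 (e^t - t - 1) / t^2], given by its power series so that it is smooth
    at [0] as well. *)
Definition exp_quot (t : R) : R := 2 * PSeries (PS_decr_1 (PS_decr_1 (fun n => / INR (fact n)))) t.

Lemma CV_radius_exp : CV_radius (fun n => / INR (fact n)) = p_infty.
Proof.
  apply CV_radius_infinite_DAlembert.
  - intros n. apply Rinv_neq_0_compat, INR_fact_neq_0.
  - apply is_lim_seq_ext with (fun n => / INR (S n)).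
    + intros n. change (fact (S n)) with (S n * fact n)%nat. rewrite mult_INR.
      assert (Hn : 0 < INR (S n)) by (apply lt_0_INR; lia).
      assert (Hf : 0 < INR (fact n)) by apply INR_fact_lt_0.
      rewrite Rabs_pos_eq.
      * field. lra.
      * apply Rlt_le, Rdiv_lt_0_compat; apply Rinv_0_lt_compat; nra.
    + apply (is_lim_seq_incr_1 (fun n => / INR n)).
      replace (Finite 0) with (Rbar_inv p_infty) by reflexivity.
      apply is_lim_seq_inv; [apply is_lim_seq_INR | discriminate].
Qed.

Lemma smooth_PSeries a : CV_radius a = p_infty -> smooth (PSeries a).
Proof.
  intros H n. revert a H; induction n as [|n IH]; intros a H; [exact I|].
  exists (PSeries (PS_derive a)). split.
  - intros x. apply is_derive_PSeries. rewrite H. exact I.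
  - apply IH. rewrite CV_radius_derive. exact H.
Qed.

Lemma exp_quot_smooth : smooth exp_quot.
Proof.
  apply smooth_scal, smooth_PSeries. rewrite !CV_radius_decr_1. apply CV_radius_exp.
Qed.

Lemma exp_quot_eq t : t * t * exp_quot t = 2 * (exp t - t - 1).
Proof.
  unfold exp_quot. rewrite exp_Reals.
  set (e := fun n => / INR (fact n)).
  rewrite (PSeries_decr_1 e t) by (apply CV_radius_inside; unfold e; rewrite CV_radius_exp; exact I).
  rewrite (PSeries_decr_1 (PS_decr_1 e) t)
    by (apply CV_radius_inside; rewrite CV_radius_decr_1; unfold e; rewrite CV_radius_exp; exact I).
  replace (e O) with 1 by (unfold e; simpl; field).
  replace (PS_decr_1 e O) with 1 by (unfold PS_decr_1, e; simpl; field).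
  ring.
Qed.

Lemma exp_quot_0 : exp_quot 0 = 1.
Proof. unfold exp_quot. rewrite PSeries_0. unfold PS_decr_1. simpl. field. Qed.

Lemma exp_quot_pos t : 0 < exp_quot t.
Proof.
  destruct (Req_dec t 0) as [->|Ht]; [rewrite exp_quot_0; lra|].
  generalize (exp_quot_eq t) (exp_ineq1 t Ht); intros. assert (0 < t * t) by nra.
  apply (Rmult_lt_reg_l (t * t)); lra.
Qed.

Lemma phi_base_exp_quot t : phi_base t = / exp_quot t.
Proof.
  unfold phi_base. destruct (Req_EM_T t 0) as [->|Ht]; [rewrite exp_quot_0; field|].
  generalize (exp_quot_eq t) (exp_ineq1 t Ht) (exp_quot_pos t); intros.
  replace (exp t - t - 1) with (t * t * exp_quot t / 2) by lra. field. lra.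
Qed.

Lemma Rpower_inv_base x y : 0 < x -> Rpower (/ x) y = Rpower x (- y).
Proof. intros H. unfold Rpower. rewrite ln_Rinv by exact H. f_equal; ring. Qed.

(** This is [(t / w)^(n+1)] for the uniformizer [w] below. *)
Definition lagrange_power (n : nat) (t : R) : R := Rpower (exp_quot t) (- ((INR n + 1) / 2)).

Lemma smooth_exp_quot_pow p : smooth (fun t => Rpower (exp_quot t) p).
Proof. apply smooth_Rpower; [apply exp_quot_pos | apply exp_quot_smooth]. Qed.

Lemma Rpower_exp_quot_0 p : Rpower (exp_quot 0) p = 1.
Proof. rewrite exp_quot_0. unfold Rpower. rewrite ln_1, Rmult_0_r, exp_0. reflexivity. Qed.

(** The square root of [2 (e^t - t - 1)] that behaves like [t] at [0]. *)
Definition uniformizer (t : R) : R := t * Rpower (exp_quot t) (1 / 2).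

Lemma uniformizer_smooth : smooth uniformizer.
Proof. apply smooth_mult; [apply smooth_id | apply smooth_exp_quot_pow]. Qed.

Lemma Rpower_half x : 0 < x -> Rpower x (1 / 2) * Rpower x (1 / 2) = x.
Proof. intros H. rewrite <- Rpower_plus. replace (1 / 2 + 1 / 2) with 1 by field. now apply Rpower_1. Qed.

Lemma uniformizer_sqr t : uniformizer t * uniformizer t = 2 * (exp t - t - 1).
Proof.
  rewrite <- exp_quot_eq. unfold uniformizer.
  replace (t * Rpower (exp_quot t) (1 / 2) * (t * Rpower (exp_quot t) (1 / 2)))
    with (t * t * (Rpower (exp_quot t) (1 / 2) * Rpower (exp_quot t) (1 / 2))) by ring.
  rewrite Rpower_half by apply exp_quot_pos. reflexivity.
Qed.

Lemma Derive_exp_quot_pow p t :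
  Derive (fun s => Rpower (exp_quot s) p) t = p * (Derive exp_quot t * Rpower (exp_quot t) (p - 1)).
Proof. apply is_derive_unique, is_derive_Rpower; [apply exp_quot_pos | apply smooth_is_derive, exp_quot_smooth]. Qed.

Lemma Derive_uniformizer t :
  Derive uniformizer t = Rpower (exp_quot t) (1 / 2) + t * (1 / 2 * (Derive exp_quot t * Rpower (exp_quot t) (1 / 2 - 1))).
Proof.
  apply is_derive_unique. eapply is_derive_eq.
  - apply is_derive_Rmult; [apply @is_derive_id | apply is_derive_Rpower; [apply exp_quot_pos | apply smooth_is_derive, exp_quot_smooth]].
  - unfold one; simpl. ring.
Qed.

Lemma Rpower_exp_quot_pow t j : Rpower (exp_quot t) (1 / 2) ^ j = Rpower (exp_quot t) (INR j / 2).
Proof.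
  rewrite <- Rpower_pow by apply exp_pos. rewrite Rpower_mult. f_equal. field.
Qed.

(** Write [w] for the uniformizer and [i = n - j > 0].  The function is [t^(n+1) w' w^(-i-1)], that is,
    [t^(n+1)] times the derivative of [- w^(-i) / i].  A derivative has no residue, so the
    coefficient of [t^n] is zero.  With [w^(-i) = t^(-i) chi] the same computation stays among
    smooth functions: the function is [t^j (chi - t chi' / i)], and the coefficient of [t^i] in
    [chi - t chi' / i] is [chi_i - i chi_i / i]. *)
Lemma lagrange_residue j n : (j < n)%nat ->
  taylor (fun t => Derive uniformizer t * uniformizer t ^ j * lagrange_power n t) n = 0.
Proof.
  intros Hj. set (i := (n - j)%nat).
  assert (Hi : 0 < INR i) by (apply lt_0_INR; unfold i; lia).
  assert (En : INR n = INR j + INR i) by (rewrite <- plus_INR; f_equal; unfold i; lia).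
  set (chi := fun t => Rpower (exp_quot t) (- (INR i / 2))).
  assert (Hc : smooth chi) by apply smooth_exp_quot_pow.
  assert (Hc' : smooth (fun t => (-1 / INR i) * (t * Derive chi t))).
  { apply smooth_scal, smooth_mult; [apply smooth_id | now apply smooth_Derive]. }
  rewrite (taylor_ext _ (fun t => t ^ j * (chi t + (-1 / INR i) * (t * Derive chi t)))).
  - replace n with (j + i)%nat by (unfold i; lia).
    rewrite taylor_mult_pow by (now apply smooth_plus).
    rewrite taylor_plus by assumption. rewrite taylor_scal.
    destruct i as [|i']; [simpl in Hi; lra|].
    rewrite taylor_mult_id by now apply smooth_Derive.
    rewrite taylor_Derive. field. lra.
  - intros t. unfold chi. rewrite Derive_exp_quot_pow, Derive_uniformizer. unfold uniformizer, lagrange_power.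
    rewrite Rpow_mult_distr, Rpower_exp_quot_pow, En.
    replace (- ((INR j + INR i + 1) / 2)) with (- (INR j / 2) + (- (INR i / 2) + - (1 / 2))) by field.
    replace (1 / 2 - 1) with (- (1 / 2)) by field.
    replace (- (INR i / 2) - 1) with (- (INR i / 2) + (- (1 / 2) + - (1 / 2))) by field.
    rewrite !Rpower_plus, !Rpower_Ropp.
    generalize (exp_pos (INR j / 2 * ln (exp_quot t))) (exp_pos (INR i / 2 * ln (exp_quot t))) (exp_pos (1 / 2 * ln (exp_quot t))).
    fold (Rpower (exp_quot t) (INR j / 2)) (Rpower (exp_quot t) (INR i / 2)) (Rpower (exp_quot t) (1 / 2)).
    intros. field. lra.
Qed.

(** The error of the first [n] terms in the expansion of [dt / dw] in powers of the uniformizer [w],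
    multiplied by [dw / dt]. *)
Fixpoint lagrange_remainder (n : nat) (t : R) : R :=
  match n with
  | O => 1
  | S m => lagrange_remainder m t - taylor (lagrange_power m) m * (Derive uniformizer t * uniformizer t ^ m)
  end.

Lemma lagrange_power_smooth n : smooth (lagrange_power n).
Proof. apply smooth_exp_quot_pow. Qed.

Lemma smooth_minus f g : smooth f -> smooth g -> smooth (fun x => f x - g x).
Proof.
  intros Hf Hg. apply (smooth_ext (fun x => f x + (-1) * g x)); [intros; ring|].
  apply smooth_plus; [exact Hf | now apply smooth_scal].
Qed.

Lemma uniformizer_term_smooth m : smooth (fun t => Derive uniformizer t * uniformizer t ^ m).
Proof. apply smooth_mult; [apply smooth_Derive, uniformizer_smooth | apply smooth_pow, uniformizer_smooth]. Qed.

Lemma lagrange_remainder_smooth n : smooth (lagrange_remainder n).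
Proof.
  induction n as [|n IH]; [exact (smooth_const 1)|].
  apply smooth_minus; [exact IH | apply smooth_scal, uniformizer_term_smooth].
Qed.

(** The subtracted terms do not contribute to the coefficient of [t^n], by the residue computation. *)
Lemma taylor_lagrange_remainder j n : (j <= n)%nat ->
  taylor (fun t => lagrange_remainder j t * lagrange_power n t) n = taylor (lagrange_power n) n.
Proof.
  induction j as [|j IH]; intros Hj.
  - apply taylor_ext; intros; simpl; ring.
  - rewrite (taylor_ext _ (fun t => lagrange_remainder j t * lagrange_power n t
       + - taylor (lagrange_power j) j * (Derive uniformizer t * uniformizer t ^ j * lagrange_power n t))) by (intros; simpl; ring).
    rewrite taylor_plus, taylor_scal, lagrange_residue, IH by
      (lia || (apply smooth_mult; [apply lagrange_remainder_smooth | apply lagrange_power_smooth])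
       || (apply smooth_scal, smooth_mult; [apply uniformizer_term_smooth | apply lagrange_power_smooth])).
    ring.
Qed.

Lemma bigO_minus_value f : smooth f -> bigO 1 (fun t => f t - f 0).
Proof.
  intros H. eapply bigO_ext; [|apply (taylor_bigO f 0 H)].
  intros t _. cbv beta. rewrite sum_O. unfold taylor. simpl. apply (f_equal (Rminus (f t))). field.
Qed.

(** Lagrange inversion.  The factor [lagrange_power n] is [1] at [0], so it does not change the
    leading coefficient of a function of order [n]; hence this coefficient is
    [taylor (lagrange_power n) n], which is exactly what the next step subtracts. *)
Lemma lagrange_remainder_bigO n : bigO n (lagrange_remainder n).
Proof.
  induction n as [|n IH].
  - exact (smooth_bigO _ (smooth_const 1)).
  - assert (Hlead := bigO_leading _ _ (lagrange_remainder_smooth n) IH).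
    assert (E : taylor (lagrange_remainder n) n = taylor (lagrange_power n) n).
    { rewrite <- (taylor_lagrange_remainder n n) by lia. symmetry. apply taylor_leading.
      - apply smooth_mult; [apply lagrange_remainder_smooth | apply lagrange_power_smooth].
      - apply (bigO_ext _ (fun t => (lagrange_remainder n t - taylor (lagrange_remainder n) n * t ^ n) * lagrange_power n t
                   + taylor (lagrange_remainder n) n * (t ^ n * (lagrange_power n t - lagrange_power n 0)))).
        { intros t _. unfold lagrange_power at 3. rewrite Rpower_exp_quot_0. ring. }
        apply bigO_plus.
        + rewrite <- (Nat.add_0_r (S n)). apply bigO_mult; [exact Hlead | apply smooth_bigO, lagrange_power_smooth].
        + apply bigO_scal. rewrite <- Nat.add_1_r. apply bigO_mult; [apply bigO_pow_id | apply bigO_minus_value, lagrange_power_smooth]. }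
    apply (bigO_ext _ (fun t => (lagrange_remainder n t - taylor (lagrange_remainder n) n * t ^ n)
       - taylor (lagrange_power n) n * (t ^ n * (Derive uniformizer t * Rpower (exp_quot t) (1 / 2) ^ n
           - Derive uniformizer 0 * Rpower (exp_quot 0) (1 / 2) ^ n)))).
    { intros t _. rewrite E, (Derive_uniformizer 0), !Rpower_exp_quot_0, pow1. simpl lagrange_remainder.
      replace (uniformizer t ^ n) with (t ^ n * Rpower (exp_quot t) (1 / 2) ^ n) by (unfold uniformizer; now rewrite Rpow_mult_distr). ring. }
    apply bigO_minus; [exact Hlead|]. apply bigO_scal. rewrite <- Nat.add_1_r.
    apply bigO_mult; [apply bigO_pow_id|].
    apply (bigO_minus_value (fun t => Derive uniformizer t * Rpower (exp_quot t) (1 / 2) ^ n)).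
    apply smooth_mult; [apply smooth_Derive, uniformizer_smooth | apply smooth_pow, smooth_exp_quot_pow].
Qed.

Lemma lagrange_remainder_sum n t :
  lagrange_remainder (S n) t = 1 - Derive uniformizer t * sum_n (fun k => taylor (lagrange_power k) k * uniformizer t ^ k) n.
Proof.
  induction n as [|n IH].
  - rewrite sum_O. simpl. ring.
  - change (lagrange_remainder (S (S n)) t)
      with (lagrange_remainder (S n) t - taylor (lagrange_power (S n)) (S n) * (Derive uniformizer t * uniformizer t ^ S n)).
    rewrite IH, sum_Sn. unfold plus; simpl. ring.
Qed.

Lemma Derive_evalR l t : Derive (evalR l) t = evalR (pderiv l) t.
Proof.
  apply is_derive_unique.
  destruct (Cderiv_evalC l _ _ _ (Cderiv_id t)) as [H _].
  rewrite Cmult_1_l, evalC_RtoC in H. cbv beta in H.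
  refine (is_derive_ext (fun s => Re (evalC l (RtoC s))) _ _ _ _ H).
  intros s. now rewrite evalC_RtoC.
Qed.

Lemma bigO_Derive f n : smooth f -> bigO (S (S n)) f -> bigO (S n) (Derive f).
Proof.
  intros Hf H.
  eapply bigO_ext; [|apply (taylor_bigO _ n (smooth_Derive f Hf))].
  intros t _. cbv beta. rewrite (sum_n_ext_loc _ (fun _ => 0)).
  - rewrite sum_n_const. ring.
  - intros k Hk. rewrite taylor_Derive, (taylor_unique f (S n) (fun _ => 0) Hf); [apply (eq_trans (f_equal (fun x => x * _) (Rmult_0_r _))), Rmult_0_l| |lia].
    eapply bigO_ext; [|exact H]. intros s _. rewrite (sum_n_ext _ (fun _ => 0)) by (intros; apply Rmult_0_l).
    rewrite sum_n_const. ring.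
Qed.

Lemma bigO_pow_diff k f g n : bigO 0 f -> bigO 0 g -> bigO k (fun t => f t - g t) ->
  bigO k (fun t => f t ^ n - g t ^ n).
Proof.
  intros Hf Hg H. assert (Hgn : forall n, bigO 0 (fun t => g t ^ n)).
  { intros m; induction m as [|m IHm]; [apply smooth_bigO, (smooth_const 1) | apply (bigO_mult 0 0); assumption]. }
  induction n as [|n IH].
  - exists 0. split; [lra|]. intros. simpl. rewrite Rminus_diag, Rabs_R0. lra.
  - apply (bigO_ext k (fun t => f t * (f t ^ n - g t ^ n) + (f t - g t) * g t ^ n)); [intros; simpl; ring|].
    apply bigO_plus; [now apply (bigO_mult 0 k)|].
    rewrite <- (Nat.add_0_r k). now apply bigO_mult.
Qed.

Lemma exp_rem_RtoC n t : exp_rem n (RtoC t) = RtoC (exp t - sum_n (fun k => / INR (fact k) * t ^ k) n).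
Proof.
  unfold exp_rem. rewrite Cexp_RtoC, RtoC_minus. f_equal. f_equal.
  apply (real_poly_RtoC (fun t => sum_n (fun k => / INR (fact k) * t ^ k) n)
    (fun w => sum_n (fun k => RtoC (/ INR (fact k)) * w ^ k)%C n)).
  apply (real_poly_sum (fun k t => / INR (fact k) * t ^ k)). intros k.
  apply real_poly_mult; [apply real_poly_const | apply real_poly_pow, real_poly_id].
Qed.

(** The exponent in [e^(-z g)], with its saddle point at [0]. *)
Definition phase (w : C) : C := (Cexp w - w - 1)%C.

(** Take for [l] the Taylor polynomial of degree [N + 1] of the uniformizer [w].  Up to the remainder of
    the exponential, the differences are polynomials, so it suffices to estimate them on the positive
    axis.  There [w^2 = 2 g] and [lagrange_remainder_bigO] give the estimates for [w] itself, and
    replacing [w] by the polynomial costs terms of the same order. *)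
Lemma polynomial_uniformizer N :
  exists l K, 0 <= K /\ forall w : C, Cmod w <= 1 ->
    Cmod (phase w - evalC l w ^ 2 / 2)%C <= K * Cmod w ^ (N + 3) /\
    Cmod (1 - evalC (pderiv l) w * sum_n (fun n => RtoC (taylor (lagrange_power n) n) * evalC l w ^ n)%C N)%C
      <= K * Cmod w ^ (N + 1) /\
    Cmod (evalC l w - w)%C <= K * Cmod w ^ 2.
Proof.
  destruct (real_poly_sum (fun k t => taylor uniformizer k * t ^ k)
    (fun k w => (RtoC (taylor uniformizer k) * w ^ k)%C) (S N)) as [l [Hl _]].
  { intros k. apply real_poly_mult; [apply real_poly_const | apply real_poly_pow, real_poly_id]. }
  exists l.
  assert (D0 : bigO (S (S N)) (fun t => uniformizer t - evalR l t)).
  { eapply bigO_ext; [|apply (taylor_bigO uniformizer (S N) uniformizer_smooth)]. intros t _. rewrite <- Hl. reflexivity. }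
  assert (D1 : bigO (S N) (fun t => Derive uniformizer t - evalR (pderiv l) t)).
  { eapply bigO_ext; [|apply (bigO_Derive (fun t => uniformizer t - evalR l t))].
    - intros t _. rewrite Derive_minus, Derive_evalR; [reflexivity| |];
        (eexists; apply smooth_is_derive; [apply uniformizer_smooth || apply smooth_evalR]).
    - apply smooth_minus; [apply uniformizer_smooth | apply smooth_evalR].
    - exact D0. }
  assert (Hu : bigO 1 uniformizer) by
    (apply (bigO_mult 1 0 (fun t => t)); [apply (bigO_ext _ (fun t => t ^ 1)); [intros; ring | apply bigO_pow_id] | apply smooth_bigO, smooth_exp_quot_pow]).
  assert (Hl1 : bigO 1 (evalR l)).
  { apply (bigO_ext 1 (fun t => uniformizer t - (uniformizer t - evalR l t))); [intros; ring|].
    apply bigO_minus; [exact Hu | apply (bigO_weaken (S (S N))); [lia | exact D0]]. }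
  assert (H1 : bigO (N + 3) (fun t => sum_n (fun k => / INR (fact k) * t ^ k) (N + 2) - t - 1 - evalR l t ^ 2 * (1 / 2))).
  { apply (bigO_ext _ (fun t => (1 / 2) * ((uniformizer t - evalR l t) * (uniformizer t + evalR l t))
        - (exp t - sum_n (fun k => / INR (fact k) * t ^ k) (N + 2)))).
    { intros t _. assert (E := uniformizer_sqr t). simpl pow. nra. }
    apply bigO_minus.
    - apply bigO_scal. replace (N + 3)%nat with (S (S N) + 1)%nat by lia.
      apply bigO_mult; [exact D0 | now apply bigO_plus].
    - exists 3. split; [lra|]. intros t Ht.
      generalize (exp_rem_bound (N + 2) (RtoC t)).
      rewrite exp_rem_RtoC, !Cmod_R, (Rabs_pos_eq t) by lra.
      replace (N + 3)%nat with (S (N + 2)) by lia. intros H; apply H; lra. }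
  assert (H2 : bigO (S N) (fun t => 1 - evalR (pderiv l) t * sum_n (fun k => taylor (lagrange_power k) k * evalR l t ^ k) N)).
  { apply (bigO_ext _ (fun t => lagrange_remainder (S N) t
       + ((Derive uniformizer t - evalR (pderiv l) t) * sum_n (fun k => taylor (lagrange_power k) k * uniformizer t ^ k) N
          + evalR (pderiv l) t * sum_n (fun k => taylor (lagrange_power k) k * (uniformizer t ^ k - evalR l t ^ k)) N))).
    { intros t _. rewrite lagrange_remainder_sum.
      replace (sum_n (fun k => taylor (lagrange_power k) k * (uniformizer t ^ k - evalR l t ^ k)) N : R) with
       (sum_n (fun k => taylor (lagrange_power k) k * uniformizer t ^ k) N
        - sum_n (fun k => taylor (lagrange_power k) k * evalR l t ^ k) N); [ring|].
      clear. symmetry. induction N as [|n IH]; [rewrite !sum_O; simpl; ring|].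
      rewrite !sum_Sn, IH. unfold plus; simpl; ring. }
    apply bigO_plus; [apply lagrange_remainder_bigO | apply bigO_plus].
    - rewrite <- (Nat.add_0_r (S N)). apply bigO_mult; [exact D1|].
      apply smooth_bigO, smooth_sum. intros k; apply smooth_scal, smooth_pow, uniformizer_smooth.
    - apply (bigO_mult 0 (S N)); [apply smooth_bigO, smooth_evalR|].
      apply bigO_sum. intros k _. apply bigO_scal, bigO_pow_diff.
      + apply smooth_bigO, uniformizer_smooth.
      + apply smooth_bigO, smooth_evalR.
      + apply (bigO_weaken (S (S N))); [lia | exact D0]. }
  assert (H3 : bigO 2 (fun t => evalR l t - t)).
  { apply (bigO_ext _ (fun t => t ^ 1 * (Rpower (exp_quot t) (1 / 2) - Rpower (exp_quot 0) (1 / 2)) - (uniformizer t - evalR l t))).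
    { intros t _. rewrite Rpower_exp_quot_0. unfold uniformizer. ring. }
    apply bigO_minus; [|apply (bigO_weaken (S (S N))); [lia | exact D0]].
    apply (bigO_mult 1 1); [apply bigO_pow_id | apply (bigO_minus_value (fun t => Rpower (exp_quot t) (1 / 2))), smooth_exp_quot_pow]. }
  assert (P := real_poly_eval l). assert (P' := real_poly_eval (pderiv l)).
  eapply real_poly_bigO in H1.
  2:{ apply real_poly_minus; [apply real_poly_minus; [apply real_poly_minus|]|].
      - apply (real_poly_sum (fun k t => / INR (fact k) * t ^ k)). intros k.
        apply real_poly_mult; [apply real_poly_const | apply real_poly_pow, real_poly_id].
      - apply real_poly_id.
      - apply real_poly_const.
      - apply real_poly_mult; [apply real_poly_pow, P | apply real_poly_const]. }
  eapply real_poly_bigO in H2.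
  2:{ apply real_poly_minus; [apply real_poly_const | apply real_poly_mult; [exact P'|]].
      apply (real_poly_sum (fun k t => taylor (lagrange_power k) k * evalR l t ^ k)). intros k.
      apply real_poly_mult; [apply real_poly_const | apply real_poly_pow, P]. }
  eapply real_poly_bigO in H3.
  2:{ apply real_poly_minus; [exact P | apply real_poly_id]. }
  destruct H1 as [K1 [HK1 H1]], H2 as [K2 [HK2 H2]], H3 as [K3 [HK3 H3]].
  exists (3 + K1 + K2 + K3). split; [lra|]. intros w Hw.
  assert (Hpow : forall k, 0 <= Cmod w ^ k) by (intros; apply pow_le, Cmod_ge_0).
  split; [|split].
  - generalize (H1 w Hw) (exp_rem_bound (N + 2) w Hw) (Hpow (N + 3)%nat).
    replace (S (N + 2)) with (N + 3)%nat by lia. intros A1 A2 A3.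
    match type of A1 with Cmod ?x <= _ =>
      replace (phase w - evalC l w ^ 2 / 2)%C with (exp_rem (N + 2) w + x)%C end.
    + eapply Rle_trans; [apply Cmod_triangle|]. nra.
    + unfold phase, exp_rem. replace (RtoC (1 / 2)) with (/ 2)%C by (apply C_eq; simpl; field).
      unfold Cdiv. ring.
  - rewrite Nat.add_1_r. eapply Rle_trans; [apply H2, Hw|]. generalize (Hpow (S N)); nra.
  - eapply Rle_trans; [apply H3, Hw|]. generalize (Hpow 2%nat); nra.
Qed.

(** * The Gaussian integral and its moments *)

Definition gauss (x : R) : R := RInt (fun t => exp (- t ^ 2 / 2)) 0 x.

Lemma is_derive_gauss x : is_derive gauss x (exp (- x ^ 2 / 2)).
Proof.
  assert (Hc : forall t, continuous (fun t : R => exp (- t ^ 2 / 2)) t).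
  { intros t. apply @ex_derive_continuous. auto_derive. exact I. }
  apply (is_derive_RInt (fun t => exp (- t ^ 2 / 2)) gauss 0).
  - apply filter_forall. intros y. apply (RInt_correct (V := R_CompleteNormedModule)).
    apply (ex_RInt_continuous (V := R_CompleteNormedModule)). intros; apply Hc.
  - apply Hc.
Qed.

Lemma gauss_0 : gauss 0 = 0.
Proof. apply (RInt_point (V := R_CompleteNormedModule)). Qed.

(** Auxiliary function for the Gaussian integral: its derivative is minus that of
    [gauss x ^ 2 / 2], and it decays at infinity. *)
Definition gauss_aux (x : R) : R :=
  RInt (fun t => exp (- (x ^ 2 * (1 + t ^ 2)) / 2) / (1 + t ^ 2)) 0 1.

Lemma continuous_gauss_aux x t : continuous (fun t => exp (- (x ^ 2 * (1 + t ^ 2)) / 2) / (1 + t ^ 2)) t.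
Proof. apply @ex_derive_continuous. auto_derive. nra. Qed.

Lemma is_derive_gauss_aux x : is_derive gauss_aux x (- (exp (- x ^ 2 / 2) * gauss x)).
Proof.
  assert (E : RInt (fun t => - x * exp (- (x ^ 2 * (1 + t ^ 2)) / 2)) 0 1 = - (exp (- x ^ 2 / 2) * gauss x)).
  { apply is_RInt_unique.
    replace (- (exp (- x ^ 2 / 2) * gauss x))
      with (minus (- exp (- x ^ 2 / 2) * gauss (x * 1)) (- exp (- x ^ 2 / 2) * gauss (x * 0)) : R).
    2:{ rewrite Rmult_0_r, gauss_0, Rmult_1_r. unfold minus, plus, opp; simpl. ring. }
    apply (is_RInt_derive (fun t => - exp (- x ^ 2 / 2) * gauss (x * t))).
    - intros t _. eapply is_derive_eq.
      + apply @is_derive_scal. apply (is_derive_comp gauss); [apply is_derive_gauss|].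
        apply @is_derive_scal, @is_derive_id.
      + unfold scal; simpl; unfold mult, one; simpl.
        replace (- (x * (x * 1) * (1 + t * (t * 1))) / 2) with (- (x * (x * 1)) / 2 + - (x * t * (x * t * 1)) / 2) by field.
        rewrite exp_plus. ring.
    - intros t _. apply @ex_derive_continuous. auto_derive. exact I. }
  rewrite <- E.
  apply (is_derive_RInt_param_global (fun x t => exp (- (x ^ 2 * (1 + t ^ 2)) / 2) / (1 + t ^ 2))
          (fun x t => - x * exp (- (x ^ 2 * (1 + t ^ 2)) / 2))).
  - intros u v. auto_derive; [nra|]. change R in u. unfold Rdiv. simpl pow. set (e := exp _). field. nra.
  - intros u v.
    assert (C1 : continuous (fun p : R * R => fst p) (u, v)) by apply continuous_fst.
    assert (C2 : continuous (fun p : R * R => snd p) (u, v)) by apply continuous_snd.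
    apply (continuous_mult (fun p : R * R => - fst p)).
    + now apply @continuous_opp.
    + apply (continuous_comp (fun p : R * R => - (fst p ^ 2 * (1 + snd p ^ 2)) / 2) exp); [|apply continuous_exp].
      apply (continuous_mult (fun p : R * R => - (fst p ^ 2 * (1 + snd p ^ 2)))); [|apply continuous_const].
      apply @continuous_opp. apply (continuous_mult (fun p : R * R => fst p ^ 2)).
      * apply (continuous_mult (fun p : R * R => fst p)); [exact C1|].
        apply (continuous_mult (fun p : R * R => fst p)); [exact C1 | apply continuous_const].
      * apply (continuous_plus (V := R_NormedModule) (fun _ => 1)); [apply continuous_const|].
        apply (continuous_mult (fun p : R * R => snd p)); [exact C2|].
        apply (continuous_mult (fun p : R * R => snd p)); [exact C2 | apply continuous_const].
  - intros; apply continuous_gauss_aux.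
Qed.

(** The left side has derivative zero, and its value at [0] is [2 atan 1]. *)
Lemma gauss_sqr x : 0 <= x -> gauss x ^ 2 + 2 * gauss_aux x = PI / 2.
Proof.
  intros Hx.
  assert (H0 : gauss_aux 0 = PI / 4).
  { unfold gauss_aux. apply is_RInt_unique.
    replace (PI / 4) with (minus (atan 1) (atan 0) : R)
      by (rewrite atan_1, atan_0; unfold minus, plus, opp; simpl; ring).
    apply (is_RInt_ext (fun t => / (1 + t ^ 2))).
    { intros t _. replace (- (0 ^ 2 * (1 + t ^ 2)) / 2) with 0 by field. rewrite exp_0. symmetry; apply Rmult_1_l. }
    apply (is_RInt_derive atan).
    - intros t _. eapply is_derive_eq; [apply is_derive_atan | unfold Rsqr; f_equal; ring].
    - intros t _. apply @ex_derive_continuous. auto_derive. nra. }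
  set (k := fun x => gauss x ^ 2 + 2 * gauss_aux x).
  assert (Hk : forall t, is_derive k t 0).
  { intros t. eapply is_derive_eq.
    - apply @is_derive_plus.
      + apply (is_derive_ext (fun t => gauss t * gauss t)); [intros; simpl; ring|].
        apply is_derive_Rmult; apply is_derive_gauss.
      + apply @is_derive_scal, is_derive_gauss_aux.
    - unfold plus; simpl. ring. }
  destruct (MVT_gen k 0 x (fun _ => 0)) as [c [_ E]].
  - intros; apply Hk.
  - intros. apply derivable_continuous_pt. eexists. apply is_derive_Reals, Hk.
  - unfold k in E. rewrite gauss_0, H0 in E. lra.
Qed.

Lemma gauss_aux_bound x : 0 <= gauss_aux x <= exp (- x ^ 2 / 2).
Proof.
  assert (Hex : ex_RInt (fun t => exp (- (x ^ 2 * (1 + t ^ 2)) / 2) / (1 + t ^ 2)) 0 1).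
  { apply (ex_RInt_continuous (V := R_CompleteNormedModule)). intros; apply continuous_gauss_aux. }
  split.
  - apply RInt_ge_0; [lra | exact Hex|].
    intros t _. apply Rlt_le, Rdiv_lt_0_compat; [apply exp_pos | nra].
  - replace (exp (- x ^ 2 / 2)) with (RInt (fun _ => exp (- x ^ 2 / 2)) 0 1)
      by (rewrite RInt_const; unfold scal; simpl; unfold mult; simpl; ring).
    apply RInt_le; [lra | exact Hex | apply ex_RInt_const|].
    intros t _. apply (Rmult_le_reg_r (1 + t ^ 2)); [nra|].
    unfold Rdiv at 1. rewrite Rmult_assoc, Rinv_l, Rmult_1_r by nra.
    assert (exp (- (x ^ 2 * (1 + t ^ 2)) / 2) <= exp (- x ^ 2 / 2)).
    { assert (L : - (x ^ 2 * (1 + t ^ 2)) / 2 <= - x ^ 2 / 2) by nra.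
      destruct L as [L|L]; [left; now apply exp_increasing | rewrite L; lra]. }
    generalize (exp_pos (- x ^ 2 / 2)); nra.
Qed.

Lemma sqrt_PI2_ge_1 : 1 <= sqrt (PI / 2).
Proof. rewrite <- sqrt_1. apply sqrt_le_1; generalize PI2_1; lra. Qed.

Lemma gauss_limit x : 0 <= x -> Rabs (gauss x - sqrt (PI / 2)) <= 2 * exp (- x ^ 2 / 2).
Proof.
  intros Hx. assert (H := gauss_sqr x Hx). assert (B := gauss_aux_bound x).
  assert (S1 := sqrt_PI2_ge_1).
  assert (Hs : sqrt (PI / 2) * sqrt (PI / 2) = PI / 2) by (apply sqrt_sqrt; generalize PI2_1; lra).
  assert (G : 0 <= gauss x).
  { unfold gauss. apply RInt_ge_0; [exact Hx| |].
    - apply (ex_RInt_continuous (V := R_CompleteNormedModule)). intros t _.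
      apply @ex_derive_continuous. auto_derive. exact I.
    - intros; apply Rlt_le, exp_pos. }
  apply Rabs_le. split; nra.
Qed.

(** The integral of [v^n e^(-v^2 / 2)] over the positive half-line, by its recursion in [n]. *)
Fixpoint moment (n : nat) : R :=
  match n with
  | O => sqrt (PI / 2)
  | S O => 1
  | S (S m) => (INR m + 1) * moment m
  end.

Lemma nat_ind_two_steps (P : nat -> Prop) :
  P 0%nat -> P 1%nat -> (forall n, P n -> P (S (S n))) -> forall n, P n.
Proof.
  intros H0 H1 HS n. assert (P n /\ P (S n)); [|tauto].
  induction n as [|n [a b]]; auto.
Qed.

Lemma moment_pos n : 0 < moment n.
Proof.
  induction n as [| |n IH] using nat_ind_two_steps; simpl.
  - generalize sqrt_PI2_ge_1; lra.
  - lra.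
  - generalize (pos_INR n); nra.
Qed.

(** The duplication formula of the Gamma function at half-integers, in terms of moments. *)
Lemma moment_prod n : moment n * moment (S n) = INR (fact n) * sqrt (PI / 2).
Proof.
  induction n as [|n IH].
  - simpl. ring.
  - change (moment (S (S n))) with ((INR n + 1) * moment n).
    change (fact (S n)) with (S n * fact n)%nat. rewrite mult_INR, S_INR, Rmult_assoc, <- IH. ring.
Qed.

Lemma is_RInt_gen_antiderivative {V : NormedModule R_AbsRing} {Fa Fb : (R -> Prop) -> Prop}
  {FFa : Filter Fa} {FFb : Filter Fb} (f df : R -> V) (la lb : V) :
  filter_prod Fa Fb (fun ab => is_RInt df (fst ab) (snd ab) (minus (f (snd ab)) (f (fst ab)))) ->
  filterlim f Fa (locally la) -> filterlim f Fb (locally lb) ->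
  is_RInt_gen df Fa Fb (minus lb la).
Proof.
  intros H Ha Hb P HP.
  assert (L : filterlim (fun ab : R * R => minus (f (snd ab)) (f (fst ab))) (filter_prod Fa Fb) (locally (minus lb la))).
  { unfold minus. eapply filterlim_comp_2; [| | apply (filterlim_plus lb (opp la))].
    - eapply filterlim_comp; [apply filterlim_snd | exact Hb].
    - eapply filterlim_comp; [| apply filterlim_opp].
      eapply filterlim_comp; [apply filterlim_fst | exact Ha]. }
  specialize (L P HP). unfold filtermap in L.
  unfold filtermapi. generalize (filter_and _ _ H L). apply filter_imp.
  intros ab [H1 H2]. eexists; split; eassumption.
Qed.

Lemma exp_ge_pow x n : 0 <= x -> x ^ n <= INR (fact n) * exp x.
Proof.
  intros Hx. revert x Hx. induction n as [|n IH]; intros x Hx.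
  - simpl. generalize (exp_ineq1_le x); lra.
  - set (k := fun t => INR (fact (S n)) * exp t - t ^ S n).
    set (k' := fun t => INR (fact (S n)) * exp t - INR (S n) * t ^ n).
    destruct (MVT_gen k 0 x k') as [c [Hc E]].
    + intros t _. unfold k, k'. auto_derive; [exact I|].
      change (fact n + n * fact n)%nat with (fact (S n)). change (match n with O => 1 | S _ => INR n + 1 end) with (INR (S n)).
      set (a := INR (fact (S n))). set (b := INR (S n)). ring.
    + intros t _. apply continuity_pt_filterlim, (ex_derive_continuous k). unfold k. auto_derive. exact I.
    + rewrite Rmin_left, Rmax_right in Hc by lra.
      assert (0 <= k' c).
      { unfold k'. change (fact (S n)) with (S n * fact n)%nat. rewrite mult_INR.
        generalize (IH c ltac:(lra)) (pos_INR (S n)). nra. }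
      assert (0 <= k 0).
      { unfold k. rewrite exp_0, pow_i by lia. generalize (INR_fact_lt_0 (S n)); lra. }
      unfold k in *. nra.
Qed.

(** One term of the exponential series of [c v^2] dominates [v^n]. *)
Lemma poly_exp_decay c n : 0 < c -> exists K, 0 <= K /\
  forall v, 0 <= v -> v ^ n * exp (- (c * v ^ 2)) <= K.
Proof.
  intros Hc. exists (1 + INR (fact n) / c ^ n).
  assert (Hcn : 0 < c ^ n) by now apply pow_lt.
  assert (Hf := INR_fact_lt_0 n).
  assert (Hq : 0 < INR (fact n) / c ^ n) by now apply Rdiv_lt_0_compat.
  split; [lra|]. intros v Hv.
  assert (He := exp_pos (- (c * v ^ 2))).
  destruct (Rle_lt_dec v 1) as [L|L].
  - assert (v ^ n <= 1) by (rewrite <- (pow1 n); apply pow_incr; lra).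
    assert (0 <= v ^ n) by (apply pow_le; lra).
    assert (exp (- (c * v ^ 2)) <= 1).
    { rewrite <- exp_0. assert (M : - (c * v ^ 2) <= 0) by nra.
      destruct M as [M|M]; [left; now apply exp_increasing | rewrite M; lra]. }
    nra.
  - assert (P := exp_ge_pow (c * v ^ 2) n ltac:(nra)).
    rewrite Rpow_mult_distr in P.
    assert (Q : v ^ n <= (v ^ 2) ^ n) by (apply pow_incr; nra).
    rewrite exp_Ropp in *.
    assert (Hx := exp_pos (c * v ^ 2)).
    apply Rle_trans with (INR (fact n) / c ^ n); [|lra].
    apply (Rmult_le_reg_r (c ^ n * exp (c * v ^ 2))); [nra|].
    replace (v ^ n * / exp (c * v ^ 2) * (c ^ n * exp (c * v ^ 2))) with (c ^ n * v ^ n) by (field; lra).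
    replace (INR (fact n) / c ^ n * (c ^ n * exp (c * v ^ 2))) with (INR (fact n) * exp (c * v ^ 2)) by (field; lra).
    nra.
Qed.

(** * The Gamma function at half-integers *)

Lemma is_lim_of_inv_bound f l K : (forall t, 1 <= t -> Rabs (f t - l) <= K / t) -> is_lim f p_infty l.
Proof.
  intros H. apply is_lim_spec. intros eps. simpl.
  exists (Rmax 1 (K / eps)). intros t Ht.
  assert (He := cond_pos eps).
  assert (1 < t) by (eapply Rle_lt_trans; [apply Rmax_l | exact Ht]).
  assert (K / eps < t) by (eapply Rle_lt_trans; [apply Rmax_r | exact Ht]).
  eapply Rle_lt_trans; [apply H; lra|].
  apply (Rmult_lt_reg_r t); [lra|]. unfold Rdiv. rewrite Rmult_assoc, Rinv_l, Rmult_1_r by lra.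
  apply (Rmult_lt_compat_r eps) in H1; [|exact He]. unfold Rdiv in H1.
  rewrite Rmult_assoc, Rinv_l, Rmult_1_r in H1 by lra. lra.
Qed.

Lemma Rpower_half_nat t n : 0 < t -> Rpower t (INR n / 2) = sqrt t ^ n.
Proof.
  intros Ht. rewrite <- Rpower_pow by now apply sqrt_lt_R0.
  rewrite <- Rpower_sqrt by exact Ht. rewrite Rpower_mult. f_equal. field.
Qed.

Lemma is_lim_sqrt_pow_exp n : is_lim (fun t => sqrt t ^ n * exp (- t)) p_infty 0.
Proof.
  destruct (poly_exp_decay 1 (n + 2) Rlt_0_1) as [K [HK H]].
  apply (is_lim_of_inv_bound _ _ K). intros t Ht.
  assert (P := pow_le (sqrt t) n (sqrt_pos t)). assert (Q := exp_pos (- t)).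
  rewrite Rminus_0_r, Rabs_pos_eq by nra.
  specialize (H (sqrt t) (sqrt_pos t)).
  rewrite pow_add, pow2_sqrt, Rmult_1_l in H by lra.
  apply (Rmult_le_reg_r t); [lra|]. replace (K / t * t) with K by (field; lra). lra.
Qed.

Lemma is_derive_sqrt_pow_exp n t : 0 < t ->
  is_derive (fun t => sqrt t ^ S (S n) * exp (- t)) t
    ((INR n / 2 + 1) * (sqrt t ^ n * exp (- t)) - sqrt t ^ S (S n) * exp (- t)).
Proof.
  intros Ht. assert (Hs := sqrt_lt_R0 t Ht). assert (Hq := sqrt_sqrt t ltac:(lra)).
  apply (is_derive_ext_loc (fun t => t * (Rpower t (INR n / 2) * exp (- t)))).
  { exists (mkposreal t Ht). intros y Hy. unfold ball in Hy; simpl in Hy; unfold AbsRing_ball in Hy; simpl in Hy.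
    apply Rabs_def2 in Hy. unfold minus, plus, opp in Hy; simpl in Hy.
    rewrite Rpower_half_nat by lra. simpl. rewrite <- (sqrt_sqrt y) at 1 by lra. ring. }
  eapply is_derive_eq.
  - apply is_derive_Rmult; [apply @is_derive_id|]. apply is_derive_Rmult.
    + apply (is_derive_Rpower (fun t => t)); [exact Ht | apply @is_derive_id].
    + apply (is_derive_comp exp (fun t => - t)); [apply is_derive_exp | apply @is_derive_opp, @is_derive_id].
  - unfold one, scal, opp; simpl; unfold mult; simpl.
    replace (INR n / 2 - 1) with (INR n / 2 + - (1)) by ring.
    rewrite Rpower_plus, Rpower_Ropp, Rpower_1, Rpower_half_nat by exact Ht.
    set (a := sqrt t ^ n). set (e := exp (- t)).
    replace (sqrt t * (sqrt t * a) * e) with (t * a * e) by (rewrite <- Hq at 1; ring).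
    field. lra.
Qed.

(** Integration by parts, which is the functional equation of the Gamma function, steps from [n] to
    [n + 2].  The case [n = 1] reduces to the Gaussian integral through [t = v^2 / 2]. *)
Lemma gamma_antiderivative n : exists F : R -> R,
  (forall t, 0 < t -> is_derive F t (sqrt t ^ n * exp (- t))) /\
  continuous F 0 /\ F 0 = 0 /\ is_lim F p_infty (moment (S n) / sqrt 2 ^ n).
Proof.
  assert (H2 : 0 < sqrt 2) by (apply sqrt_lt_R0; lra).
  assert (H22 := sqrt_sqrt 2 ltac:(lra)).
  induction n as [| |n [F [F1 [F2 [F3 F4]]]]] using nat_ind_two_steps.
  - exists (fun t => 1 - exp (- t)). split; [|split; [|split]].
    + intros t Ht. auto_derive; [exact I | simpl; ring].
    + apply @ex_derive_continuous. auto_derive. exact I.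
    + rewrite Ropp_0, exp_0. ring.
    + replace (moment 1 / sqrt 2 ^ 0) with (1 - 0) by (simpl; field).
      apply is_lim_of_inv_bound with 1. intros t Ht.
      replace (1 - exp (- t) - (1 - 0)) with (- exp (- t)) by ring.
      rewrite Rabs_Ropp, Rabs_pos_eq by (apply Rlt_le, exp_pos).
      rewrite exp_Ropp. unfold Rdiv. rewrite Rmult_1_l. apply Rinv_le_contravar; [lra|].
      generalize (exp_ineq1_le t); lra.
  - exists (fun t => gauss (sqrt 2 * sqrt t) / sqrt 2 - sqrt t * exp (- t)).
    assert (Hc : forall c, continuous (fun t => c * sqrt t) 0).
    { intros c. apply (continuous_scal_r (V := R_NormedModule) c sqrt). apply continuous_sqrt. }
    split; [|split; [|split]].
    + intros t Ht. assert (Hs := sqrt_lt_R0 t Ht). assert (Hq := sqrt_sqrt t ltac:(lra)).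
      eapply is_derive_eq.
      * apply @is_derive_minus.
        -- apply (is_derive_ext (fun t => / sqrt 2 * gauss (sqrt 2 * sqrt t))); [intros; apply Rmult_comm|].
           apply @is_derive_scal. apply (is_derive_comp gauss); [apply is_derive_gauss|].
           apply @is_derive_scal. apply is_derive_Reals, derivable_pt_lim_sqrt, Ht.
        -- apply is_derive_Rmult; [apply is_derive_Reals, derivable_pt_lim_sqrt, Ht|].
           apply (is_derive_comp exp (fun t => - t)); [apply is_derive_exp | apply @is_derive_opp, @is_derive_id].
      * unfold minus, plus, opp, one, scal; simpl; unfold mult; simpl.
        replace (- (sqrt 2 * sqrt t * (sqrt 2 * sqrt t * 1)) / 2) with (- t) by nra.
        field. lra.
    + apply (continuous_minus (V := R_NormedModule)).
      * apply (continuous_mult (fun t => gauss (sqrt 2 * sqrt t)) (fun _ => / sqrt 2)); [|apply continuous_const].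
        apply (continuous_comp (fun t => sqrt 2 * sqrt t) gauss); [apply Hc|].
        apply @ex_derive_continuous. eexists; apply is_derive_gauss.
      * apply (continuous_mult sqrt); [apply continuous_sqrt|].
        apply @ex_derive_continuous. auto_derive. exact I.
    + rewrite sqrt_0, Rmult_0_r, gauss_0. field. lra.
    + replace (moment 2 / sqrt 2 ^ 1) with (sqrt (PI / 2) / sqrt 2 - 0) by (simpl; field; lra).
      apply (is_lim_minus' (fun t => gauss (sqrt 2 * sqrt t) / sqrt 2)).
      * apply is_lim_of_inv_bound with 2. intros t Ht.
        replace (gauss (sqrt 2 * sqrt t) / sqrt 2 - sqrt (PI / 2) / sqrt 2)
          with ((gauss (sqrt 2 * sqrt t) - sqrt (PI / 2)) / sqrt 2) by (field; lra).
        assert (Hq := sqrt_sqrt t ltac:(lra)). assert (Hs := sqrt_pos t).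
        assert (G := gauss_limit (sqrt 2 * sqrt t) ltac:(nra)).
        replace (- (sqrt 2 * sqrt t) ^ 2 / 2) with (- t) in G by (simpl; nra).
        unfold Rdiv at 1. rewrite Rabs_mult, (Rabs_pos_eq (/ sqrt 2)) by (apply Rlt_le, Rinv_0_lt_compat, H2).
        assert (S1 : / sqrt 2 <= 1).
        { rewrite <- Rinv_1. apply Rinv_le_contravar; [lra|]. rewrite <- sqrt_1. apply sqrt_le_1; lra. }
        assert (/ sqrt 2 > 0) by (apply Rinv_0_lt_compat, H2).
        assert (Ee : exp (- t) <= / t).
        { rewrite exp_Ropp. apply Rinv_le_contravar; [lra|]. generalize (exp_ineq1_le t); lra. }
        generalize (Rabs_pos (gauss (sqrt 2 * sqrt t) - sqrt (PI / 2))). unfold Rdiv at 2. nra.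
      * eapply is_lim_ext; [|apply (is_lim_sqrt_pow_exp 1)]. intros; simpl; ring.
  - exists (fun t => (INR n / 2 + 1) * F t - sqrt t ^ S (S n) * exp (- t)). split; [|split; [|split]].
    + intros t Ht. eapply is_derive_eq.
      * apply @is_derive_minus; [apply @is_derive_scal, F1, Ht | apply is_derive_sqrt_pow_exp, Ht].
      * unfold minus, plus, opp; simpl; ring.
    + apply (continuous_minus (V := R_NormedModule)).
      * apply (continuous_scal_r (V := R_NormedModule)), F2.
      * apply (continuous_mult (fun t => sqrt t ^ S (S n))).
        -- apply (continuous_comp sqrt (fun x => x ^ S (S n))); [apply continuous_sqrt|].
           apply @ex_derive_continuous. auto_derive. exact I.
        -- apply @ex_derive_continuous. auto_derive. exact I.
    + rewrite F3, sqrt_0. simpl. ring.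
    + replace (moment (S (S (S n))) / sqrt 2 ^ S (S n)) with ((INR n / 2 + 1) * (moment (S n) / sqrt 2 ^ n) - 0).
      * apply (is_lim_minus' (fun t => (INR n / 2 + 1) * F t)); [|apply is_lim_sqrt_pow_exp].
        apply (is_lim_scal_l F (INR n / 2 + 1) p_infty (Finite (moment (S n) / sqrt 2 ^ n))), F4.
      * change (moment (S (S (S n)))) with ((INR (S n) + 1) * moment (S n)). rewrite S_INR.
        assert (0 < sqrt 2 ^ n) by (apply pow_lt, H2).
        change (sqrt 2 ^ S (S n)) with (sqrt 2 * (sqrt 2 * sqrt 2 ^ n)).
        rewrite <- Rmult_assoc, H22. field. lra.
Qed.

Lemma Gamma_half n : Gamma (INR n / 2 + 1) = moment (S n) / sqrt 2 ^ n.
Proof.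
  destruct (gamma_antiderivative n) as [F [F1 [F2 [F3 F4]]]].
  unfold Gamma. apply is_RInt_gen_unique.
  replace (moment (S n) / sqrt 2 ^ n) with (minus (moment (S n) / sqrt 2 ^ n) 0 : R)
    by (unfold minus, plus, opp; simpl; ring).
  apply (is_RInt_gen_antiderivative F).
  - exists (fun a => 0 < a) (fun b => 0 < b).
    + exists (mkposreal 1 Rlt_0_1). intros; assumption.
    + exists 0. auto.
    + intros a b Ha Hb. simpl.
      apply (is_RInt_ext (fun t => sqrt t ^ n * exp (- t))).
      * intros t Ht. assert (0 < t) by (generalize (Rmin_glb_lt a b 0 Ha Hb); lra).
        rewrite <- Rpower_half_nat by assumption. do 2 f_equal. ring.
      * apply (is_RInt_derive (V := R_CompleteNormedModule) F).
        -- intros t Ht. apply F1. generalize (Rmin_glb_lt a b 0 Ha Hb); lra.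
        -- intros t Ht. apply (continuous_mult (fun t => sqrt t ^ n)).
           ++ apply (continuous_comp sqrt (fun x => x ^ n)); [apply continuous_sqrt|].
              apply @ex_derive_continuous. auto_derive. exact I.
           ++ apply @ex_derive_continuous. auto_derive. exact I.
  - rewrite <- F3 at 2. eapply filterlim_filter_le_1; [|exact F2].
    intros P [d Hd]. exists d. intros y Hy _. now apply Hd.
  - exact F4.
Qed.

Lemma coef_moment n : coef n * sqrt (PI / 2) = taylor (lagrange_power n) n * moment n.
Proof.
  unfold coef, taylor. rewrite Gamma_half.
  rewrite (Derive_n_ext _ (lagrange_power n)).
  2:{ intros t. unfold lagrange_power. rewrite phi_base_exp_quot, Rpower_inv_base by apply exp_quot_pos. reflexivity. }
  rewrite Rpower_half_nat by lra.
  assert (Hp := moment_prod n). assert (H1 := moment_pos (S n)).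
  assert (0 < sqrt 2 ^ n) by (apply pow_lt, sqrt_lt_R0; lra).
  assert (Hf := INR_fact_lt_0 n).
  replace (moment n) with (INR (fact n) * sqrt (PI / 2) / moment (S n)) by (rewrite <- Hp; field; lra).
  field. lra.
Qed.

(** * The phase along the ray of steepest descent and along the horizontal line *)

Lemma exp_le_compat x y : x <= y -> exp x <= exp y.
Proof. intros [H| ->]; [left; now apply exp_increasing | lra]. Qed.

(** [Re (e^(2 i b) g (s e^(-i b)))], the height of the phase on the ray of steepest descent for
    [th = 2 b]. *)
Definition ray_height (b s : R) : R := exp (s * cos b) * cos (2 * b - s * sin b) - s * cos b - cos (2 * b).

(** [Re (e^(i th) g (x - i th))], the height of the phase on the horizontal line. *)
Definition line_height (th x : R) : R := exp x - (x + 1) * cos th - th * sin th.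

Lemma is_derive_ray_height b s : is_derive (ray_height b) s (exp (s * cos b) * cos (b - s * sin b) - cos b).
Proof.
  unfold ray_height. auto_derive; [exact I|].
  replace (b - s * sin b) with ((2 * b - s * sin b) - b) by ring.
  rewrite (cos_minus (2 * b - s * sin b) b). unfold Rminus. ring.
Qed.

Lemma cos_ge_of_abs_le b y : 0 <= b <= PI -> 0 <= y <= 2 * b -> cos b <= cos (b - y).
Proof.
  intros Hb Hy. destruct (Rle_lt_dec y b) as [L|L].
  - apply cos_decr_1; lra.
  - rewrite <- (cos_neg (b - y)). apply cos_decr_1; lra.
Qed.

(** The derivative is [e^(s cos b) cos (b - s sin b) - cos b].  Since [|b - s sin b| <= b], the second
    cosine is at least [cos b], and the exponential is at least or at most [1] according to the sign
    of [cos b]. *)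
Lemma ray_height_increasing b s1 s2 :
  0 <= b <= PI -> 0 <= s1 <= s2 -> s2 * sin b <= 2 * b -> ray_height b s1 <= ray_height b s2.
Proof.
  intros Hb Hs Hc.
  assert (Hsin : 0 <= sin b) by (apply sin_ge_0; lra).
  destruct (MVT_gen (ray_height b) s1 s2 (fun s => exp (s * cos b) * cos (b - s * sin b) - cos b)) as [c [Hcc E]].
  - intros; apply is_derive_ray_height.
  - intros. apply continuity_pt_filterlim, (ex_derive_continuous (ray_height b)). eexists; apply is_derive_ray_height.
  - rewrite Rmin_left, Rmax_right in Hcc by lra.
    assert (K := cos_ge_of_abs_le b (c * sin b) Hb ltac:(nra)).
    assert (0 <= exp (c * cos b) * cos (b - c * sin b) - cos b).
    { assert (Hp := exp_pos (c * cos b)).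
      destruct (Rle_lt_dec 0 (cos b)) as [P|P].
      - assert (1 <= exp (c * cos b)) by (rewrite <- exp_0; apply exp_le_compat; nra). nra.
      - assert (exp (c * cos b) <= 1) by (rewrite <- exp_0; apply exp_le_compat; nra). nra. }
    nra.
Qed.

Lemma ray_height_opp b s : ray_height (- b) s = ray_height b s.
Proof.
  unfold ray_height. rewrite cos_neg, sin_neg. replace (2 * - b) with (- (2 * b)) by ring.
  replace (- (2 * b) - s * - sin b) with (- (2 * b - s * sin b)) by ring. rewrite !cos_neg. reflexivity.
Qed.

(** The parameter at which the ray meets the line [Im w = - 2 b].  It is [2 b / sin b], or [2] when
    [b = 0], and stays bounded as long as [b] keeps away from [PI] and [- PI]. *)
Lemma corner_exists delta : 0 < delta ->
  exists T, forall b, Rabs b <= PI - delta / 2 -> exists S, 1 <= S <= T /\ S * sin b = 2 * b.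
Proof.
  intros Hd. set (eta := Rmin (delta / 2) 1).
  assert (He : 0 < eta <= 1) by (unfold eta; split; [apply Rmin_glb_lt; lra | apply Rmin_r]).
  assert (He' : eta <= delta / 2) by apply Rmin_l.
  assert (HPI : 3 < PI) by (generalize PI2_3_2; lra).
  assert (HPI4 := PI_4).
  assert (Hm : 0 < sin eta) by (apply sin_gt_0; lra).
  exists (4 + 2 * PI / sin eta).
  assert (Hq : 0 < 2 * PI / sin eta) by (apply Rdiv_lt_0_compat; lra).
  assert (main : forall b, 0 < b -> b <= PI - delta / 2 -> exists S, 1 <= S <= 4 + 2 * PI / sin eta /\ S * sin b = 2 * b).
  { intros b Hb Hb2. assert (Hsb : 0 < sin b) by (apply sin_gt_0; lra).
    exists (2 * b / sin b). split; [split|field; lra].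
    - apply (Rmult_le_reg_r (sin b)); [exact Hsb|]. replace (2 * b / sin b * sin b) with (2 * b) by (field; lra).
      generalize (sin_lt_x b Hb); lra.
    - apply (Rmult_le_reg_r (sin b)); [exact Hsb|]. replace (2 * b / sin b * sin b) with (2 * b) by (field; lra).
      destruct (Rle_lt_dec b 1) as [L|L].
      + destruct (MVT_gen sin 0 b cos) as [c [Hc E]].
        * intros; apply is_derive_sin.
        * intros; apply continuity_sin.
        * rewrite Rmin_left, Rmax_right in Hc by lra. rewrite sin_0 in E.
          assert (1 / 2 <= cos c) by (rewrite <- cos_PI3; apply cos_decr_1; lra). nra.
      + assert (sin eta <= sin b).
        { destruct (Rle_lt_dec b (PI / 2)) as [M|M].
          - apply sin_incr_1; lra.
          - rewrite <- (sin_PI_x b). apply sin_incr_1; lra. }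
        assert (2 * PI <= 2 * PI / sin eta * sin b).
        { replace (2 * PI) with (2 * PI / sin eta * sin eta) at 1 by (field; lra).
          apply Rmult_le_compat_l; lra. }
        nra. }
  intros b Hb. destruct (Rtotal_order b 0) as [L|[->|L]].
  - rewrite Rabs_left in Hb by lra. destruct (main (- b) ltac:(lra) Hb) as [S [H1 H2]].
    exists S; split; [exact H1|]. rewrite sin_neg in H2. lra.
  - exists 2. rewrite sin_0. split; lra.
  - rewrite Rabs_pos_eq in Hb by lra. apply main; assumption.
Qed.

(** Let [x0] be the abscissa of the corner.  To the right of it the height increases when
    [cos th <= e^x0], which holds if [cos th <= 0] or if [|th| <= PI] (the corner is then in the right
    half-plane).  In the remaining case [|th|] is in the fourth quadrant and the term [- th sin th]
    alone is large enough. *)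
Lemma line_height_lower_bound delta : 0 < delta -> exists c, 0 < c /\
  forall th S x, Rabs th <= 2 * PI - delta -> 0 <= S -> S * cos (th / 2) <= x ->
    line_height th (S * cos (th / 2)) <= line_height th x \/ c <= line_height th x.
Proof.
  intros Hd. set (eta := Rmin (delta / 2) 1).
  assert (He : 0 < eta <= 1) by (unfold eta; split; [apply Rmin_glb_lt; lra | apply Rmin_r]).
  assert (He' : eta <= delta / 2) by apply Rmin_l.
  assert (HPI : 3 < PI) by (generalize PI2_3_2; lra).
  assert (Hm : 0 < sin eta) by (apply sin_gt_0; lra).
  exists (sin eta). split; [exact Hm|]. intros th S x Hth HS.
  set (x0 := S * cos (th / 2)). intros Hx.
  assert (Hmono : cos th <= exp x0 -> line_height th x0 <= line_height th x).
  { intros K. unfold line_height.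
    assert (exp x0 * (1 + (x - x0)) <= exp x).
    { replace x with (x0 + (x - x0)) at 2 by ring. rewrite exp_plus.
      apply Rmult_le_compat_l; [left; apply exp_pos | apply exp_ineq1_le]. }
    nra. }
  destruct (Rle_lt_dec (cos th) 0) as [C0|C0].
  { left. apply Hmono. generalize (exp_pos x0); lra. }
  destruct (Rle_lt_dec (Rabs th) PI) as [T|T].
  { left. apply Hmono. apply Rle_trans with 1; [apply COS_bound|].
    rewrite <- exp_0. apply exp_le_compat. unfold x0. apply Rmult_le_pos; [exact HS|].
    apply Rabs_le_between in T. apply cos_ge_0; lra. }
  right.
  assert (Ha : - th * sin th = - Rabs th * sin (Rabs th)).
  { unfold Rabs. destruct (Rcase_abs th); [rewrite sin_neg|]; ring. }
  assert (Hc : cos (Rabs th) = cos th).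
  { unfold Rabs. destruct (Rcase_abs th); [apply cos_neg | reflexivity]. }
  set (u := 2 * PI - Rabs th).
  assert (Hsu : sin (Rabs th) = - sin u).
  { unfold u. rewrite sin_minus, sin_2PI, cos_2PI. ring. }
  assert (Hu : eta <= u <= PI / 2).
  { unfold u. split; [lra|]. destruct (Rle_lt_dec (2 * PI - Rabs th) (PI / 2)) as [M|M]; [exact M|exfalso].
    rewrite <- Hc in C0. generalize (cos_le_0 (Rabs th)); lra. }
  assert (sin eta <= sin u) by (apply sin_incr_1; lra).
  unfold line_height.
  assert (Hex := exp_ineq1_le x). assert (Hpx := exp_pos x). assert (Hcb := proj2 (COS_bound th)).
  assert (0 <= exp x - (x + 1) * cos th) by nra.
  nra.
Qed.

Lemma line_height_growth th x : Rabs th <= 2 * PI -> x - 2 * PI - 2 <= line_height th x.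
Proof.
  intros Hth. unfold line_height.
  assert (H1 : th * sin th <= 2 * PI).
  { eapply Rle_trans; [apply Rle_abs|]. rewrite Rabs_mult.
    assert (Rabs (sin th) <= 1) by (apply Rabs_le, SIN_bound).
    generalize (Rabs_pos th) (Rabs_pos (sin th)); nra. }
  assert (Hc := COS_bound th).
  destruct (Rle_lt_dec (-1) x) as [L|L].
  - assert (H2 : (x + 1) * cos th <= x + 1) by nra.
    assert (2 * x - 1 <= exp x).
    { destruct (Rle_lt_dec x 1); [generalize (exp_ineq1_le x); lra|].
      assert (E := exp_ineq1_le (x - 1)). assert (E1 := exp_ineq1_le 1).
      replace x with (1 + (x - 1)) at 2 by ring. rewrite exp_plus. nra. }
    lra.
  - assert (H2 : (x + 1) * cos th <= - (x + 1)) by nra.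
    generalize (exp_pos x); lra.
Qed.

(** * Exponential of the phase *)

Definition phase_exp (z w : C) : C := Cexp (- (z * phase w))%C.

Lemma entire_phase_exp z : entire (phase_exp z) (fun w => - z * (Cexp w - 1) * phase_exp z w)%C.
Proof.
  split.
  - intros g t d H. unfold phase_exp, phase. eapply Cderiv_eq.
    + apply Cderiv_Cexp, Cderiv_opp, Cderiv_scal, Cderiv_minus; [|apply Cderiv_const].
      apply Cderiv_minus; [apply Cderiv_Cexp, H | exact H].
    + cbv beta. ring.
  - intros U u x H. unfold phase_exp, phase.
    apply Ccont_Cexp, Ccont_opp, Ccont_mult; [apply Ccont_const|].
    apply Ccont_minus; [apply Ccont_minus; [apply Ccont_Cexp, H | exact H] | apply Ccont_const].
  - intros U u x H. unfold phase_exp, phase. apply Ccont_mult.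
    + apply Ccont_mult; [apply Ccont_const | apply Ccont_minus; [apply Ccont_Cexp, H | apply Ccont_const]].
    + apply Ccont_Cexp, Ccont_opp, Ccont_mult; [apply Ccont_const|].
      apply Ccont_minus; [apply Ccont_minus; [apply Ccont_Cexp, H | exact H] | apply Ccont_const].
Qed.

Definition polar (r th : R) : C := (r * cos th, r * sin th).

Lemma Cexp_polar x y : Cexp (x, y) = polar (exp x) y.
Proof. reflexivity. Qed.

Lemma phase_exp_ray r th s :
  Cmod (phase_exp (polar r th) (polar s (- (th / 2)))) = exp (- (r * ray_height (th / 2) s)).
Proof.
  unfold phase_exp. rewrite Cmod_Cexp. f_equal. unfold phase, polar, ray_height. simpl.
  rewrite cos_neg, sin_neg.
  set (b := th / 2). replace th with (b + b) by (unfold b; field).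
  replace (2 * b - s * sin b) with (b + b - s * sin b) by ring. replace (2 * b) with (b + b) by ring.
  replace (s * - sin b) with (- (s * sin b)) by ring. rewrite cos_neg, sin_neg.
  rewrite cos_minus. rewrite !cos_plus, !sin_plus. generalize (sin2_cos2 b). unfold Rsqr. intros Hb.
  set (co := cos b) in *. set (si := sin b) in *.
  set (e := exp (s * co)). set (cy := cos (s * si)). set (sy := sin (s * si)).
  assert (Hco : co * co = 1 - si * si) by lra.
  ring [Hco].
Qed.

Lemma phase_exp_line r th x : Cmod (phase_exp (polar r th) (x, - th)) = exp (- (r * line_height th x)).
Proof.
  unfold phase_exp. rewrite Cmod_Cexp. f_equal. unfold phase, polar, line_height. simpl.
  rewrite cos_neg, sin_neg. generalize (sin2_cos2 th). unfold Rsqr. intros Hb.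
  assert (Hco : cos th * cos th = 1 - sin th * sin th) by lra.
  ring [Hco].
Qed.

Lemma corner_point S th : S * sin (th / 2) = 2 * (th / 2) -> polar S (- (th / 2)) = (S * cos (th / 2), - th).
Proof. intros H. unfold polar. rewrite cos_neg, sin_neg. f_equal. lra. Qed.

Lemma ray_height_corner S th : S * sin (th / 2) = 2 * (th / 2) ->
  ray_height (th / 2) S = line_height th (S * cos (th / 2)).
Proof.
  intros H. generalize (phase_exp_ray 1 th S) (phase_exp_line 1 th (S * cos (th / 2))).
  rewrite corner_point by exact H. intros -> E. apply exp_inv in E. lra.
Qed.

(** * Gaussian integrals in the complex plane *)

(** The model integrand [e^(-z w^2 / 2)]. *)
Definition gauss_exp (z w : C) : C := Cexp (- (z * (w * w) / 2))%C.

Lemma entire_gauss_exp z : entire (gauss_exp z) (fun w => - (z * w) * gauss_exp z w)%C.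
Proof.
  assert (E : forall u : C, (- (z * (u * u) / 2))%C = (- (z / 2) * (u * u))%C) by (intros; field; intros H; apply RtoC_inj in H; lra).
  split.
  - intros g t d H. unfold gauss_exp.
    apply (Cderiv_ext (fun s => Cexp (- (z / 2) * (g s * g s)))%C); [intros; now rewrite <- E|].
    rewrite E. eapply Cderiv_eq.
    + apply Cderiv_Cexp, Cderiv_scal, Cderiv_mult; exact H.
    + cbv beta. field.
  - intros U u x H. unfold gauss_exp, Cdiv.
    apply Ccont_Cexp, Ccont_opp, Ccont_mult; [|apply Ccont_const].
    apply Ccont_mult; [apply Ccont_const | apply Ccont_mult; exact H].
  - intros U u x H. unfold gauss_exp, Cdiv. apply Ccont_mult.
    + apply Ccont_opp, Ccont_mult; [apply Ccont_const | exact H].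
    + apply Ccont_Cexp, Ccont_opp, Ccont_mult; [|apply Ccont_const].
      apply Ccont_mult; [apply Ccont_const | apply Ccont_mult; exact H].
Qed.

(** The primitive of [w^n e^(-z w^2 / 2)] vanishing at [0]; integration by parts leads from [n] to
    [n + 2]. *)
Fixpoint gauss_primitive (z : C) (n : nat) (w : C) : C :=
  match n with
  | O => radial_primitive (gauss_exp z) w
  | S O => ((1 - gauss_exp z w) / z)%C
  | S (S m) => ((RtoC (INR m + 1) * gauss_primitive z m w - w ^ S m * gauss_exp z w) / z)%C
  end.

Lemma Cderiv_gauss_primitive (z : C) n g g' : z <> 0%C ->
  (forall t, Cderiv g t (g' t)) -> (forall t, Ccont g' t) ->
  forall t, Cderiv (fun s => gauss_primitive z n (g s)) t (g' t * (g t ^ n * gauss_exp z (g t)))%C.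
Proof.
  intros Hz Hg Hg' t.
  assert (Hgz : Cderiv (fun s => gauss_exp z (g s)) t (g' t * (- (z * g t) * gauss_exp z (g t)))%C)
    by apply (entire_deriv _ _ (entire_gauss_exp z)), Hg.
  assert (Hdiv : forall f d, Cderiv f t d -> Cderiv (fun s => (f s / z)%C) t (d / z)%C).
  { intros f d H. eapply Cderiv_eq; [apply Cderiv_mult; [exact H | apply Cderiv_const]|]. cbv beta. unfold Cdiv. ring. }
  induction n as [| |n IH] using nat_ind_two_steps; simpl gauss_primitive.
  - eapply Cderiv_eq.
    + apply (Cderiv_radial_primitive _ _ g g' (entire_gauss_exp z)); assumption.
    + simpl. ring.
  - eapply Cderiv_eq.
    + apply Hdiv, Cderiv_minus; [apply Cderiv_const | exact Hgz].
    + simpl. field. exact Hz.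
  - eapply Cderiv_eq.
    + apply Hdiv, Cderiv_minus; [apply Cderiv_scal, IH|].
      apply Cderiv_mult; [apply Cderiv_pow, Hg | exact Hgz].
    + cbv beta. rewrite !Cpow_S, S_INR. field. exact Hz.
Qed.

Lemma gauss_exp_0 z : gauss_exp z 0%C = 1%C.
Proof. unfold gauss_exp. rewrite <- Cexp_0. f_equal. unfold Cdiv. ring. Qed.

Lemma gauss_primitive_0 (z : C) n : z <> 0%C -> gauss_primitive z n 0%C = 0%C.
Proof.
  intros Hz. induction n as [| |n IH] using nat_ind_two_steps; simpl gauss_primitive.
  - apply radial_primitive_0.
  - rewrite gauss_exp_0. field. exact Hz.
  - rewrite IH. field. exact Hz.
Qed.

Lemma polar_scal s a : polar s a = (RtoC s * polar 1 a)%C.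
Proof. unfold polar. apply C_eq; simpl; ring. Qed.

Lemma Cmod_polar s a : 0 <= s -> Cmod (polar s a) = s.
Proof.
  intros Hs. unfold polar, Cmod. simpl fst; simpl snd.
  replace ((s * cos a) ^ 2 + (s * sin a) ^ 2) with (s ^ 2).
  - now apply sqrt_pow2.
  - generalize (sin2_cos2 a); unfold Rsqr. intros E.
    replace (s ^ 2) with (s ^ 2 * (sin a * sin a + cos a * cos a)) by (rewrite E; ring). ring.
Qed.

Lemma polar_mult a b x y : (polar a x * polar b y)%C = polar (a * b) (x + y).
Proof. unfold polar. apply C_eq; simpl; rewrite ?cos_plus, ?sin_plus; ring. Qed.

Lemma polar_0 a : polar a 0 = RtoC a.
Proof. unfold polar. apply C_eq; simpl; rewrite ?cos_0, ?sin_0; ring. Qed.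

Lemma polar_neq_0 r th : 0 < r -> polar r th <> 0%C.
Proof. intros Hr E. apply (f_equal Cmod) in E. rewrite Cmod_polar, Cmod_0 in E; lra. Qed.

Lemma gauss_exp_near_ray r th s w : 0 <= r -> 0 <= s ->
  Cmod (w - polar s (- (th / 2)))%C <= s / 10 ->
  Cmod (gauss_exp (polar r th) w) <= exp (- (r * s ^ 2 / 4)).
Proof.
  intros Hr Hs Hw. unfold gauss_exp. rewrite Cmod_Cexp. apply exp_le_compat.
  set (p := polar s (- (th / 2))) in *. set (d := (w - p)%C) in *. set (z := polar r th).
  assert (Ew : (z * (w * w))%C = (RtoC (r * s ^ 2) + (2 * (z * p) * d + z * d * d))%C).
  { replace (RtoC (r * s ^ 2)) with (z * (p * p))%C.
    - replace w with (p + d)%C by (unfold d; ring). ring.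
    - unfold z, p. rewrite !polar_mult, <- polar_0. f_equal; [ring | field]. }
  set (e := (2 * (z * p) * d + z * d * d)%C) in *.
  assert (He : Cmod e <= r * s ^ 2 / 2).
  { unfold e. eapply Rle_trans; [apply Cmod_triangle|]. rewrite !Cmod_mult.
    unfold z, p. rewrite !Cmod_polar by lra. rewrite Cmod_R, Rabs_pos_eq by lra.
    assert (H0 := Cmod_ge_0 d).
    assert (r * (Cmod d * Cmod d) <= r * (s / 10 * (s / 10))) by (apply Rmult_le_compat_l; nra).
    assert (r * (s * Cmod d) <= r * (s * (s / 10))) by (apply Rmult_le_compat_l; nra).
    nra. }
  replace (Re (- (z * (w * w) / 2))%C) with (- (Re (z * (w * w))%C / 2)).
  2:{ generalize (z * (w * w))%C. intros [a b]. simpl. field. }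
  rewrite Ew.
  assert (Re (RtoC (r * s ^ 2) + e)%C = r * s ^ 2 + Re e) by (destruct e; reflexivity).
  generalize (re_le_Cmod e). intros K. apply Rabs_le_between in K. lra.
Qed.

Lemma phase_quadratic w : Cmod w <= 1 -> Cmod (phase w - w * w / 2)%C <= 3 * Cmod w ^ 3.
Proof.
  intros Hw. generalize (exp_rem_bound 2 w Hw).
  replace (exp_rem 2 w) with (phase w - w * w / 2)%C; [auto|].
  unfold exp_rem, phase. rewrite !sum_Sn, sum_O. unfold plus; simpl.
  rewrite Rinv_1. replace (RtoC (/ (1 + 1))) with (/ 2)%C by (apply C_eq; simpl; field).
  unfold Cdiv. ring.
Qed.

Lemma ray_height_quadratic th s : 0 <= s <= 1 / 12 -> s ^ 2 / 4 <= ray_height (th / 2) s.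
Proof.
  intros Hs.
  set (w := polar s (- (th / 2))). set (z := polar 1 th).
  assert (Hw : Cmod w = s) by (apply Cmod_polar; lra).
  assert (Hz : Cmod z = 1) by (apply Cmod_polar; lra).
  assert (E : Re (z * phase w)%C = ray_height (th / 2) s).
  { generalize (phase_exp_ray 1 th s). fold z w. unfold phase_exp. rewrite Cmod_Cexp. intros K.
    apply exp_inv in K. destruct (z * phase w)%C as [a b]. simpl in *. unfold Re in *; simpl in *. lra. }
  rewrite <- E.
  set (e := (phase w - w * w / 2)%C).
  assert (He : Cmod (z * e)%C <= s ^ 2 / 4).
  { rewrite Cmod_mult, Hz, Rmult_1_l. eapply Rle_trans; [apply phase_quadratic; rewrite Hw; lra|].
    rewrite Hw. simpl. nra. }
  replace (z * phase w)%C with (RtoC (s ^ 2 / 2) + z * e)%C.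
  - generalize (re_le_Cmod (z * e)%C). intros K. apply Rabs_le_between in K.
    assert (Re (RtoC (s ^ 2 / 2) + z * e)%C = s ^ 2 / 2 + Re (z * e)%C) by reflexivity. lra.
  - replace (RtoC (s ^ 2 / 2)) with (z * (w * w) / 2)%C.
    + unfold e, Cdiv. ring.
    + unfold z, w. rewrite !polar_mult. replace (th + (- (th / 2) + - (th / 2))) with 0 by field.
      rewrite polar_0. apply C_eq; simpl; field.
Qed.

(** On the ray [w = e^(-i th / 2) s] the exponent [z w^2] is the real number [(q s)^2], so the
    primitive is the real Gaussian integral. *)
Lemma gauss_primitive_ray q th s : 0 < q -> 0 <= s ->
  gauss_primitive (polar (q ^ 2) th) 0 (polar s (- (th / 2))) = (polar (/ q) (- (th / 2)) * RtoC (gauss (q * s)))%C.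
Proof.
  intros Hq Hs. set (z := polar (q ^ 2) th). set (om := polar 1 (- (th / 2))).
  assert (Hz : z <> 0%C) by (apply polar_neq_0, pow_lt, Hq).
  set (k := fun t => (gauss_primitive z 0 (RtoC t * om) - polar (/ q) (- (th / 2)) * RtoC (gauss (q * t)))%C).
  assert (Hk : forall t, Cderiv k t 0%C).
  { intros t. eapply Cderiv_eq.
    - apply Cderiv_minus.
      + apply (Cderiv_gauss_primitive z 0 (fun s => RtoC s * om)%C (fun _ => om) Hz).
        * intros v. eapply Cderiv_eq; [apply Cderiv_mult; [apply Cderiv_id | apply Cderiv_const]|]. cbv beta; ring.
        * intros; apply Ccont_const.
      + apply Cderiv_scal, Cderiv_RtoC. apply (is_derive_comp gauss); [apply is_derive_gauss|].
        apply @is_derive_scal, @is_derive_id.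
    - cbv beta. rewrite (polar_scal (/ q)). fold om.
      replace (gauss_exp z (RtoC t * om)) with (RtoC (exp (- (q * t) ^ 2 / 2))).
      + unfold scal, one; simpl; unfold mult; simpl. rewrite !Rmult_1_r, RtoC_mult, RtoC_inv by lra.
        field. intros K; apply RtoC_inj in K; lra.
      + unfold gauss_exp. rewrite <- Cexp_RtoC. f_equal. unfold om. rewrite <- polar_scal. unfold z. rewrite !polar_mult.
        replace (th + (- (th / 2) + - (th / 2))) with 0 by field. rewrite polar_0. apply C_eq; simpl; field. }
  assert (B := Cmean_value_const k (fun _ => 0%C) 0 0 s Hs (fun t _ => Hk t)).
  rewrite Rmult_0_l in B. specialize (B ltac:(intros; rewrite Cmod_0; lra)).
  assert (B0 := Cmod_ge_0 (k s - k 0)%C). assert (B1 : Cmod (k s - k 0)%C = 0) by lra.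
  apply Cmod_eq_0 in B1. unfold k in B1. rewrite Rmult_0_r, gauss_0, Cmult_0_l, gauss_primitive_0 in B1 by exact Hz.
  rewrite polar_scal. fold om.
  match goal with |- ?a = ?b => replace a with (a - b - (0 - polar (/ q) (- (th / 2)) * 0) + b)%C by ring end.
  rewrite B1. ring.
Qed.

(** The integral up to [w] differs from the complete moment by an exponentially small amount.  For
    [n = 0] move the endpoint from [w] to the nearby point of the ray; the recursions of
    [gauss_primitive] and [moment] agree up to boundary terms.  The power of
    [polar (/ q) (- (th / 2))] is that of [z^(-1/2)]. *)
Lemma gauss_primitive_moment n : exists K, 0 <= K /\ forall q th s w, 1 <= q -> 0 <= s <= 1 / 12 ->
  Cmod (w - polar s (- (th / 2)))%C <= s / 10 ->
  Cmod (gauss_primitive (polar (q ^ 2) th) n w - RtoC (moment n) * polar (/ q) (- (th / 2)) ^ S n)%C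
    <= K * exp (- (q ^ 2 * s ^ 2 / 4)).
Proof.
  assert (Hq : forall q, 1 <= q -> 1 <= q ^ 2 /\ 0 <= / q <= 1).
  { intros q Hq. split; [nra|]. split; [left; apply Rinv_0_lt_compat; lra|].
    rewrite <- Rinv_1. apply Rinv_le_contravar; lra. }
  assert (Hzeta : forall q th, 1 <= q -> (polar (/ q) (- (th / 2)) * polar (/ q) (- (th / 2)))%C = (/ polar (q ^ 2) th)%C).
  { intros q th H. assert (Hz : polar (q ^ 2) th <> 0%C) by (apply polar_neq_0; nra).
    rewrite <- (Cmult_1_l (/ _)%C).
    replace (RtoC 1) with (polar (/ q) (- (th / 2)) * polar (/ q) (- (th / 2)) * polar (q ^ 2) th)%C.
    - field. exact Hz.
    - rewrite !polar_mult. replace (- (th / 2) + - (th / 2) + th) with 0 by field.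
      rewrite polar_0. f_equal. field. lra. }
  assert (Hzinv : forall q th a, 1 <= q -> Cmod (a / polar (q ^ 2) th)%C <= Cmod a).
  { intros q th a H. assert (Hz : polar (q ^ 2) th <> 0%C) by (apply polar_neq_0; nra).
    unfold Cdiv. rewrite Cmod_mult, Cmod_inv by exact Hz. rewrite Cmod_polar by nra.
    destruct (Hq q H) as [Q1 _].
    assert (/ q ^ 2 <= 1) by (rewrite <- Rinv_1; apply Rinv_le_contravar; lra).
    assert (0 < / q ^ 2) by (apply Rinv_0_lt_compat; lra).
    generalize (Cmod_ge_0 a); nra. }
  induction n as [| |n [K [HK IH]]] using nat_ind_two_steps.
  - exists 3. split; [lra|]. intros q th s w H1 Hs Hw.
    destruct (Hq q H1) as [Q1 Q2].
    set (z := polar (q ^ 2) th). set (p := polar s (- (th / 2))) in *. set (ze := polar (/ q) (- (th / 2))).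
    assert (Hz : z <> 0%C) by (apply polar_neq_0; lra).
    set (e := exp (- (q ^ 2 * s ^ 2 / 4))). assert (He : 0 < e) by apply exp_pos.
    assert (A1 : Cmod (gauss_primitive z 0 w - gauss_primitive z 0 p)%C <= e).
    { set (g := fun t : R => (p + RtoC t * (w - p))%C).
      replace w with (g 1) by (unfold g; ring). replace p with (g 0) by (unfold g; ring).
      apply Rle_trans with (Cmod (w - p) * e * (1 - 0)).
      - apply (Cmean_value_const (fun t => gauss_primitive z 0 (g t)) (fun t => (w - p) * (g t ^ 0 * gauss_exp z (g t)))%C); [lra| |].
        + intros t _. apply (Cderiv_gauss_primitive z 0 g (fun _ => (w - p)%C) Hz).
          * intros v. unfold g. eapply Cderiv_eq; [apply Cderiv_plus; [apply Cderiv_const | apply Cderiv_mult; [apply Cderiv_id | apply Cderiv_const]]|].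
            cbv beta; ring.
          * intros; apply Ccont_const.
        + intros t Ht. rewrite !Cmod_mult. simpl (Cmod (g t ^ 0)%C). rewrite Cmod_1, Rmult_1_l.
          apply Rmult_le_compat_l; [apply Cmod_ge_0|].
          apply gauss_exp_near_ray; [lra | lra|]. fold p.
          replace (g t - p)%C with (RtoC t * (w - p))%C by (unfold g; ring).
          rewrite Cmod_mult, Cmod_R, Rabs_pos_eq by lra.
          generalize (Cmod_ge_0 (w - p)%C); nra.
      - assert (Cmod (w - p) <= 1) by lra. nra. }
    assert (A2 : Cmod (gauss_primitive z 0 p - RtoC (moment 0) * ze ^ 1)%C <= 2 * e).
    { unfold z, p. rewrite gauss_primitive_ray by lra. fold ze.
      replace (ze * RtoC (gauss (q * s)) - RtoC (moment 0) * ze ^ 1)%C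
        with (ze * RtoC (gauss (q * s) - sqrt (PI / 2)))%C by (rewrite RtoC_minus; simpl; ring).
      rewrite Cmod_mult, Cmod_R. unfold ze. rewrite Cmod_polar by lra.
      assert (G := gauss_limit (q * s) ltac:(nra)).
      assert (exp (- (q * s) ^ 2 / 2) <= e).
      { apply exp_le_compat. rewrite Rpow_mult_distr.
        assert (0 <= q ^ 2 * s ^ 2) by (apply Rmult_le_pos; apply pow2_ge_0). lra. }
      generalize (Rabs_pos (gauss (q * s) - sqrt (PI / 2))); nra. }
    replace (gauss_primitive z 0 w - RtoC (moment 0) * ze ^ 1)%C
      with ((gauss_primitive z 0 w - gauss_primitive z 0 p) + (gauss_primitive z 0 p - RtoC (moment 0) * ze ^ 1))%C by ring.
    eapply Rle_trans; [apply Cmod_triangle|]. lra.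
  - exists 1. split; [lra|]. intros q th s w H1 Hs Hw.
    set (z := polar (q ^ 2) th).
    assert (Hz : z <> 0%C) by (apply polar_neq_0; nra).
    replace (gauss_primitive z 1 w - RtoC (moment 1) * polar (/ q) (- (th / 2)) ^ 2)%C with (- gauss_exp z w / z)%C.
    + rewrite Rmult_1_l. eapply Rle_trans; [apply Hzinv, H1|]. rewrite Cmod_opp.
      apply gauss_exp_near_ray; [nra | lra | exact Hw].
    + simpl. rewrite Cmult_1_r, Hzeta by exact H1. fold z. field. exact Hz.
  - exists ((INR n + 1) * K + 1). assert (Hn := pos_INR n). split; [nra|].
    intros q th s w H1 Hs Hw. specialize (IH q th s w H1 Hs Hw).
    set (z := polar (q ^ 2) th) in *. set (ze := polar (/ q) (- (th / 2))) in *.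
    assert (Hz : z <> 0%C) by (apply polar_neq_0; nra).
    set (e := exp (- (q ^ 2 * s ^ 2 / 4))) in *. assert (He : 0 < e) by apply exp_pos.
    replace (gauss_primitive z (S (S n)) w - RtoC (moment (S (S n))) * ze ^ S (S (S n)))%C
      with ((RtoC (INR n + 1) * (gauss_primitive z n w - RtoC (moment n) * ze ^ S n) + - (w ^ S n * gauss_exp z w)) / z)%C.
    + eapply Rle_trans; [apply Hzinv, H1|]. eapply Rle_trans; [apply Cmod_triangle|].
      rewrite Cmod_opp, !Cmod_mult, Cmod_R, Rabs_pos_eq by lra.
      assert (G := gauss_exp_near_ray (q ^ 2) th s w ltac:(nra) ltac:(lra) Hw). fold z e in G.
      assert (Hw1 : Cmod w <= 1).
      { replace w with ((w - polar s (- (th / 2))) + polar s (- (th / 2)))%C by ring.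
        eapply Rle_trans; [apply Cmod_triangle|]. rewrite Cmod_polar by lra. lra. }
      assert (Hwn : Cmod (w ^ S n)%C <= 1).
      { rewrite Cmod_pow. rewrite <- (pow1 (S n)). apply pow_incr. split; [apply Cmod_ge_0 | exact Hw1]. }
      assert (P1 := Cmod_ge_0 (gauss_exp z w)). assert (P2 := Cmod_ge_0 (w ^ S n)%C).
      assert (P3 : Cmod (w ^ S n)%C * Cmod (gauss_exp z w) <= 1 * e) by (apply Rmult_le_compat; lra).
      assert (P4 := Rmult_le_compat_l (INR n + 1) _ _ ltac:(lra) IH). lra.
    + change (moment (S (S n))) with ((INR n + 1) * moment n). rewrite RtoC_mult.
      replace (ze ^ S (S (S n)))%C with (ze * ze * ze ^ S n)%C by (rewrite !Cpow_S; ring).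
      unfold ze at 2 3. rewrite Hzeta by exact H1. fold z.
      change (gauss_primitive z (S (S n)) w) with ((RtoC (INR n + 1) * gauss_primitive z n w - w ^ S n * gauss_exp z w) / z)%C.
      field. exact Hz.
Qed.

(** * Expansion of the integral near the saddle point *)

Lemma Cmod_sum_n_le {X : Type} (P : X -> Prop) (u : nat -> X -> C) (e : X -> R) :
  (forall n, exists K, 0 <= K /\ forall x, P x -> Cmod (u n x) <= K * e x) ->
  forall N, exists K, 0 <= K /\ forall x, P x -> Cmod (sum_n (fun n => u n x) N) <= K * e x.
Proof.
  intros H N; induction N as [|N [K [HK IH]]].
  - destruct (H 0%nat) as [K [HK H0]]. exists K; split; [exact HK|].
    intros x Hx. rewrite sum_O. now apply H0.
  - destruct (H (S N)) as [L [HL H1]]. exists (K + L). split; [lra|].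
    intros x Hx. rewrite sum_Sn. eapply Rle_trans; [apply Cmod_triangle|].
    generalize (IH x Hx) (H1 x Hx). lra.
Qed.

Lemma Csum_minus (u v : nat -> C) N :
  (sum_n u N - sum_n v N)%C = sum_n (fun n => (u n - v n)%C) N.
Proof.
  induction N as [|N IH]; [now rewrite !sum_O|].
  rewrite !sum_Sn, <- IH. unfold plus; simpl. ring.
Qed.

Lemma Csum_mult (c : C) (u : nat -> C) N : (c * sum_n u N)%C = sum_n (fun n => (c * u n)%C) N.
Proof.
  induction N as [|N IH]; [now rewrite !sum_O|].
  rewrite !sum_Sn, <- IH. unfold plus; simpl. ring.
Qed.

Lemma Cderiv_sum (f : nat -> R -> C) (d : nat -> C) N t :
  (forall n, Cderiv (f n) t (d n)) -> Cderiv (fun s => sum_n (fun n => f n s) N) t (sum_n d N).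
Proof.
  intros H; induction N as [|N IH].
  - rewrite sum_O. apply (Cderiv_ext (f O)); [intros; now rewrite sum_O | apply H].
  - rewrite sum_Sn. apply (Cderiv_ext (fun s => sum_n (fun n => f n s) N + f (S N) s)%C).
    + intros; now rewrite sum_Sn.
    + apply Cderiv_plus; [exact IH | apply H].
Qed.

(** The expansion of the integral before its normalization; [polar (/ q) (- (th / 2))] is [z^(-1/2)]
    for [z] of modulus [q^2] and argument [th]. *)
Definition truncated_expansion (N : nat) (q th : R) : C :=
  sum_n (fun n => RtoC (taylor (lagrange_power n) n) * (RtoC (moment n) * polar (/ q) (- (th / 2)) ^ S n))%C N.

Lemma atan_bound x : - 2 <= atan x <= 2.
Proof. generalize (atan_bound x) PI_4. lra. Qed.

(** The scaling [v = q s] extracts the power of [q]; the factor [1 / (1 + v^2)] that is left has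
    the elementary primitive [atan]. *)
Lemma gaussian_weight_bound N : exists K, 0 <= K /\ forall q s, 0 < q -> 0 <= s ->
  (q ^ 2 * s ^ (N + 3) + s ^ (N + 1)) * exp (- (q ^ 2 * s ^ 2 / 4))
    <= K * (/ q) ^ (N + 1) * / (1 + (q * s) ^ 2).
Proof.
  destruct (poly_exp_decay (1 / 4) (N + 1) ltac:(lra)) as [K1 [HK1 H1]].
  destruct (poly_exp_decay (1 / 4) (N + 3) ltac:(lra)) as [K2 [HK2 H2]].
  destruct (poly_exp_decay (1 / 4) (N + 5) ltac:(lra)) as [K3 [HK3 H3]].
  exists (K1 + 2 * K2 + K3). split; [lra|]. intros q s Hq Hs.
  set (v := q * s). assert (Hv : 0 <= v) by (unfold v; nra).
  specialize (H1 v Hv). specialize (H2 v Hv). specialize (H3 v Hv).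
  replace (1 / 4 * v ^ 2) with (q ^ 2 * s ^ 2 / 4) in * by (unfold v; rewrite Rpow_mult_distr; field).
  set (e := exp (- (q ^ 2 * s ^ 2 / 4))) in *.
  apply (Rmult_le_reg_r (1 + v ^ 2)); [nra|].
  rewrite (Rmult_assoc _ (/ _)), Rinv_l, Rmult_1_r by nra.
  assert (Hqp : 0 < q ^ (N + 1)) by (apply pow_lt, Hq).
  apply (Rmult_le_reg_r (q ^ (N + 1))); [exact Hqp|].
  rewrite (Rmult_assoc _ ((/ q) ^ (N + 1))), <- Rpow_mult_distr, Rinv_l, pow1, Rmult_1_r by lra.
  replace ((q ^ 2 * s ^ (N + 3) + s ^ (N + 1)) * e * (1 + v ^ 2) * q ^ (N + 1))
    with (v ^ (N + 1) * e + 2 * (v ^ (N + 3) * e) + v ^ (N + 5) * e); [lra|].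
  unfold v. rewrite !Rpow_mult_distr.
  replace (N + 3)%nat with ((N + 1) + 2)%nat by lia. replace (N + 5)%nat with ((N + 1) + 4)%nat by lia.
  rewrite !pow_add. ring.
Qed.

(** Up to the point of parameter [rho] on the ray, compare the primitive of [e^(-z g)] with the
    combination of Gaussian primitives evaluated at [W].  The derivatives differ by
    [e^(-z g) - e^(-z W^2 / 2)] plus [e^(-z W^2 / 2) (1 - W' * sum_n b_n W^n)], both controlled by
    [polynomial_uniformizer]. *)
Lemma local_expansion N : exists rho K, 0 < rho <= 1 / 12 /\ 0 <= K /\ forall q th, 1 <= q ->
  Cmod (radial_primitive (phase_exp (polar (q ^ 2) th)) (polar rho (- (th / 2))) - truncated_expansion N q th)%C
    <= K * (/ q) ^ (N + 2).
Proof.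
  destruct (polynomial_uniformizer N) as [l [K [HK HU]]].
  set (b := fun n => RtoC (taylor (lagrange_power n) n)).
  (* This size keeps the polynomial [W] within [|w| / 10] of [w]. *)
  set (rho := Rmin (1 / 12) (/ (10 * (K + 1)))).
  assert (Hr0 : 0 < rho) by (apply Rmin_glb_lt; [lra | apply Rinv_0_lt_compat; lra]).
  assert (Hr1 : rho <= 1 / 12) by apply Rmin_l.
  assert (Hr2 : rho * (10 * (K + 1)) <= 1).
  { apply Rle_trans with (/ (10 * (K + 1)) * (10 * (K + 1))); [|right; field; lra].
    apply Rmult_le_compat_r; [lra | apply Rmin_r]. }
  assert (Hnear : forall th s, 0 <= s <= rho ->
    Cmod (evalC l (polar s (- (th / 2))) - polar s (- (th / 2)))%C <= s / 10).
  { intros th s Hs. destruct (HU (polar s (- (th / 2)))) as [_ [_ H3]]; [rewrite Cmod_polar; lra|].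
    eapply Rle_trans; [exact H3|]. rewrite Cmod_polar by lra.
    assert (s * (10 * (K + 1)) <= 1) by nra. simpl. nra. }
  destruct (gaussian_weight_bound N) as [KW [HKW HW]].
  destruct (Cmod_sum_n_le
     (fun x : R * R * C => 1 <= fst (fst x) /\ Cmod (snd x - polar rho (- (snd (fst x) / 2)))%C <= rho / 10)
     (fun n x => b n * (gauss_primitive (polar (fst (fst x) ^ 2) (snd (fst x))) n (snd x)
          - RtoC (moment n) * polar (/ fst (fst x)) (- (snd (fst x) / 2)) ^ S n))%C
     (fun x => exp (- (fst (fst x) ^ 2 * rho ^ 2 / 4)))) with (N := N) as [KM [HKM HM]].
  { intros n. destruct (gauss_primitive_moment n) as [L [HL H]].
    exists (Cmod (b n) * L). split; [generalize (Cmod_ge_0 (b n)); nra|].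
    intros [[q th] w] [H1 H2]; simpl in H1, H2 |- *. rewrite Cmod_mult, Rmult_assoc.
    apply Rmult_le_compat_l; [apply Cmod_ge_0|]. apply H; [exact H1 | lra | exact H2]. }
  destruct (poly_exp_decay (rho ^ 2 / 4) (N + 2) ltac:(nra)) as [KE [HKE HE]].
  exists rho, (4 * (K * KW) + KM * KE). split; [lra|]. split; [nra|].
  intros q th Hq.
  set (z := polar (q ^ 2) th). set (om := polar 1 (- (th / 2))).
  assert (Hz : z <> RtoC 0) by (apply polar_neq_0; nra).
  assert (Hzm : Cmod z = q ^ 2) by (apply Cmod_polar; nra).
  assert (Hom : Cmod om = 1) by (apply Cmod_polar; lra).
  assert (Hray : forall s, Cderiv (fun s => (RtoC s * om)%C) s om).
  { intros s. eapply Cderiv_eq; [apply Cderiv_mult; [apply Cderiv_id | apply Cderiv_const]|]. cbv beta; ring. }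
  assert (Hrayc : forall s, Ccont (fun s => (RtoC s * om)%C) s) by (intros; eapply Cderiv_cont, Hray).
  set (W := fun s : R => evalC l (RtoC s * om)%C).
  set (W' := fun s : R => (om * evalC (pderiv l) (RtoC s * om))%C).
  assert (HW1 : forall s, Cderiv W s (W' s)) by (intros s; apply Cderiv_evalC, Hray).
  assert (HW2 : forall s, Ccont W' s) by (intros s; apply Ccont_mult; [apply Ccont_const | apply Ccont_evalC, Hrayc]).
  (* The two primitives along the ray; [D'] is the difference of the integrands. *)
  set (D := fun s : R => (radial_primitive (phase_exp z) (RtoC s * om)
    - sum_n (fun n => b n * gauss_primitive z n (W s)) N)%C).
  set (D' := fun s : R => (om * phase_exp z (RtoC s * om)
    - sum_n (fun n => b n * (W' s * (W s ^ n * gauss_exp z (W s)))) N)%C).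
  assert (HD : forall s, Cderiv D s (D' s)).
  { intros s. apply Cderiv_minus.
    - apply (Cderiv_radial_primitive _ _ (fun s => RtoC s * om)%C (fun _ => om) (entire_phase_exp z) Hray).
      intros; apply Ccont_const.
    - apply (Cderiv_sum (fun n s => b n * gauss_primitive z n (W s))%C). intros n. apply Cderiv_scal.
      now apply (Cderiv_gauss_primitive z n W W'). }
  assert (HDb : forall s, 0 <= s <= rho -> Cmod (D' s) <= K * KW * (/ q) ^ (N + 1) * / (1 + (q * s) ^ 2)).
  { intros s Hs. set (p := (RtoC s * om)%C).
    assert (Hp : p = polar s (- (th / 2))) by (unfold p, om; now rewrite <- polar_scal).
    assert (Hpm : Cmod p = s) by (rewrite Hp; apply Cmod_polar; lra).
    destruct (HU p) as [U1 [U2 _]]; [rewrite Hpm; lra|]. rewrite Hpm in U1, U2.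
    set (e := exp (- (q ^ 2 * s ^ 2 / 4))).
    assert (Eq : D' s = (om * ((phase_exp z p - gauss_exp z (evalC l p))
        + gauss_exp z (evalC l p) * (1 - evalC (pderiv l) p * sum_n (fun n => b n * evalC l p ^ n) N)))%C).
    { unfold D'. fold p.
      replace (sum_n (fun n => b n * (W' s * (W s ^ n * gauss_exp z (W s)))) N)%C
        with (W' s * gauss_exp z (W s) * sum_n (fun n => b n * evalC l p ^ n) N)%C.
      - unfold W, W'. fold p. ring.
      - rewrite Csum_mult. apply sum_n_ext. intros n. unfold W at 2. fold p. unfold W. fold p.
        change ((W' s * gauss_exp z (evalC l p) * (b n * evalC l p ^ n))%C = (b n * (W' s * (evalC l p ^ n * gauss_exp z (evalC l p))))%C). ring. }
    assert (G1 : Cmod (gauss_exp z (evalC l p)) <= e).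
    { apply gauss_exp_near_ray; [nra | lra|]. rewrite Hp. now apply Hnear. }
    assert (G2 : Cmod (phase_exp z p - gauss_exp z (evalC l p)) <= q ^ 2 * (K * s ^ (N + 3)) * e).
    { assert (R1 : Re (- (z * phase p))%C <= - (q ^ 2 * s ^ 2 / 4)).
      { assert (X := phase_exp_ray (q ^ 2) th s). fold z in X. rewrite <- Hp in X. unfold phase_exp in X.
        rewrite Cmod_Cexp in X. apply exp_inv in X. rewrite X.
        generalize (ray_height_quadratic th s ltac:(lra)). nra. }
      assert (R2 : Re (- (z * (evalC l p * evalC l p) / 2))%C <= - (q ^ 2 * s ^ 2 / 4)).
      { unfold gauss_exp in G1. rewrite Cmod_Cexp in G1. unfold e in G1.
        apply Rnot_lt_le. intros X. apply exp_increasing in X. lra. }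
      unfold phase_exp, gauss_exp. eapply Rle_trans; [apply (Cexp_diff_le _ _ _ R1 R2)|]. fold e.
      apply Rmult_le_compat_r; [left; apply exp_pos|].
      replace (- (z * phase p) - - (z * (evalC l p * evalC l p) / 2))%C
        with (- (z * (phase p - evalC l p ^ 2 / 2)))%C by (simpl; unfold Cdiv; ring).
      rewrite Cmod_opp, Cmod_mult, Hzm. apply Rmult_le_compat_l; [nra | exact U1]. }
    rewrite Eq, Cmod_mult, Hom, Rmult_1_l.
    eapply Rle_trans; [apply Cmod_triangle|]. rewrite Cmod_mult.
    assert (G3 : Cmod (gauss_exp z (evalC l p)) * Cmod (1 - evalC (pderiv l) p * sum_n (fun n => b n * evalC l p ^ n) N)%C
       <= e * (K * s ^ (N + 1))) by (apply Rmult_le_compat; auto using Cmod_ge_0).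
    specialize (HW q s ltac:(lra) ltac:(lra)). fold e in HW.
    apply (Rmult_le_compat_l K _ _ HK) in HW. lra. }
  assert (HDm : Cmod (D rho - D 0)%C <= 4 * (K * KW) * (/ q) ^ (N + 2)).
  { set (m := fun s => K * KW * (/ q) ^ (N + 2) * atan (q * s)).
    assert (Hqi : 0 < / q) by (apply Rinv_0_lt_compat; lra).
    apply Rle_trans with (m rho - m 0).
    - apply (Cmean_value D D' m (fun s => K * KW * (/ q) ^ (N + 1) * / (1 + (q * s) ^ 2))); [lra | auto | | exact HDb].
      intros s _. unfold m. eapply is_derive_eq.
      + apply @is_derive_scal. apply (is_derive_comp atan (fun s => q * s)); [apply is_derive_atan|].
        apply @is_derive_scal, @is_derive_id.
      + unfold scal, one; simpl; unfold mult, Rsqr; simpl.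
        replace (N + 2)%nat with (S (N + 1)) by lia. simpl. field. split; nra.
    - unfold m. assert (A1 := atan_bound (q * rho)). assert (A2 := atan_bound (q * 0)).
      assert (0 <= K * KW * (/ q) ^ (N + 2)) by (apply Rmult_le_pos; [nra | apply pow_le; lra]). nra. }
  assert (Hp0 : evalC l (RtoC 0 * om)%C = RtoC 0).
  { rewrite Cmult_0_l. destruct (HU (RtoC 0)) as [_ [_ H3]]; [rewrite Cmod_0; lra|].
    rewrite Cmod_0 in H3. assert (E0 : Cmod (evalC l (RtoC 0) - RtoC 0)%C = 0).
    { generalize (Cmod_ge_0 (evalC l (RtoC 0) - RtoC 0)%C). simpl in H3. lra. }
    apply Cmod_eq_0 in E0. replace (evalC l (RtoC 0)) with (evalC l (RtoC 0) - RtoC 0)%C by ring. exact E0. }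
  assert (HD0 : D 0 = RtoC 0).
  { unfold D, W. rewrite Hp0, Cmult_0_l, radial_primitive_0.
    rewrite (sum_n_ext _ (fun _ => RtoC 0)).
    - replace (sum_n (fun _ => RtoC 0) N) with (RtoC 0); [ring|].
      clear. induction N as [|N IH]; [now rewrite sum_O | rewrite sum_Sn, <- IH; unfold plus; simpl; ring].
    - intros n. rewrite gauss_primitive_0 by exact Hz. apply Cmult_0_r. }
  assert (Hend : Cmod (sum_n (fun n => b n * gauss_primitive z n (W rho)) N - truncated_expansion N q th)%C <= KM * KE * (/ q) ^ (N + 2)).
  { unfold truncated_expansion. rewrite Csum_minus.
    rewrite (sum_n_ext _ (fun n => b n * (gauss_primitive z n (W rho) - RtoC (moment n) * polar (/ q) (- (th / 2)) ^ S n))%C).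
    2:{ intros n. unfold b. unfold Cminus.
        change ((RtoC (taylor (lagrange_power n) n) * gauss_primitive z n (W rho)
            + - (RtoC (taylor (lagrange_power n) n) * (RtoC (moment n) * polar (/ q) (- (th / 2)) ^ S n)))%C
          = (RtoC (taylor (lagrange_power n) n) * (gauss_primitive z n (W rho) + - (RtoC (moment n) * polar (/ q) (- (th / 2)) ^ S n)))%C). ring. }
    eapply Rle_trans; [apply (HM (q, th, W rho))|]; simpl fst; simpl snd.
    - split; [exact Hq|]. unfold W, om. rewrite <- polar_scal. apply Hnear; lra.
    - rewrite Rmult_assoc. apply Rmult_le_compat_l; [exact HKM|].
      apply (Rmult_le_reg_r (q ^ (N + 2))); [apply pow_lt; lra|].
      replace (KE * (/ q) ^ (N + 2) * q ^ (N + 2)) with KE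
        by (rewrite Rmult_assoc, <- Rpow_mult_distr, Rinv_l, pow1 by lra; ring).
      specialize (HE q ltac:(lra)). rewrite Rmult_comm.
      replace (q ^ 2 * rho ^ 2 / 4) with (rho ^ 2 / 4 * q ^ 2) by field. exact HE. }
  rewrite polar_scal. fold om z.
  replace (radial_primitive (phase_exp z) (RtoC rho * om) - truncated_expansion N q th)%C
    with ((D rho - D 0) + (sum_n (fun n => b n * gauss_primitive z n (W rho)) N - truncated_expansion N q th))%C
    by (rewrite HD0; unfold D; ring).
  eapply Rle_trans; [apply Cmod_triangle|]. lra.
Qed.

(** * The tail of the path of integration *)

Definition Clim (h : R -> C) (G : C) : Prop :=
  forall eps, 0 < eps -> exists X, forall x, X < x -> Cmod (h x - G)%C < eps.

Lemma Clim_scal c h G : Clim h G -> Clim (fun x => (c * h x)%C) (c * G)%C.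
Proof.
  intros H eps He. assert (Hc := Cmod_ge_0 c).
  destruct (H (eps / (Cmod c + 1))) as [X HX]; [apply Rdiv_lt_0_compat; lra|].
  exists X. intros x Hx. replace (c * h x - c * G)%C with (c * (h x - G))%C by ring.
  rewrite Cmod_mult. specialize (HX x Hx).
  apply Rle_lt_trans with (Cmod c * (eps / (Cmod c + 1))); [apply Rmult_le_compat_l; lra|].
  apply (Rmult_lt_reg_r (Cmod c + 1)); [lra|].
  replace (Cmod c * (eps / (Cmod c + 1)) * (Cmod c + 1)) with (Cmod c * eps) by (field; lra). nra.
Qed.

Lemma Clim_filterlim h G : Clim h G ->
  filterlim h (Rbar_locally p_infty) (locally (T := C_R_NormedModule) G).
Proof.
  intros H. apply filterlim_locally. intros eps.
  destruct (H eps (cond_pos eps)) as [X HX]. exists X. intros x Hx. specialize (HX x Hx).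
  split; (eapply Rle_lt_trans; [|exact HX]).
  - apply (re_le_Cmod (h x - G)%C).
  - apply (Rle_trans _ _ _ (Rmax_r _ _) (Rmax_Cmod (h x - G)%C)).
Qed.

Lemma Cmod_le_sum (c : C) : Cmod c <= Rabs (Re c) + Rabs (Im c).
Proof.
  replace c with (RtoC (Re c) + Ci * RtoC (Im c))%C at 1 by (apply C_eq; destruct c; simpl; ring).
  eapply Rle_trans; [apply Cmod_triangle|]. rewrite Cmod_mult, !Cmod_R.
  replace (Cmod Ci) with 1; [lra|]. unfold Cmod, Ci; simpl. rewrite <- sqrt_1 at 1. f_equal; ring.
Qed.

(** The Cauchy criterion, with [M e^(-x)] as the majorant of the remaining arc length. *)
Lemma Clim_of_exp_bound (g g' : R -> C) M x0 : 0 <= M ->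
  (forall x, Cderiv g x (g' x)) -> (forall x, x0 <= x -> Cmod (g' x) <= M * exp (- x)) ->
  exists G, Clim g G /\ Cmod (G - g x0)%C <= M * exp (- x0).
Proof.
  intros HM Hg Hb.
  assert (Hcau : forall x y, x0 <= x <= y -> Cmod (g y - g x)%C <= M * exp (- x)).
  { intros x y Hxy. apply Rle_trans with (- M * exp (- y) - - M * exp (- x)).
    - apply (Cmean_value g g' (fun t => - M * exp (- t)) (fun t => M * exp (- t))); [lra | auto | |].
      + intros t _. auto_derive; [exact I | ring].
      + intros t Ht. apply Hb; lra.
    - generalize (exp_pos (- y)); nra. }
  assert (Hsmall : forall eps, 0 < eps -> exists X, x0 <= X /\ M * exp (- X) < eps).
  { intros eps He. exists (Rmax x0 (Rmax 1 (M / eps))).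
    (* [e^X > X] makes [M e^(-X)] smaller than [eps]. *)
    set (X := Rmax x0 (Rmax 1 (M / eps))).
    assert (x0 <= X) by apply Rmax_l.
    assert (H1 : Rmax 1 (M / eps) <= X) by apply Rmax_r.
    assert (1 <= X) by (eapply Rle_trans; [apply Rmax_l | exact H1]).
    assert (M / eps <= X) by (eapply Rle_trans; [apply Rmax_r | exact H1]).
    split; [assumption|]. rewrite exp_Ropp.
    assert (HX := exp_ineq1_le X).
    apply (Rmult_lt_reg_r (exp X)); [apply exp_pos|].
    rewrite Rmult_assoc, Rinv_l, Rmult_1_r by (generalize (exp_pos X); lra).
    assert (M <= X * eps).
    { apply (Rmult_le_compat_r eps) in H2; [|lra]. replace (M / eps * eps) with M in H2 by (field; lra). exact H2. }
    nra. }
  destruct (proj1 (filterlim_locally_cauchy (U := C_R_CompleteNormedModule) (F := Rbar_locally p_infty) g)) as [G HG].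
  { intros eps. destruct (Hsmall (eps / 2)) as [X [HX1 HX2]]; [generalize (cond_pos eps); lra|].
    exists (fun x => X < x). split; [exists X; auto|].
    assert (K : forall u v, X < u -> X < v -> Cmod (g v - g u)%C < eps).
    { intros u v Hu Hv.
      replace (g v - g u)%C with ((g v - g X) + - (g u - g X))%C by ring.
      eapply Rle_lt_trans; [apply Cmod_triangle|]. rewrite Cmod_opp.
      generalize (Hcau X u ltac:(lra)) (Hcau X v ltac:(lra)). lra. }
    intros u v Hu Hv. specialize (K u v Hu Hv).
    split; (eapply Rle_lt_trans; [|exact K]).
    - apply (re_le_Cmod (g v - g u)%C).
    - apply (Rle_trans _ _ _ (Rmax_r _ _) (Rmax_Cmod (g v - g u)%C)). }
  assert (HC : Clim g G).
  { intros eps He.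
    assert (He2 : 0 < eps / 2) by lra.
    destruct (proj1 (filterlim_locally g G) HG (mkposreal _ He2)) as [X HX].
    exists X. intros x Hx. destruct (HX x Hx) as [B1 B2].
    eapply Rle_lt_trans; [apply Cmod_le_sum|].
    assert (B1' : Rabs (Re (g x - G)%C) < eps / 2) by exact B1.
    assert (B2' : Rabs (Im (g x - G)%C) < eps / 2) by exact B2. lra. }
  exists G. split; [exact HC|].
  apply le_epsilon. intros eps He. destruct (HC eps He) as [X HX].
  set (x := Rmax X x0 + 1). assert (X < x) by (unfold x; generalize (Rmax_l X x0); lra).
  assert (x0 <= x) by (unfold x; generalize (Rmax_r X x0); lra).
  replace (G - g x0)%C with ((g x - g x0) + - (g x - G))%C by ring.
  eapply Rle_trans; [apply Cmod_triangle|]. rewrite Cmod_opp.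
  generalize (HX x ltac:(assumption)) (Hcau x0 x ltac:(lra)). lra.
Qed.

Lemma Cderiv_horizontal z y x : Cderiv (fun s => radial_primitive (phase_exp z) (s, y)) x (phase_exp z (x, y)).
Proof.
  assert (E : forall s : R, (s, y) = (RtoC s + Ci * RtoC y)%C) by (intros; apply C_eq; simpl; ring).
  apply (Cderiv_ext (fun s => radial_primitive (phase_exp z) (RtoC s + Ci * RtoC y)%C)); [intros; now rewrite E|].
  rewrite E. eapply Cderiv_eq.
  - apply (Cderiv_radial_primitive _ _ (fun s => RtoC s + Ci * RtoC y)%C (fun _ => RtoC 1) (entire_phase_exp z)).
    + intros t. eapply Cderiv_eq; [apply Cderiv_plus; [apply Cderiv_id | apply Cderiv_const]|]. cbv beta; ring.
    + intros; apply Ccont_const.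
  - cbv beta; ring.
Qed.

Lemma Cderiv_vertical z th x :
  Cderiv (fun s => radial_primitive (phase_exp z) (0, s - th)) x
    (Ci * phase_exp z (0%R, (x - th)%R))%C.
Proof.
  assert (E : forall s : R, (0, s - th) = (Ci * (RtoC s - RtoC th))%C) by (intros; apply C_eq; simpl; ring).
  apply (Cderiv_ext (fun s => radial_primitive (phase_exp z) (Ci * (RtoC s - RtoC th))%C)); [intros; now rewrite E|].
  rewrite E.
  apply (Cderiv_radial_primitive _ _ (fun s => Ci * (RtoC s - RtoC th))%C (fun _ => Ci) (entire_phase_exp z)).
  - intros t. eapply Cderiv_eq; [apply Cderiv_scal, Cderiv_minus; [apply Cderiv_id | apply Cderiv_const]|]. cbv beta; ring.
  - intros; apply Ccont_const.
Qed.

Lemma Cderiv_ray z a x :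
  Cderiv (fun s => radial_primitive (phase_exp z) (polar s a)) x (polar 1 a * phase_exp z (polar x a))%C.
Proof.
  apply (Cderiv_ext (fun s => radial_primitive (phase_exp z) (RtoC s * polar 1 a)%C)); [intros; now rewrite (polar_scal s)|].
  rewrite (polar_scal x).
  apply (Cderiv_radial_primitive _ _ (fun s => RtoC s * polar 1 a)%C (fun _ => polar 1 a) (entire_phase_exp z)).
  - intros t. eapply Cderiv_eq; [apply Cderiv_mult; [apply Cderiv_id | apply Cderiv_const]|]. cbv beta; ring.
  - intros; apply Ccont_const.
Qed.

(** From the point of parameter [rho] on, the height of the phase is at least [c]: first along the
    ray up to the corner, then along the horizontal line. *)
Lemma tail_bound delta rho : 0 < delta -> 0 < rho <= 1 / 12 ->
  exists K c, 0 <= K /\ 0 < c /\ forall q th, 1 <= q -> Rabs th <= 2 * PI - delta ->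
  exists G, Clim (fun x => radial_primitive (phase_exp (polar (q ^ 2) th)) (x, - th)) G /\
    Cmod (G - radial_primitive (phase_exp (polar (q ^ 2) th)) (polar rho (- (th / 2))))%C <= K * exp (- (c * q ^ 2)).
Proof.
  intros Hd Hrho.
  destruct (corner_exists delta Hd) as [T HT].
  destruct (line_height_lower_bound delta Hd) as [c1 [Hc1 HH]].
  set (c := Rmin (rho ^ 2 / 4) c1).
  assert (Hc : 0 < c) by (apply Rmin_glb_lt; [simpl; nra | exact Hc1]).
  assert (Hca : c <= rho ^ 2 / 4) by apply Rmin_l. assert (Hcb : c <= c1) by apply Rmin_r.
  exists (Rabs T + exp (c + 2 * PI + 2 + Rabs T)), c.
  assert (HT0 := Rabs_pos T).
  split; [generalize (exp_pos (c + 2 * PI + 2 + Rabs T)); lra|]. split; [exact Hc|].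
  intros q th Hq Hth. set (z := polar (q ^ 2) th). set (b := th / 2).
  assert (Hb : Rabs b <= PI - delta / 2).
  { unfold b, Rdiv. rewrite Rabs_mult, (Rabs_pos_eq (/ 2)) by lra. lra. }
  destruct (HT b Hb) as [S [HS1 HS2]]. assert (HS3 := Rle_abs T).
  assert (Hq2 : 1 <= q ^ 2) by nra.
  assert (Hray : forall s, rho <= s <= S -> rho ^ 2 / 4 <= ray_height b s).
  { intros s Hs. apply Rle_trans with (ray_height b rho); [apply ray_height_quadratic; lra|].
    assert (Hinc : 0 <= b -> ray_height b rho <= ray_height b s).
    { intros Hb0. rewrite Rabs_pos_eq in Hb by exact Hb0. apply ray_height_increasing; try lra.
      assert (0 <= sin b) by (apply sin_ge_0; lra). nra. }
    assert (Hdec : b <= 0 -> ray_height (- b) rho <= ray_height (- b) s).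
    { intros Hb0. rewrite Rabs_left1 in Hb by exact Hb0. apply ray_height_increasing; try lra.
      rewrite sin_neg. assert (0 <= sin (- b)) by (apply sin_ge_0; lra). rewrite sin_neg in *. nra. }
    rewrite !ray_height_opp in Hdec. destruct (Rle_lt_dec 0 b); [auto | apply Hdec; lra]. }
  set (x0 := S * cos b).
  assert (Hhor : forall x, x0 <= x -> c <= line_height th x).
  { intros x Hx. destruct (HH th S x Hth ltac:(lra) Hx) as [K|K]; [|lra].
    eapply Rle_trans; [|exact K]. rewrite <- (ray_height_corner S th) by exact HS2. fold b.
    generalize (Hray S ltac:(lra)). lra. }
  set (M := exp (c + 2 * PI + 2) * exp (- (c * q ^ 2))).
  assert (HM : 0 <= M) by (apply Rlt_le, Rmult_lt_0_compat; apply exp_pos).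
  destruct (Clim_of_exp_bound (fun x => radial_primitive (phase_exp z) (x, - th)) (fun x => phase_exp z (x, - th)) M x0 HM) as [G [HG1 HG2]].
  { intros x; apply Cderiv_horizontal. }
  { intros x Hx. unfold z. rewrite phase_exp_line. unfold M. rewrite <- !exp_plus. apply exp_le_compat.
    assert (G1 := Hhor x Hx). assert (G2 := line_height_growth th x ltac:(lra)).
    (* one copy of the exponent gives integrability, the other ones the decay in q *)
    assert ((q ^ 2 - 1) * c <= (q ^ 2 - 1) * line_height th x) by (apply Rmult_le_compat_l; lra). lra. }
  exists G. split; [exact HG1|].
  set (P := radial_primitive (phase_exp z)) in *. set (e := exp (- (c * q ^ 2))) in *.
  assert (He : 0 < e) by apply exp_pos.
  assert (A1 : Cmod (P (x0, (- th)%R) - P (polar rho (- b)))%C <= Rabs T * e).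
  { unfold x0, b. rewrite <- corner_point by exact HS2. fold b.
    apply Rle_trans with (e * (S - rho)).
    - apply (Cmean_value_const (fun s => P (polar s (- b))) (fun s => polar 1 (- b) * phase_exp z (polar s (- b)))%C); [lra| |].
      + intros; apply Cderiv_ray.
      + intros s Hs. rewrite Cmod_mult, Cmod_polar, Rmult_1_l by lra. unfold z, b. rewrite phase_exp_ray.
        fold b. apply exp_le_compat. generalize (Hray s Hs). nra.
    - nra. }
  assert (A2 : M * exp (- x0) <= exp (c + 2 * PI + 2 + Rabs T) * e).
  { unfold M. fold e. rewrite (exp_plus _ (Rabs T)).
    assert (exp (- x0) <= exp (Rabs T)).
    { apply exp_le_compat. unfold x0. generalize (COS_bound b). nra. }
    generalize (exp_pos (c + 2 * PI + 2)). intros Hp.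
    replace (exp (c + 2 * PI + 2) * exp (Rabs T) * e) with (exp (c + 2 * PI + 2) * e * exp (Rabs T)) by ring.
    apply Rmult_le_compat_l; [nra | assumption]. }
  replace (G - P (polar rho (- b)))%C with ((G - P (x0, (- th)%R)) + (P (x0, (- th)%R) - P (polar rho (- b))))%C by ring.
  eapply Rle_trans; [apply Cmod_triangle|]. lra.
Qed.

(** * The incomplete gamma function *)

Lemma proj_Cexp z : proj z = Cexp (surf_log z).
Proof.
  unfold proj, surf_log. rewrite Cexp_polar, exp_ln by apply modulus_gt0. reflexivity.
Qed.

(** The substitution [u = s + w] in the integrand [e^(a u - e^u)] of the incomplete gamma function, at
    [a = e^s]. *)
Lemma phase_exp_shift (s u : C) :
  (Cexp (Cexp s * s) * Cexp (- Cexp s) * phase_exp (Cexp s) (u - s))%C = (Cexp (Cexp s * u) * Cexp (- Cexp u))%C.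
Proof.
  unfold phase_exp, phase. rewrite <- !Cexp_plus. f_equal.
  replace (Cexp (u - s)) with (Cexp u * / Cexp s)%C by (rewrite <- Cexp_opp, <- Cexp_plus; f_equal; ring).
  field. apply Cexp_neq_0.
Qed.

(** Both pieces of the defining path have the same primitive in the logarithmic variable: the arc
    contributes its increment from [0] to [- i th], the half-line its increment from [- i th] to
    infinity, and the intermediate values cancel. *)
Lemma upper_gamma_limit z G :
  Clim (fun x => radial_primitive (phase_exp (proj z)) (x, - argument z)) G ->
  upper_gamma (proj z) z = (surf_pow z (proj z) * Cexp (- proj z) * G)%C.
Proof.
  intros HG. set (L := ln (modulus z)). set (th := argument z) in *.
  assert (Hs : surf_log z = (L, th)) by reflexivity.
  assert (Hr := modulus_gt0 z).
  set (a := proj z) in *. set (P := radial_primitive (phase_exp a)) in *.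
  set (c := (surf_pow z a * Cexp (- a))%C).
  assert (Ha : a = Cexp (L, th)) by (unfold a; rewrite proj_Cexp; reflexivity).
  assert (Hc : forall u, (c * phase_exp a (u - (L, th)))%C = (Cexp (a * u) * Cexp (- Cexp u))%C).
  { intros u. unfold c, surf_pow. rewrite Hs, Ha. apply phase_exp_shift. }
  unfold upper_gamma. fold th.
  rewrite (is_RInt_unique (V := C_R_CompleteNormedModule) _ th 0 (c * P (0%R, (- th)%R))%C).
  - rewrite (is_RInt_gen_unique (V := C_R_CompleteNormedModule) _ (minus (c * G)%C (c * P (0%R, (- th)%R))%C : C_R_NormedModule)).
    + unfold minus, plus, opp; simpl. ring.
    + apply (is_RInt_gen_antiderivative (V := C_R_NormedModule) (fun t => c * P ((ln t - L)%R, (- th)%R))%C).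
      * exists (fun x => x = modulus z) (fun x => 0 < x); [reflexivity | exists 0; auto|].
        intros x y -> Hy. simpl.
        assert (Hpos : forall t, Rmin (modulus z) y <= t -> 0 < t).
        { intros t Ht. generalize (Rmin_glb_lt _ _ _ Hr Hy). lra. }
        apply (is_RInt_Cderiv (fun t => c * P ((ln t - L)%R, (- th)%R))%C).
        -- intros t [Ht _]. apply Hpos in Ht. eapply Cderiv_eq.
           ++ apply Cderiv_scal.
              apply (Cderiv_comp (fun x => P (x, - th)) (fun t => ln t - L)).
              ** apply Cderiv_horizontal.
              ** apply (is_derive_minus ln (fun _ => L)); [apply is_derive_ln, Ht | apply @is_derive_const].
           ++ replace ((ln t - L)%R, (- th)%R) with (RtoC (ln t) - (L, th))%C by (apply C_eq; simpl; ring).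
              transitivity (RtoC (/ t) * (c * phase_exp a (RtoC (ln t) - (L, th))))%C.
              { unfold minus, plus, opp, zero; simpl. rewrite Ropp_0, Rplus_0_r. ring. }
              rewrite Hc.
              replace ((a - 1) * RtoC (ln t))%C with (a * RtoC (ln t) + - RtoC (ln t))%C by ring.
              rewrite Cexp_plus, (Cexp_opp (RtoC (ln t))), !Cexp_RtoC, exp_ln by exact Ht.
              rewrite RtoC_inv by lra. ring.
        -- intros t [Ht _]. apply Hpos in Ht.
           assert (Hln : Ccont (fun t => RtoC (ln t)) t).
           { apply Ccont_RtoC, @ex_derive_continuous. eexists; apply is_derive_ln, Ht. }
           apply Ccont_mult; apply Ccont_Cexp.
           ++ apply Ccont_mult; [apply Ccont_const | exact Hln].
           ++ apply Ccont_opp, Ccont_RtoC, continuous_id.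
      * intros Q HQ. unfold filtermap, at_point.
        replace (ln (modulus z) - L) with 0 by (unfold L; ring). now apply locally_singleton.
      * apply Clim_filterlim. apply (Clim_scal c) in HG. intros eps He. destruct (HG eps He) as [X HX].
        (* The variable [x] of the limit is [ln t - L]. *)
        exists (exp (X + L)). intros t Ht. apply HX.
        assert (X + L < ln t); [|lra].
        rewrite <- (ln_exp (X + L)). apply ln_increasing; [apply exp_pos | exact Ht].
  - replace (c * P (0%R, (- th)%R))%C with (c * P (0%R, (0 - th)%R) - c * P (0%R, (th - th)%R))%C.
    2:{ replace (th - th) with 0 by ring. replace (0 - th) with (- th) by ring.
        unfold P at 2. change (0, 0) with (RtoC 0). rewrite radial_primitive_0. ring. }
    apply (is_RInt_Cderiv (fun phi => c * P (0%R, (phi - th)%R))%C).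
    + intros phi _. eapply Cderiv_eq.
      * apply Cderiv_scal, Cderiv_vertical.
      * replace (0%R, (phi - th)%R) with ((L, phi) - (L, th))%C by (apply C_eq; simpl; ring).
        transitivity (Ci * (c * phase_exp a ((L, phi) - (L, th))))%C; [ring|]. rewrite Hc.
        unfold gamma_integrand, surf_pow. simpl.
        rewrite proj_Cexp. change (surf_log (with_argument z phi)) with (L, phi).
        replace ((a - 1) * (L, phi))%C with (a * (L, phi) + - (L, phi))%C by ring.
        rewrite Cexp_plus, (Cexp_opp (L, phi)). field. apply Cexp_neq_0.
    + intros phi _.
      assert (Hid : Ccont (fun phi : R => (L, phi) : C) phi).
      { split; simpl; [apply continuous_const | apply continuous_id]. }
      assert (Hpr : Ccont (fun phi => proj (with_argument z phi)) phi).
      { assert (Hpr' : Ccont (fun phi : R => Cexp (L, phi)) phi) by now apply Ccont_Cexp.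
        destruct Hpr' as [C1 C2].
        split; [apply (continuous_ext (fun y => Re (Cexp (L, y)))) | apply (continuous_ext (fun y => Im (Cexp (L, y))))];
          try assumption; intros y; rewrite proj_Cexp; reflexivity. }
      unfold gamma_integrand, surf_pow. cbv zeta.
      apply Ccont_mult; [apply Ccont_mult; apply Ccont_Cexp|].
      * apply Ccont_mult; [apply Ccont_const | exact Hid].
      * now apply Ccont_opp.
      * apply Ccont_mult; [apply Ccont_const | exact Hpr].
Qed.

Lemma Cexp_pow a n : (Cexp a ^ n)%C = Cexp (RtoC (INR n) * a)%C.
Proof.
  induction n as [|n IH].
  - simpl INR. rewrite Cmult_0_l, Cexp_0. reflexivity.
  - rewrite Cpow_S, IH, <- Cexp_plus, S_INR, RtoC_plus. f_equal. ring.
Qed.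

Lemma exp_decay_power c n : 0 < c -> exists K, 0 <= K /\
  forall q, 1 <= q -> exp (- (c * q ^ 2)) <= K * (/ q) ^ n.
Proof.
  intros Hc. destruct (poly_exp_decay c n Hc) as [K [HK H]]. exists K. split; [exact HK|].
  intros q Hq. specialize (H q ltac:(lra)).
  apply (Rmult_le_reg_l (q ^ n)); [apply pow_lt; lra|].
  replace (q ^ n * (K * (/ q) ^ n)) with K; [exact H|].
  rewrite (Rmult_comm K), <- Rmult_assoc, <- Rpow_mult_distr, Rinv_r, pow1 by lra. ring.
Qed.

Lemma surf_pow_half z n :
  (/ surf_pow z (RtoC (INR n / 2)))%C = (polar (/ sqrt (modulus z)) (- (argument z / 2)) ^ n)%C.
Proof.
  assert (Hr := modulus_gt0 z). assert (Hq := sqrt_lt_R0 _ Hr).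
  replace (polar (/ sqrt (modulus z)) (- (argument z / 2))) with (Cexp (- (RtoC (1 / 2) * surf_log z))%C).
  - rewrite Cexp_pow. unfold surf_pow. rewrite <- Cexp_opp. f_equal.
    unfold Rdiv. rewrite !RtoC_mult. ring.
  - replace (- (RtoC (1 / 2) * surf_log z))%C with ((- (1 / 2 * ln (modulus z)), - (argument z / 2)) : C)
      by (apply C_eq; simpl; field).
    rewrite Cexp_polar, exp_Ropp. f_equal. f_equal.
    change (Rpower (modulus z) (1 / 2) = sqrt (modulus z)). replace (1 / 2) with (/ 2) by field.
    apply Rpower_sqrt, Hr.
Qed.

Theorem mainTheorem11 :
  forall delta : R, 0 < delta <= 2 * PI ->
    poincare_expansion
      (fun z : logsurf => Rabs (argument z) <= 2 * PI - delta)
      (fun z : logsurf =>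
         upper_gamma (proj z) z
         / (RtoC (sqrt (PI / 2)) * surf_pow z (proj z - RtoC (1 / 2))
            * Cexp (- proj z)))%C
      (fun n : nat => RtoC (coef n)).
Proof.
  intros delta [Hdelta _] N.
  destruct (local_expansion N) as [rho [K1 [Hrho [HK1 Hloc]]]].
  destruct (tail_bound delta rho Hdelta Hrho) as [K2 [c [HK2 [Hc Htail]]]].
  destruct (exp_decay_power c (N + 2) Hc) as [K3 [HK3 Hexp]].
  exists (K1 + K2 * K3), 1. split; [lra|]. intros z Hz Hr1.
  set (q := sqrt (modulus z)). set (th := argument z) in *.
  assert (Hq2 : q ^ 2 = modulus z) by (apply pow2_sqrt; lra).
  assert (Hq : 1 <= q) by (rewrite <- sqrt_1; apply sqrt_le_1; lra).
  assert (Hproj : proj z = polar (q ^ 2) th) by (rewrite Hq2; reflexivity).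
  destruct (Htail q th Hq Hz) as [G [HG1 HG2]]. rewrite <- Hproj in HG1.
  rewrite (upper_gamma_limit z G HG1).
  specialize (Hloc q th Hq). specialize (Hexp q Hq).
  set (ze := polar (/ q) (- (th / 2))).
  assert (Hqi : 0 < / q) by (apply Rinv_0_lt_compat; lra).
  assert (Hze : Cmod ze = / q) by (apply Cmod_polar; lra).
  assert (Hze0 : ze <> RtoC 0) by (apply polar_neq_0, Hqi).
  assert (HS := sqrt_PI2_ge_1).
  assert (HS0 : RtoC (sqrt (PI / 2)) <> RtoC 0) by (intros E; apply RtoC_inj in E; lra).
  assert (Hpow : surf_pow z (proj z - RtoC (1 / 2)) = (surf_pow z (proj z) * ze)%C).
  { replace ze with (ze ^ 1)%C by (simpl; ring). unfold ze, q, th. rewrite <- surf_pow_half.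
    unfold surf_pow. rewrite <- Cexp_opp, <- Cexp_plus. f_equal. simpl INR. ring. }
  assert (HGm : Cmod (G - truncated_expansion N q th)%C <= (K1 + K2 * K3) * (/ q) ^ (N + 2)).
  { rewrite <- Hproj in *. set (p := radial_primitive _ _) in *.
    replace (G - truncated_expansion N q th)%C with ((G - p) + (p - truncated_expansion N q th))%C by ring.
    eapply Rle_trans; [apply Cmod_triangle|].
    assert (K2 * exp (- (c * q ^ 2)) <= K2 * (K3 * (/ q) ^ (N + 2))) by now apply Rmult_le_compat_l. lra. }
  replace (surf_pow z (proj z) * Cexp (- proj z) * G
      / (RtoC (sqrt (PI / 2)) * surf_pow z (proj z - RtoC (1 / 2)) * Cexp (- proj z))
      - sum_n (fun n => RtoC (coef n) / surf_pow z (RtoC (INR n / 2))) N)%C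
    with ((G - truncated_expansion N q th) / (RtoC (sqrt (PI / 2)) * ze))%C.
  - unfold Cdiv. rewrite Cmod_mult, Cmod_inv, Cmod_mult, Cmod_R, Hze by now apply Cmult_neq_0.
    rewrite Rabs_pos_eq by lra.
    replace (Rpower (modulus z) (- (INR (N + 1) / 2))) with ((/ q) ^ (N + 1)).
    2:{ rewrite Rpower_Ropp, Rpower_half_nat by lra. apply pow_inv. }
    replace (N + 2)%nat with (S (N + 1)) in HGm by lia. simpl pow in HGm.
    apply (Rmult_le_reg_r (sqrt (PI / 2) * / q)); [nra|].
    rewrite Rmult_assoc, Rinv_l, Rmult_1_r by nra.
    eapply Rle_trans; [exact HGm|].
    assert (0 <= (K1 + K2 * K3) * (/ q * (/ q) ^ (N + 1))).
    { apply Rmult_le_pos; [nra|]. apply Rmult_le_pos; [lra | apply pow_le; lra]. }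
    nra.
  - assert (Em : (truncated_expansion N q th / (RtoC (sqrt (PI / 2)) * ze))%C = sum_n (fun n => RtoC (coef n) / surf_pow z (RtoC (INR n / 2)))%C N).
    { unfold Cdiv. rewrite Cmult_comm. unfold truncated_expansion. rewrite Csum_mult. apply sum_n_ext. intros n.
      rewrite surf_pow_half. fold q th ze.
      transitivity (RtoC (taylor (lagrange_power n) n * moment n) * ze ^ n / RtoC (sqrt (PI / 2)))%C.
      - rewrite RtoC_mult, Cpow_S.
        change (@eq C ((/ (RtoC (sqrt (PI / 2)) * ze) * (RtoC (taylor (lagrange_power n) n) * (RtoC (moment n) * (ze * ze ^ n))))%C)
          (RtoC (taylor (lagrange_power n) n) * RtoC (moment n) * ze ^ n / RtoC (sqrt (PI / 2)))%C). field. split; assumption.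
      - rewrite <- coef_moment, RtoC_mult.
        change (@eq C (RtoC (coef n) * RtoC (sqrt (PI / 2)) * ze ^ n / RtoC (sqrt (PI / 2)))%C
          (RtoC (coef n) * ze ^ n)%C). field. exact HS0. }
    rewrite <- Em, Hpow. field.
    repeat split; try assumption; apply Cexp_neq_0.
Qed.
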